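(* Let $(Z,d,\nu)$ be a locally compact, non-complete, bounded metric measure space, with $\nu$ a doubling measure. Suppose that $\partial Z:=\overline Z\setminus Z$ is equipped with a Borel measure $\pi$ which is codimension $\theta$ Ahlfors regular with respect to $\nu$ for some $\theta>0$. Let $1\le p<\infty$, $1\le q\le\infty$ and $\theta/p<\alpha<1$. Then there exists a bounded linear trace operator $$T:B^\alpha_{p,q}(Z,\nu)\to B^{\alpha-\theta/p}_{p,q}(\partial Z,\pi)$$ such that for all $u\in B^\alpha_{p,q}(Z,\nu)$ we have $$\lim_{r\to 0^+}\frac{1}{\nu(B(z,r))}\int_{B(z,r)}|u-Tu(z)|^p\,d\nu=0$$ for $\pi$-a.e. $z\in\partial Z$, and $$\|Tu\|_{HB^{\alpha-\theta/p}_{p,q}(\partial Z,\pi)}\le C\|u\|_{HB^\alpha_{p,q}(Z,\nu)},\qquad \|Tu\|_{L^p(\partial Z,\pi)}\le C\left(\|u\|_{L^p(Z,\nu)}+\|u\|_{HB^\alpha_{p,q}(Z,\nu)}\right),$$ where $C\ge 1$ depends only on $\alpha$, $p$, $q$, $\theta$, $\operatorname{diam}(Z)$, as well as the doubling and codimensional Ahlfors regularity constants. Furthermore, the bounded linear Whitney extension operator $\widetilde E:B^{\alpha-\theta/p}_{p,q}(\partial Z,\pi)\to B^\alpha_{p,q}(Z,\nu)$ (defined in the context) is a right-inverse of $T$: for all $f\in B^{\alpha-\theta/p}_{p,q}(\partial Z,\pi)$ we have $T\widetilde Ef(z)=f(z)$ for $\pi$-a.e. $z\in\partial Z$.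
   Context: Doubling: a Borel measure $\nu$ on a metric space is doubling if there is $C_\nu\ge 1$ (the doubling constant) with $0<\nu(B(x,2r))\le C_\nu\,\nu(B(x,r))<\infty$ for all points $x$ and all $r>0$. Boundary: $\overline Z$ is the metric completion of $Z$; since $Z$ is locally compact it is open in $\overline Z$. The measure $\nu$ is extended to $\overline Z$ by zero (i.e. $\nu(\partial Z)=0$). Balls $B(z,r)$ centered at $z\in\partial Z$ are balls of $\overline Z$. Codimension $\theta$ Ahlfors regularity: $\pi$ is codimension $\theta$ Ahlfors regular with respect to $\nu$ if there is $C_\theta\ge 1$ such that for all $z\in\partial Z$ and $0<r\le 2\operatorname{diam}(\partial Z)$, $$\frac{1}{C_\theta}\frac{\nu(B(z,r)\cap Z)}{r^\theta}\le\pi(B(z,r)\cap\partial Z)\le C_\theta\frac{\nu(B(z,r)\cap Z)}{r^\theta}.$$ Besov spaces: for a metric measure space $(X,d,\mu)$, $0<\alpha<1$, $1\le p<\infty$ and $f\in L^1_{\mathrm{loc}}(X,\mu)$, set $$\|f\|_{HB^\alpha_{p,q}(X,\mu)}:=\left(\int_0^\infty\left(\int_X\frac{1}{\mu(B(x,t))}\int_{B(x,t)}|f(y)-f(x)|^p\,d\mu(y)\,d\mu(x)\right)^{q/p}\frac{dt}{t^{\alpha q+1}}\right)^{1/q}$$ for $1\le q<\infty$, and $$\|f\|_{HB^\alpha_{p,\infty}(X,\mu)}:=\sup_{t>0}\frac{1}{t^{\alpha}}\left(\int_X\frac{1}{\mu(B(x,t))}\int_{B(x,t)}|f(y)-f(x)|^p\,d\mu(y)\,d\mu(x)\right)^{1/p}.$$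 $HB^\alpha_{p,q}(X,\mu)$ is the class of $f\in L^1_{\mathrm{loc}}(X,\mu)$ for which this seminorm is finite. The inhomogeneous Besov space is $B^\alpha_{p,q}(X,\mu):=HB^\alpha_{p,q}(X,\mu)\cap L^p(X,\mu)$ with norm $\|f\|_{HB^\alpha_{p,q}(X,\mu)}+\|f\|_{L^p(X,\mu)}$. Whitney extension operator $\widetilde E$: fix a countable Whitney cover $\{B_{i,j}=B(p_{i,j},r_{i,j})\}$ of $Z$ in $\overline Z$ by balls in $Z$ such that (i) $\bigcup_{i,j}B_{i,j}=Z$; (ii) $\sum_{i,j}\chi_{2B_{i,j}}\le 2C_\nu^5$; (iii) $2^{i-1}<r_{i,j}\le 2^i$ for all $i\in\mathbb Z$; (iv) $r_{i,j}=\frac18\operatorname{dist}(p_{i,j},\partial Z)$; (v) for each $i$ the points $\{p_{i,j}\}_j$ are $2^i/C$-separated (so for each $K\ge1$ there is $C_K\ge1$ with $\sum_j\chi_{KB_{i,j}}\le C_K$); together with a partition of unity $\{\varphi_{i,j}\}$ with $\varphi_{i,j}$ being $C/r_{i,j}$-Lipschitz, $0\le\varphi_{i,j}\le\chi_{2B_{i,j}}$ and $\sum_{i,j}\varphi_{i,j}=\chi_Z$, where $C$ depends only on $C_\nu$. (Such a cover and partition exist.) Let $q_{i,j}\in\partial Z$ be a closest point to $p_{i,j}$, and $U_{i,j}:=B(q_{i,j},r_{i,j})\cap\partial Z$. Then $$\widetilde Ef(x):=\sum_{i,j}\left(\frac{1}{\pi(U_{i,j})}\int_{U_{i,j}}f\,d\pi\right)\varphi_{i,j}(x),\qquad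 x\in Z.$$
   Formalization: The formal theorem assumes that ∂Z has positive diameter (for a one-point boundary the regularity condition is vacuous and the claim fails), and lets the constant in the L^p bound for Tu depend also on diam(∂Z), since dependence on diam(Z) alone is false. *)

(* Defs.v *)
From HB Require Import structures.
From mathcomp Require Import all_boot all_order all_algebra.
From mathcomp Require Import all_classical all_reals all_analysis.

Set Implicit Arguments.
Unset Strict Implicit.
Unset Printing Implicit Defensive.

Import Order.TTheory GRing.Theory Num.Theory.
Import numFieldNormedType.Exports.

Local Open Scope classical_set_scope.
Local Open Scope ring_scope.

#[short(type="completeMetricType")]
HB.structure Definition CompleteMetric (R : numDomainType) :=
  {W of CompletePseudoMetric R W & Metric R W}.

Notation borel W := (g_sigma_algebraType (@open W)).

(* A metric space Z together with its metric completion is a dense subset Z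
   of a complete metric space W, so that the boundary is W minus Z.
   A Borel measure on a subset X of W is a Borel measure on W that vanishes
   on the complement of X.  A function on X is a function on W of which only
   the values on X matter; the definitions below are relative to X. *)
Section relative_notions.
Context {R : realType} {W : completeMetricType R}.
Implicit Types (X Z : set W) (f g : W -> R).
Implicit Types mu nu pi eta : {measure set (borel W) -> \bar R}.

Definition boundary Z : set W := ~` Z.

Definition diam X : R := sup [set mdist x y | x in X & y in X].

Definition metric_bounded X : Prop :=
  exists M : R, forall x y, X x -> X y -> mdist x y <= M.

(* The library's [locally_compact X] asks for compact neighbourhoods in the
   ambient space W; here they have to lie in X. *)
Definition locally_compact_in X : Prop :=
  forall x, X x -> exists2 K : set W, K `<=` X /\ compact K & within X (nbhs x) K.

Definition complete_in X : Prop :=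
  forall u : nat -> W, (forall n, X (u n)) -> cauchy (u @ \oo) ->
    exists2 x, X x & u @ \oo --> x.

Definition doubling mu X (C : R) : Prop :=
  forall x (r : R), X x -> 0 < r ->
    [/\ (0 < mu (ball x (2 * r) `&` X))%E,
        (mu (ball x (2 * r) `&` X) <= C%:E * mu (ball x r `&` X))%E &
        (C%:E * mu (ball x r `&` X) < +oo)%E].

Definition codim_regular nu pi Z (theta C : R) : Prop :=
  forall z (r : R), boundary Z z -> 0 < r -> r <= 2 * diam (boundary Z) ->
    (((C^-1)%:E * (nu (ball z r `&` Z) / (r `^ theta)%:E)
        <= pi (ball z r `&` boundary Z)) /\
     (pi (ball z r `&` boundary Z)
        <= C%:E * (nu (ball z r `&` Z) / (r `^ theta)%:E)))%E.

Definition ball_avg mu X (g : W -> \bar R) (x : W) (t : R) : \bar R :=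
  ((mu (ball x t `&` X))^-1 * \int[mu]_(y in ball x t `&` X) g y)%E.

Definition besov_osc mu X (p : R) f (t : R) : \bar R :=
  (\int[mu]_(x in X) ball_avg mu X (fun y => (`|f y - f x| `^ p)%:E) x t)%E.

(* The last branch is meant for q = +oo; q = -oo never occurs. *)
Definition besov_seminorm mu X (alpha p : R) (q : \bar R) f : \bar R :=
  match q with
  | q'%:E => ((\int[lebesgue_measure]_(t in `]0%R, +oo[%classic)
      (besov_osc mu X p f t `^ (q' / p) / (t `^ (alpha * q' + 1))%:E)) `^ q'^-1)%E
  | _ => ereal_sup [set (((t `^ alpha)^-1)%:E * besov_osc mu X p f t `^ p^-1)%E
                   | t in `]0, +oo[]
  end.

Definition Lp_norm mu X (p : R) f : \bar R :=
  ('N[mu]_(p%:E)[EFin \o ((f : borel W -> R) \_ X)])%E.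

Definition locally_integrable_on mu X f : Prop :=
  measurable_fun (X : set (borel W)) (f : borel W -> R) /\
  forall x, X x -> exists2 r : R, 0 < r &
    mu.-integrable (ball x r `&` X) (EFin \o f).

Definition besov_space mu X (alpha p : R) (q : \bar R) f : Prop :=
  [/\ locally_integrable_on mu X f,
      (besov_seminorm mu X alpha p q f < +oo)%E &
      (Lp_norm mu X p f < +oo)%E].

Definition besov_norm mu X (alpha p : R) (q : \bar R) f : \bar R :=
  (besov_seminorm mu X alpha p q f + Lp_norm mu X p f)%E.

(* T induces a bounded linear operator from B^alpha_{p,q}(X, mu) to
   B^beta_{p,q}(Y, eta), whose elements are classes of functions modulo
   equality almost everywhere. *)
Definition bounded_linear_besov mu X (alpha : R) eta (Y : set W) (beta : R)
    (p : R) (q : \bar R) (T : (W -> R) -> (W -> R)) : Prop :=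
  [/\ forall u, besov_space mu X alpha p q u -> besov_space eta Y beta p q (T u),
      forall u v, besov_space mu X alpha p q u -> besov_space mu X alpha p q v ->
        {ae mu, forall x, X x -> u x = v x} ->
        {ae eta, forall y, Y y -> T u y = T v y},
      forall (a : R) u v,
        besov_space mu X alpha p q u -> besov_space mu X alpha p q v ->
        {ae eta, forall y, Y y ->
          T (fun x => a * u x + v x) y = a * T u y + T v y} &
      exists C : R, forall u, besov_space mu X alpha p q u ->
        (besov_norm eta Y beta p q (T u) <= C%:E * besov_norm mu X alpha p q u)%E].

End relative_notions.

(* The pair (i, j) in wh_index stands for the ball B(p_ij, r_ij), with i the
   scale; wh_foot is q_ij. *)
Record whitney_data (R : realType) (W : completeMetricType R) := WhitneyData {
  wh_index : set (int * nat);
  wh_center : int * nat -> W;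
  wh_radius : int * nat -> R;
  wh_foot : int * nat -> W;
  wh_part : int * nat -> W -> R
}.

(* The bounded overlap of the dilated balls K B_ij at a fixed scale i follows
   from the separation of the centers and the doubling property. *)
Record is_whitney (R : realType) (W : completeMetricType R) (Z : set W)
    (Cnu C : R) (w : whitney_data W) : Prop := IsWhitney {
  wh_cover : \bigcup_(k in wh_index w) ball (wh_center w k) (wh_radius w k) = Z;
  wh_overlap : forall x,
    (\esum_(k in wh_index w)
       (\1_(ball (wh_center w k) (2 * wh_radius w k)) x)%:E
     <= (2 * Cnu ^+ 5)%:E)%E;
  wh_scale : forall k, wh_index w k ->
    (2 : R) ^ (k.1 - 1) < wh_radius w k /\ wh_radius w k <= (2 : R) ^ k.1;
  wh_dist : forall k, wh_index w k ->
    (wh_radius w k)%:E = ((8^-1)%:E * edist_inf (boundary Z) (wh_center w k))%E;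
  wh_separated : forall i j j', wh_index w (i, j) -> wh_index w (i, j') ->
    j != j' -> (2 : R) ^ i / C <= mdist (wh_center w (i, j)) (wh_center w (i, j'));
  wh_lipschitz : forall k x y, wh_index w k -> Z x -> Z y ->
    `|wh_part w k x - wh_part w k y| <= C / wh_radius w k * mdist x y;
  wh_support : forall k x, wh_index w k ->
    0 <= wh_part w k x /\
    wh_part w k x <= \1_(ball (wh_center w k) (2 * wh_radius w k)) x;
  wh_partition : forall x,
    (\esum_(k in wh_index w) (wh_part w k x)%:E = (\1_Z x)%:E)%E;
  wh_closest : forall k, wh_index w k -> boundary Z (wh_foot w k) /\
    forall z, boundary Z z ->
      mdist (wh_center w k) (wh_foot w k) <= mdist (wh_center w k) z
}.

(* By the bounded overlap the sum has finitely many nonzero terms at each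
   point, so that the finitely supported sum of the library is the series. *)
Definition whitney_extension (R : realType) (W : completeMetricType R)
    (Z : set W) (pi : {measure set (borel W) -> \bar R}) (w : whitney_data W)
    (f : W -> R) (x : W) : R :=
  \sum_(k \in wh_index w)
    (let U := ball (wh_foot w k) (wh_radius w k) `&` boundary Z in
     (fine (pi U))^-1 * (\int[pi]_(z in U) f z)%R * wh_part w k x).

(* Main.v *)
Require Import Defs.
From HB Require Import structures.
From mathcomp Require Import all_boot all_order all_algebra.
From mathcomp Require Import all_classical all_reals all_analysis measurable_realfun.
From mathcomp Require Import ring lra zify.

(** The two operators are estimated scale by scale.  Write [osc t] for the integral
    over the space of the means of [|f y - f x| `^ p] over the balls of radius [t]
    around [x].  Doubling makes [osc] almost increasing, so that a Besov seminorm
    is comparable to an [l^q] norm of a weighted dyadic sequence of oscillations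
    ([lqnorm_le_seminorm], [seminorm_le_lqnorm]), and an estimate of the
    oscillations of an image by a geometrically weighted sum of oscillations of
    the preimage becomes an estimate of seminorms ([lqnorm_convolution]).

    The trace of [u] at a boundary point [z] is the limit of the means of [u] over
    the dyadic balls around [z].  By Jensen's inequality the [p]-th power of the
    difference of two successive means is at most a mean of the local oscillation
    of [u] over a ball around [z].  Integrating over the boundary turns such a
    mean at radius [r] into at most a constant times [r `^ (- theta) * osc (4 * r)],
    by Tonelli's theorem and the codimension condition ([integral_wavg_le],
    [integral_boundary_wavg_le]).  Since [alpha > theta / p], these quantities decay
    geometrically; summed with slowly growing weights they give, at almost every
    boundary point, geometric convergence of the means to the trace, also in the
    [p]-th mean ([trace_avg_cvg], [trace_limit]), and they bound the oscillation
    of the trace at scale [k] by those of [u] at finer scales ([osc_trace_le]).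
    The resulting weight is that of the exponent [alpha - theta / p]
    ([trace_seminorm_le]).  The [L^p] bound compares the trace with the mean over
    the largest ball ([integral_trace_le]).

    For the Whitney extension [F] of [f], consider the oscillation at the scale [t].
    At a point whose distance [s] to the boundary is large compared with [t], the
    partition of unity is Lipschitz at the scale [s], and the oscillation is at
    most [(t / s) `^ p] times that of [f] at the scale [s] ([F_dist_far]).  Closer to
    the boundary, the values of [F] are compared with those of [f] at nearby
    boundary points ([F_dist_near], [Phi_le_near_bound]).  The layer of points at
    distance about [s] from the boundary contributes the factor [s `^ theta], again
    by Tonelli's theorem ([integral_boundary_avg_le]).  Summed over the layers this
    gives [osc_ext_le], and the geometric factor that remains for the exponent
    [alpha] is smaller than one because [alpha < 1] ([extension_seminorm_le]).

    The same estimate near the boundary shows that [F] tends to [f] in the [p]-th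
    mean over dyadic balls around almost every boundary point
    ([integral_ext_dist_le]).  As [F] also tends to its trace in this sense, the
    trace of the extension is [f] ([trace_extension]).

    Several points are specific to the setting.  The completion is separable and
    doubling because the domain is bounded and doubling ([separable_of_doubling],
    [nu_doubling]); separability puts the set of pairs at distance less than [t]
    into the product of the Borel sigma-algebras, on which all uses of Tonelli's
    theorem rest.  Functions on a subset of full measure are extended by zero, so
    that all integrals are over the whole space ([besov_spaceP]). *)

Set Implicit Arguments.
Unset Strict Implicit.
Unset Printing Implicit Defensive.

Import Order.TTheory GRing.Theory Num.Theory.
Import numFieldNormedType.Exports.

Local Open Scope classical_set_scope.
Local Open Scope ring_scope.

(** * Integration without measurability, and iterated integrals over balls *)

Ltac posr := try (apply: ltW); repeat first
  [ assumption | done | apply: mulr_gt0 | apply: addr_gt0 | apply: powR_gt0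
  | apply: exprn_gt0 | rewrite invr_gt0 ].

Section Integration.
Context {d : measure_display} {T : measurableType d} {R : realType}.
Variable mu : {measure set T -> \bar R}.
Local Open Scope ereal_scope.
Import HBNNSimple.

(** The integral of a nonnegative function is a supremum over simple minorants,
    hence monotone on all nonnegative functions.  Integrands such as
    [x |-> ball_avg mu X g x t] can therefore be estimated before their
    measurability is known. *)
Lemma le_integralT (f g : T -> \bar R) :
  (forall x, 0 <= f x) -> (forall x, f x <= g x) ->
  \int[mu]_x f x <= \int[mu]_x g x.
Proof.
move=> f0 fg; have g0 x : 0 <= g x by exact: le_trans (fg x).
rewrite !ge0_integralTE//; apply: ge_ereal_sup => _ [h hf <-].
by apply: ereal_sup_ubound; exists h => // x; exact: le_trans (fg x).
Qed.

Lemma le_integral_set (D E : set T) (f g : T -> \bar R) :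
  D `<=` E -> (forall x, E x -> 0 <= g x) ->
  (forall x, D x -> 0 <= f x) -> (forall x, D x -> f x <= g x) ->
  \int[mu]_(x in D) f x <= \int[mu]_(x in E) g x.
Proof.
move=> DE g0 f0 fg; rewrite [leLHS]integral_mkcond [leRHS]integral_mkcond.
apply: le_integralT => x; rewrite /patch; first by case: ifPn => // /set_mem/f0.
case: ifPn => [/set_mem Dx|_].
  by have Ex := DE _ Dx; rewrite mem_set// fg.
by case: ifPn => // /set_mem/g0.
Qed.

Lemma le_integral_in (D : set T) (f g : T -> \bar R) :
  (forall x, D x -> 0 <= f x) -> (forall x, D x -> f x <= g x) ->
  \int[mu]_(x in D) f x <= \int[mu]_(x in D) g x.
Proof.
move=> f0 fg; apply: le_integral_set => // x Dx.
exact: le_trans (f0 _ Dx) (fg _ Dx).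
Qed.

(** Multiplying simple minorants by a constant is invertible, so that
    homogeneity holds for all nonnegative functions, measurable or not. *)
Lemma integralZl_nonneg (D : set T) (f : T -> \bar R) (k : R) :
  (0 <= k)%R -> (forall x, D x -> 0 <= f x) ->
  \int[mu]_(x in D) (k%:E * f x) = k%:E * \int[mu]_(x in D) f x.
Proof.
have le_Z (g : T -> \bar R) (c : R) : (0 < c)%R -> (forall x, 0 <= g x) ->
    c%:E * \int[mu]_x g x <= \int[mu]_x (c%:E * g x).
  move=> c0 g0; have cg0 x : 0 <= c%:E * g x by rewrite mule_ge0// lee_fin ltW.
  rewrite -lee_pdivlMl//; rewrite [leLHS]ge0_integralTE//.
  apply: ge_ereal_sup => _ [h hg <-].
  rewrite lee_pdivlMl// -integralT_nnsfun -ge0_integralZl_EFin//; last 3 first.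
  - by move=> x _; rewrite lee_fin.
  - exact/measurable_EFinP.
  - exact: ltW.
  apply: le_integralT => x; first by rewrite mule_ge0// lee_fin// ltW.
  by rewrite lee_wpmul2l// ?lee_fin ?ltW.
rewrite le_eqVlt => /predU1P[<-|k0] f0.
  by rewrite mul0e; apply: integral0_eq => x _; rewrite mul0e.
rewrite [LHS]integral_mkcond [in RHS]integral_mkcond.
have -> : (fun x => k%:E * f x) \_ D = (fun x => k%:E * (f \_ D) x).
  by apply/funext => x; rewrite /patch; case: ifP; rewrite ?mule0.
have fD0 x : 0 <= (f \_ D) x by rewrite /patch; case: ifPn => // /set_mem/f0.
apply/eqP; rewrite eq_le le_Z// andbT -lee_pdivrMl//.
have := @le_Z (fun x => k%:E * (f \_ D) x) k^-1%R.
rewrite invr_gt0 => /(_ k0) kZ; apply: le_trans (kZ _) _ => [x|].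
  by rewrite mule_ge0// lee_fin ltW.
apply: le_integralT => x; first by rewrite !mule_ge0// ?lee_fin ?invr_ge0 ltW.
by rewrite muleA -EFinM mulVf ?mul1e// gt_eqF.
Qed.

(** A measure on a subset [X] is a measure on the whole space that vanishes off
    [X]; this lemma moves between the integrals over [X] and over the space. *)
Lemma integral_null_compl (X D : set T) (f : T -> \bar R) :
  measurable X -> mu (~` X) = 0 -> measurable D ->
  measurable_fun D f -> (forall x, D x -> 0 <= f x) ->
  \int[mu]_(x in D `&` X) f x = \int[mu]_(x in D) f x.
Proof.
move=> mX X0 mD mf f0.
rewrite [RHS](ge0_negligible_integral (measurableC mX) mD mf f0 X0).
by rewrite setDE setCK.
Qed.

Lemma measure_setI_null (X B : set T) : measurable X -> mu (~` X) = 0 ->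
  measurable B -> mu (B `&` X) = mu B.
Proof.
move=> mX X0 mB.
have := integral_null_compl mX X0 mB (measurable_cst (1 : \bar R)) (fun _ _ => lee01).
by rewrite !integral_cst ?mul1e//; exact: measurableI.
Qed.

End Integration.

Section BorelMetric.
Context {R : realType} {W : completeMetricType R}.
Implicit Types (x y z : W) (r s t : R).

Definition separable_metric := exists e : nat -> W,
  forall x r, 0 < r -> exists n, ball (e n) r x.

Lemma in_ball x r y : ball x r y = (mdist x y < r) :> Prop.
Proof. by rewrite ballEmdist. Qed.

Lemma ball_symE x r y : ball x r y = ball y r x :> Prop.
Proof. by rewrite !in_ball metric_sym. Qed.

Lemma sub_ball x y r s : mdist x y + r <= s -> ball y r `<=` ball x s.
Proof.
move=> rs z; rewrite !in_ball => yz.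
by apply: le_lt_trans (metric_triangle _ y _) _; apply: lt_le_trans rs; rewrite ltrD2l.
Qed.

Lemma sub_ballr x r s : r <= s -> ball x r `<=` ball x s.
Proof. by move=> rs; apply: sub_ball; rewrite mdistxx add0r. Qed.

Lemma ball_open_metric x r : open (ball x r).
Proof.
rewrite openE => y; rewrite in_ball => xy; apply/nbhs_ballP.
exists (r - mdist x y) => /=; first by rewrite subr_gt0.
by apply: sub_ball; rewrite addrCA subrr addr0.
Qed.

Lemma open_borel (A : set W) : open A -> measurable (A : set (borel W)).
Proof. exact: sub_sigma_algebra. Qed.

Lemma measurable_ball_metric x r : measurable (ball x r : set (borel W)).
Proof. by apply: open_borel; apply: ball_open_metric. Qed.

Definition near_pairs r : set (borel W * borel W) :=
  [set xy | ball (xy.1 : W) r xy.2].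

(** Second countability puts the open set of pairs at distance less than [r]
    into the product of the Borel sigma-algebras. *)
Lemma measurable_near (sep : separable_metric) r : measurable (near_pairs r).
Proof.
have [e he] := sep.
pose cell (nk : nat * rat) : set (borel W * borel W) :=
  ball (e nk.1) (ratr nk.2) `*` ball (e nk.1) (r - ratr nk.2).
suff -> : near_pairs r = \bigcup_nk cell nk.
  apply: countable_bigcupT_measurable => [|nk]; first exact: countableP; apply: measurableX; exact: measurable_ball_metric.
rewrite /near_pairs.
apply/seteqP; split=> [[x y]/=|[x y] [[n k] _ [/=]]]; rewrite !in_ball; last first.
  move=> nx ny; apply: le_lt_trans (metric_triangle _ (e n) _) _.
  by rewrite metric_sym -(subrK (ratr k) r) addrC ltrD.
move=> xy; pose c := (r - mdist x y) / 2.
have c0 : 0 < c by rewrite divr_gt0// subr_gt0.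
have [n] := he x (c / 2) ltac:(by rewrite divr_gt0); rewrite in_ball => nx.
have /rat_in_itvoo[k] : mdist (e n) x < c / 2 by [].
rewrite in_itv/= => /andP[k1 k2].
exists (n, k) => //; split => /=; rewrite in_ball//.
apply: le_lt_trans (metric_triangle _ x _) _.
have : mdist x y = r - c * 2 by rewrite /c; field.
by move: nx k1 k2 c0; lra.
Qed.

End BorelMetric.
Arguments separable_metric {R} W.

Section IteratedIntegrals.
Context {R : realType} {W : completeMetricType R}.
Implicit Types (mu eta : {measure set (borel W) -> \bar R}).
Local Open Scope ereal_scope.

Definition finite_total mu := mu setT < +oo.

(** Tonelli's theorem is stated for bundled sigma-finite measures; a finite
    measure is restated as one. *)
Lemma sigma_finite_copy mu : finite_total mu ->
  exists m : {sigma_finite_measure set (borel W) -> \bar R},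
    mu = m :> {measure set (borel W) -> \bar R}.
Proof.
move=> fin; exists (mfrestr measurableT fin); apply/eq_measure/funext => A /=.
by rewrite /mfrestr /mrestr setIT.
Qed.

Lemma fin_num_finite_total mu (A : set (borel W)) : finite_total mu ->
  measurable A -> mu A \is a fin_num.
Proof.
move=> fin mA; rewrite ge0_fin_numE//; apply: le_lt_trans fin.
by apply: le_measure => //; rewrite inE.
Qed.

Definition vol mu (x : W) (r : R) : R := fine (mu (ball x r)).

Lemma volE mu x r : finite_total mu -> mu (ball x r) = (vol mu x r)%:E.
Proof.
move=> fin; rewrite fineK//; apply: fin_num_finite_total => //.
exact: measurable_ball_metric.
Qed.

Lemma vol_ge0 mu x r : (0 <= vol mu x r)%R.
Proof. exact/fine_ge0. Qed.

Lemma le_vol mu x y r s : finite_total mu -> (mdist x y + r <= s)%R ->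
  (vol mu y r <= vol mu x s)%R.
Proof.
move=> fin rs; rewrite -lee_fin -!volE//.
by apply: le_measure; rewrite ?inE; [exact: measurable_ball_metric..|exact: sub_ball].
Qed.

(** The average over a ball with respect to [eta], normalised by the
    [nu]-volume of the ball: with [nu = eta] this is the mean value, and with
    [eta] the boundary measure it transports functions on the boundary to the
    whole space. *)
Definition wavg nu eta (t : R) (g : W -> \bar R) (x : W) : \bar R :=
  ((vol nu x t)^-1)%:E * \int[eta]_(y in ball x t) g y.

Lemma wavg_ge0 nu eta t g x : (forall y, 0 <= g y) -> 0 <= wavg nu eta t g x.
Proof.
move=> g0; apply: mule_ge0; first by rewrite lee_fin invr_ge0 vol_ge0.
exact: integral_ge0.
Qed.

(** An integral over a ball that depends on its centre is a section integral over
    the measurable set of near pairs; in this form Tonelli's theorem applies. *)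
Lemma integral_ball_patch eta (h : borel W * borel W -> \bar R) x t :
  \int[eta]_(y in ball x t) h (x, y) =
  \int[eta]_y (h \_ (near_pairs t)) (x, y).
Proof.
rewrite [LHS]integral_mkcond; apply: eq_integral => y _; rewrite /patch.
by congr (if _ then _ else _); apply/idP/idP; rewrite !inE.
Qed.

Section Measurability.
Hypothesis sep : separable_metric W.

Let measurable_patch_near (h : borel W * borel W -> \bar R) t :
  measurable_fun setT h ->
  measurable_fun setT (h \_ (near_pairs t)).
Proof.
move=> mh; apply/(measurable_restrictT _ _).1; first exact: measurable_near.
exact: measurable_funTS.
Qed.

Let patch_near_ge0 (h : borel W * borel W -> \bar R) t : (forall xy, 0 <= h xy) ->
  forall xy, 0 <= (h \_ (near_pairs t)) xy.
Proof. by move=> h0 xy; rewrite /patch; case: ifP. Qed.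

Lemma measurable_ball_integral eta (h : borel W * borel W -> \bar R) t :
  finite_total eta -> measurable_fun setT h -> (forall xy, 0 <= h xy) ->
  measurable_fun setT (fun x : borel W => \int[eta]_(y in ball x t) h (x, y)).
Proof.
move=> /sigma_finite_copy[m ->] mh h0.
rewrite (_ : (fun x => _) = fubini_F m (h \_ (near_pairs t))).
  by apply: measurable_fun_fubini_tonelli_F; [exact: measurable_patch_near|exact: patch_near_ge0].
by apply/funext => x; rewrite integral_ball_patch.
Qed.

Lemma swap_ball_integral mu eta (h : borel W * borel W -> \bar R) t :
  finite_total mu -> finite_total eta ->
  measurable_fun setT h -> (forall xy, 0 <= h xy) ->
  \int[mu]_x \int[eta]_(y in ball x t) h (x, y) =
  \int[eta]_y \int[mu]_(x in ball y t) h (x, y).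
Proof.
move=> /sigma_finite_copy[m ->] /sigma_finite_copy[e ->] mh h0.
under eq_integral do rewrite integral_ball_patch.
rewrite (fubini_tonelli _ (measurable_patch_near t mh) (patch_near_ge0 t h0)).
apply: eq_integral => y _; rewrite [RHS]integral_mkcond.
apply: eq_integral => x _; rewrite /patch.
by congr (if _ then _ else _); apply/idP/idP; rewrite !inE /near_pairs/= ball_symE.
Qed.

Lemma swap_set_integral mu eta (h : borel W * borel W -> \bar R) (B C : set (borel W)) :
  finite_total mu -> finite_total eta -> measurable B -> measurable C ->
  measurable_fun setT h -> (forall xy, 0 <= h xy) ->
  \int[mu]_(x in B) \int[eta]_(y in C) h (x, y) =
  \int[eta]_(y in C) \int[mu]_(x in B) h (x, y).
Proof.
move=> /sigma_finite_copy[m ->] /sigma_finite_copy[e ->] mB mC mh h0.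
have mp : measurable_fun setT (h \_ (B `*` C)).
  by apply/(measurable_restrictT _ _).1; [exact: measurableX|exact: measurable_funTS].
have p0 xy : 0 <= (h \_ (B `*` C)) xy by rewrite /patch; case: ifP.
have pE x y : (h \_ (B `*` C)) (x, y) =
    if x \in B then if y \in C then h (x, y) else 0 else 0.
  by rewrite /patch in_setX; case: (x \in B).
transitivity (\int[m]_x \int[e]_y (h \_ (B `*` C)) (x, y)).
  rewrite [LHS]integral_mkcond; apply: eq_integral => x _; rewrite [LHS]/patch.
  under [RHS]eq_integral do rewrite pE.
  case: ifPn => _; last by rewrite integral0.
  by rewrite [LHS]integral_mkcond; apply: eq_integral => y _; rewrite /patch.
rewrite (fubini_tonelli _ mp p0).
rewrite [RHS]integral_mkcond; apply: eq_integral => y _; rewrite [RHS]/patch.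
under [LHS]eq_integral do rewrite pE.
case: ifPn => _; last by apply: integral0_eq => x _; case: ifP.
by rewrite [RHS]integral_mkcond; apply: eq_integral => x _; rewrite /patch.
Qed.

Lemma measurable_vol mu t : finite_total mu ->
  measurable_fun setT (fun x : borel W => vol mu x t).
Proof.
move=> fin; rewrite (_ : (fun x => _) =
    fine \o (fun x : borel W => \int[mu]_(y in ball x t) (cst 1 (x, y)))).
  apply: measurableT_comp; first exact: fine_measurable.
  by apply: measurable_ball_integral => //; exact: measurable_cst.
apply/funext => x /=; rewrite integral_cst ?mul1e//.
exact: measurable_ball_metric.
Qed.

Lemma measurable_volV mu t : finite_total mu ->
  measurable_fun setT (fun x : borel W => (vol mu x t)^-1%R).
Proof.
move=> fin; rewrite (_ : (fun x => _) =
    (@powR R ^~ (-1)%R) \o (fun x : borel W => vol mu x t)).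
  by apply: measurableT_comp; [exact: measurable_powR|exact: measurable_vol].
by apply/funext => x /=; rewrite powR_inv1// vol_ge0.
Qed.

Lemma measurable_wavg2 nu eta t (h : borel W * borel W -> \bar R) :
  finite_total nu -> finite_total eta ->
  measurable_fun setT h -> (forall xy, 0 <= h xy) ->
  measurable_fun setT (fun x : borel W => wavg nu eta t (fun y => h (x, y)) x).
Proof.
move=> fnu feta mh h0; apply: emeasurable_funM.
  by apply/measurable_EFinP; exact: measurable_volV.
exact: measurable_ball_integral.
Qed.

Lemma measurable_wavg nu eta t (g : borel W -> \bar R) :
  finite_total nu -> finite_total eta ->
  measurable_fun setT g -> (forall x, 0 <= g x) ->
  measurable_fun setT (wavg nu eta t g : borel W -> \bar R).
Proof.
move=> fnu feta mg g0; apply: (@measurable_wavg2 _ _ _ (g \o snd)) => // [|xy]; last exact: g0.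
by apply: measurableT_comp => //; exact: measurable_snd.
Qed.

(** The case of a constant integrand, for a fixed centre [y]: the reciprocal
    volumes of the balls that contain [y] are comparable to that of [ball y t]. *)
Lemma wavg_cst_le mu nu (X : set W) (C t : R) (y : W) :
  finite_total mu -> finite_total nu ->
  measurable (X : set (borel W)) -> mu (~` X) = 0 -> (0 <= C)%R ->
  (forall z, X z -> ball y t z -> (0 < vol nu z t)%R /\ (vol mu y t <= C * vol nu z t)%R) ->
  \int[mu]_(z in ball y t) ((vol nu z t)^-1)%:E <= C%:E.
Proof.
move=> fmu fnu mX X0 C0 hC.
have mB := measurable_ball_metric y t.
have mw : measurable_fun (ball y t : set (borel W)) (fun z => ((vol nu z t)^-1)%:E).
  by apply/measurable_EFinP; apply: measurable_funTS; exact: measurable_volV.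
have w0 z : 0 <= ((vol nu z t)^-1)%:E by rewrite lee_fin invr_ge0 vol_ge0.
have [v0|v0] := eqVneq (vol mu y t) 0%R.
  rewrite (_ : integral _ _ _ = 0) ?lee_fin//.
  rewrite (ge0_negligible_integral mB mB mw) ?setDv ?integral_set0//.
  by rewrite volE// v0.
rewrite -(integral_null_compl mX X0 mB mw)//.
have v1 : (0 < vol mu y t)%R by rewrite lt_neqAle eq_sym v0 vol_ge0.
apply: (@le_trans _ _ (\int[mu]_(z in ball y t `&` X) (C / vol mu y t)%:E)).
  apply: le_integral_in => // z [yz Xz]; rewrite lee_fin.
  have [z0 zC] := hC z Xz yz.
  by rewrite -div1r ler_pdivrMr// mulrAC ler_pdivlMr// mul1r.
rewrite integral_cst; last exact: measurableI.
apply: (@le_trans _ _ ((C / vol mu y t)%:E * (vol mu y t)%:E)); last first.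
  by rewrite -EFinM lee_fin mulfVK.
apply: lee_wpmul2l; first by rewrite lee_fin divr_ge0// vol_ge0.
by rewrite -volE//; apply: le_measure; rewrite ?inE//; exact: measurableI.
Qed.

(** Fubini for averaging operators: by Tonelli the mass that a point [y]
    contributes is the integral of the reciprocal volumes of the balls that
    contain it, and comparing these volumes with that of the ball centred at [y]
    bounds it. *)
Lemma integral_wavg_le mu nu eta (X Y : set W) (C t : R) (g : borel W -> \bar R) :
  finite_total mu -> finite_total nu -> finite_total eta ->
  measurable (X : set (borel W)) -> mu (~` X) = 0 ->
  measurable (Y : set (borel W)) -> eta (~` Y) = 0 ->
  (0 < C)%R ->
  (forall y z, Y y -> X z -> ball y t z ->
    (0 < vol nu z t)%R /\ (vol mu y t <= C * vol nu z t)%R) ->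
  measurable_fun setT g -> (forall x, 0 <= g x) ->
  \int[mu]_z wavg nu eta t g z <= C%:E * \int[eta]_y g y.
Proof.
move=> fmu fnu feta mX X0 mY Y0 C0 hC mg g0.
pose h (zy : borel W * borel W) : \bar R := ((vol nu zy.1 t)^-1)%:E * g zy.2.
have h0 zy : 0 <= h zy by rewrite mule_ge0// lee_fin invr_ge0 vol_ge0.
have mh : measurable_fun setT h.
  apply: emeasurable_funM; last by apply: measurableT_comp => //; exact: measurable_snd.
  apply/measurable_EFinP; apply: (measurableT_comp (measurable_volV t fnu)).
  exact: measurable_fst.
have -> : \int[mu]_z wavg nu eta t g z = \int[mu]_z \int[eta]_(y in ball z t) h (z, y).
  apply: eq_integral => z _; rewrite /wavg /h/= integralZl_nonneg//.
  by rewrite invr_ge0 vol_ge0.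
rewrite swap_ball_integral// -integralZl_nonneg//; last exact: ltW.
have mG : measurable_fun setT (fun y : borel W => \int[mu]_(z in ball y t) h (z, y)).
  apply: (@measurable_ball_integral mu (fun yz => h (yz.2, yz.1))) => //.
  by apply: measurableT_comp => //; exact: measurable_swap.
rewrite -(integral_null_compl mY Y0 measurableT mG); last first.
  by move=> y _; exact: integral_ge0.
apply: le_integral_set => //.
- by move=> y _; rewrite mule_ge0// lee_fin ltW.
- by move=> y _; exact: integral_ge0.
move=> y [_ Yy]; rewrite /h/=.
under eq_integral do rewrite muleC.
have [gy|gy] := eqVneq (g y) +oo.
  by rewrite gy gt0_muley ?leey// lte_fin.
have gf : g y \is a fin_num by rewrite ge0_fin_numE// lt_neqAle gy leey.
rewrite -(fineK gf) integralZl_nonneg//; last 2 first.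
- exact/fine_ge0.
- by move=> x _; rewrite lee_fin invr_ge0 vol_ge0.
rewrite [leRHS]muleC; apply: lee_wpmul2l; first by rewrite fineK.
by apply: (wavg_cst_le _ _ mX X0 (ltW C0)) => // z Xz yz; exact: hC.
Qed.

End Measurability.

Lemma measurable_pow_dist (f g : borel W -> R) (p : R) :
  measurable_fun setT f -> measurable_fun setT g ->
  measurable_fun setT
    (fun xy : borel W * borel W => (`|g xy.2 - f xy.1| `^ p)%:E).
Proof.
move=> mf mg; apply/measurable_EFinP.
apply: (measurableT_comp (f := @powR R ^~ p)); first exact: measurable_powR.
apply: measurableT_comp; first exact: normr_measurable.
apply: measurable_funB; first by apply: measurableT_comp => //; exact: measurable_snd.
by apply: measurableT_comp => //; exact: measurable_fst.
Qed.

Lemma measurable_powR_norm (f : borel W -> R) (p : R) : measurable_fun setT f ->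
  measurable_fun setT (fun x : borel W => (`|f x| `^ p)%:E).
Proof.
move=> mf; apply/measurable_EFinP; apply: (measurableT_comp (f := @powR R ^~ p)).
  exact: measurable_powR.
by apply: measurableT_comp mf; exact: normr_measurable.
Qed.

Lemma measurable_powR_dist (f : borel W -> R) (c p : R) : measurable_fun setT f ->
  measurable_fun setT (fun x : borel W => (`|f x - c| `^ p)%:E).
Proof.
move=> mf; apply: (measurable_powR_norm p (f := fun x => f x - c)%R).
exact: (measurable_funB mf (measurable_cst c)).
Qed.

End IteratedIntegrals.

(** * Discrete Besov norms *)

Section Series.
Context {R : realType}.
Local Open Scope ereal_scope.

Lemma nneseries_le (u : nat -> \bar R) (M : \bar R) : (forall k, 0 <= u k) ->
  (forall n, \sum_(0 <= k < n) u k <= M) -> \sum_(0 <= k <oo) u k <= M.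
Proof.
move=> u0 uM; apply: lime_le; first by apply: is_cvg_nneseries => n _ _.
exact: nearW.
Qed.

Lemma nneseries_ge_partial (u : nat -> \bar R) n : (forall k, 0 <= u k) ->
  \sum_(0 <= k < n) u k <= \sum_(0 <= k <oo) u k.
Proof. by move=> u0; apply: nneseries_lim_ge => k _ _. Qed.

Lemma nneseries_ge_term (u : nat -> \bar R) n : (forall k, 0 <= u k) ->
  u n <= \sum_(0 <= k <oo) u k.
Proof.
move=> u0; apply: le_trans (nneseries_ge_partial n.+1 u0).
by rewrite big_nat_recr//= leeDr// sume_ge0.
Qed.

Lemma nneseriesZl_e (u : nat -> \bar R) (x : \bar R) : (forall k, 0 <= u k) ->
  0 <= x -> \sum_(0 <= k <oo) x * u k <= x * \sum_(0 <= k <oo) u k.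
Proof.
move=> u0 x0; apply: nneseries_le => [k|n]; first by rewrite mule_ge0.
rewrite -ge0_sume_distrr// lee_wpmul2l//; exact: nneseries_ge_partial.
Qed.

Lemma le_poweR (r : R) (x y : \bar R) : (0 <= r)%R -> 0 <= x -> x <= y ->
  x `^ r <= y `^ r.
Proof.
move=> r0 x0 xy; have y0 := le_trans x0 xy.
by apply: gt0_ler_poweR => //; rewrite in_itv/= leey andbT.
Qed.

Lemma poweRK (r : R) (x : \bar R) : (r != 0)%R -> 0 <= x -> (x `^ r) `^ r^-1 = x.
Proof. by move=> r0 x0; rewrite -poweRrM mulfV// poweRe1. Qed.

Lemma poweRVK (r : R) (x : \bar R) : (r != 0)%R -> 0 <= x -> (x `^ r^-1) `^ r = x.
Proof. by move=> r0 x0; rewrite -poweRrM mulVf// poweRe1. Qed.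

Lemma le_poweR_inv (r : R) (x y : \bar R) : (0 < r)%R -> 0 <= x -> 0 <= y ->
  x `^ r <= y -> x <= y `^ r^-1.
Proof.
move=> r0 x0 y0 xy; rewrite -(@poweRK r x) ?gt_eqF//.
by apply: le_poweR => //; [rewrite invr_ge0 ltW|exact: poweR_ge0].
Qed.

Lemma geometric_sum_le (g : R) n : (0 < g < 1)%R ->
  (\sum_(0 <= k < n) g ^+ k <= (1 - g)^-1)%R.
Proof.
move=> /andP[g0 g1]; have g1' : (0 < 1 - g)%R by rewrite subr_gt0.
suff -> : (\sum_(0 <= k < n) g ^+ k = (1 - g ^+ n) / (1 - g))%R.
  by rewrite ler_pdivrMr// mulVf ?gt_eqF// gerBl exprn_ge0// ltW.
elim: n => [|n IH]; first by rewrite big_geq// expr0 subrr mul0r.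
by rewrite big_nat_recr//= IH exprS; field; rewrite gt_eqF.
Qed.

Lemma geometric_series_le (g : R) : (0 < g < 1)%R ->
  \sum_(0 <= k <oo) (g ^+ k)%:E <= ((1 - g)^-1)%:E.
Proof.
move=> g01; have /andP[g0 g1] := g01.
apply: nneseries_le => [k|n]; first by rewrite lee_fin exprn_ge0// ltW.
by rewrite sumEFin lee_fin geometric_sum_le.
Qed.

(** The distance of [k] and [j], in a form that computes in both cases. *)
Definition gap (k j : nat) : nat := ((k - j) + (j - k))%N.

Lemma gapC k j : gap k j = gap j k.
Proof. by rewrite /gap addnC. Qed.

Lemma gap_series_le (g : R) k : (0 < g < 1)%R ->
  \sum_(0 <= j <oo) (g ^+ gap k j)%:E <= (2 / (1 - g))%:E.
Proof.
move=> g01; have /andP[g0 g1] := g01.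
have gn0 n : (0 <= g ^+ n)%R by rewrite exprn_ge0// ltW.
apply: nneseries_le => [j|n]; first by rewrite lee_fin.
rewrite sumEFin lee_fin mulrDl mul1r.
apply: (@le_trans _ _ (\sum_(0 <= j < k + n) g ^+ gap k j)%R).
  by rewrite (@big_cat_nat _ _ _ n _ (k + n))//= ?leq_addl// lerDl sumr_ge0.
rewrite (@big_cat_nat _ _ _ k _ (k + n))//= ?leq_addr//; apply: lerD.
  rewrite big_nat_rev/= add0n.
  apply: le_trans (geometric_sum_le k g01).
  rewrite big_nat [leRHS]big_nat; apply: ler_sum => j /andP[_ jk].
  rewrite /gap subKn// (eqP (_ : (k - j.+1 - k)%N == 0)%N) ?addn0; last first.
    by rewrite subn_eq0 leq_subr.
  by rewrite exprS ler_piMl// ltW.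
rewrite -{1}(add0n k) big_addn addnC addnK.
apply: le_trans (geometric_sum_le n g01).
apply: ler_sum => j _; rewrite /gap addnK.
by rewrite (eqP (_ : (k - (j + k))%N == 0)%N)// subn_eq0 leq_addl.
Qed.

(** Half of the geometric weight [h ^ 2] makes the series converge and the other
    half survives the power [s]; for [s < 1] and [s >= 1] alike this replaces
    the inequalities of Hoelder and Minkowski. *)
Lemma weighted_series_pow (h s M : R) (w : nat -> nat) (B : nat -> \bar R) :
  (0 < h < 1)%R -> (0 < s)%R -> (0 < M)%R -> (forall j, 0 <= B j) ->
  \sum_(0 <= j <oo) (h ^+ w j)%:E <= M%:E ->
  (\sum_(0 <= j <oo) ((h ^+ 2) ^+ w j)%:E * B j) `^ s <=
    (M `^ s)%:E * \sum_(0 <= j <oo) ((h `^ s) ^+ w j)%:E * B j `^ s.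
Proof.
move=> /andP[h0 h1] s0 M0 B0 hM.
have hn0 n : (0 <= h ^+ n)%R by rewrite exprn_ge0// ltW.
have hs0 n : (0 <= (h `^ s) ^+ n)%R by rewrite exprn_ge0// powR_ge0.
have t0 j : 0 <= ((h `^ s) ^+ w j)%:E * B j `^ s by rewrite mule_ge0 ?lee_fin ?poweR_ge0.
set T := (X in _ <= _ * X).
have T0 : 0 <= T by apply: nneseries_ge0.
have Ms : (0 < M `^ s)%R by rewrite powR_gt0.
have BT j : (h ^+ w j)%:E * B j <= T `^ s^-1.
  apply: le_poweR_inv => //; first by rewrite mule_ge0// lee_fin.
  rewrite poweRM//; last by rewrite lee_fin.
  rewrite poweR_EFin -powR_mulrn; last exact: ltW.
  rewrite -powRrM mulrC powRrM powR_mulrn ?powR_ge0//.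
  exact: (nneseries_ge_term j t0).
have -> : (M `^ s)%:E * T = (M%:E * T `^ s^-1) `^ s.
  rewrite poweRM ?poweR_ge0//; last by rewrite lee_fin ltW.
  by rewrite poweR_EFin poweRVK ?gt_eqF.
apply: le_poweR; first exact: ltW.
  by apply: nneseries_ge0 => j _ _; rewrite mule_ge0// lee_fin exprn_ge0// exprn_ge0// ltW.
apply: (@le_trans _ _ (\sum_(0 <= j <oo) T `^ s^-1 * (h ^+ w j)%:E)).
  apply: lee_nneseries => [j _ _|j _].
    by rewrite mule_ge0// lee_fin exprn_ge0// exprn_ge0// ltW.
  rewrite -exprM mulnC exprM expr2 EFinM -muleA [leRHS]muleC.
  by rewrite lee_wpmul2l// lee_fin.
apply: le_trans (nneseriesZl_e _ _) _ => [k||]; rewrite ?lee_fin ?poweR_ge0//.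
by rewrite [leRHS]muleC lee_wpmul2l// poweR_ge0.
Qed.

End Series.

Section DiscreteNorms.
Context {R : realType}.
Local Open Scope ereal_scope.
Implicit Types (p : R) (q : \bar R) (b : nat -> \bar R).

(** The [l^q] norm of the [p]-th roots of the terms: the quantities that occur
    are integrals of [p]-th powers. *)
Definition lqnorm p q b : \bar R :=
  match q with
  | r%:E => (\sum_(0 <= k <oo) b k `^ (r / p)) `^ r^-1
  | _ => ereal_sup [set b k `^ p^-1 | k in setT]
  end.

Lemma lqnorm_ge_term p q b k : (1 <= p)%R -> 1%:E <= q -> (forall k, 0 <= b k) ->
  b k `^ p^-1 <= lqnorm p q b.
Proof.
move=> p1 q1 b0; have p0 : (0 < p)%R by apply: lt_le_trans p1.
case: q q1 => [r| |]//=; last by move=> _; apply: ereal_sup_ubound; exists k.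
rewrite lee_fin => r1; have r0 : (0 < r)%R by apply: lt_le_trans r1.
apply: le_poweR_inv; rewrite ?poweR_ge0//.
  by apply: nneseries_ge0 => *; exact: poweR_ge0.
rewrite -poweRrM mulrC.
by apply: (@nneseries_ge_term _ (fun k => b k `^ (r / p))) => j; exact: poweR_ge0.
Qed.

Lemma lqnorm_ge0 p q b : (1 <= p)%R -> 1%:E <= q -> (forall k, 0 <= b k) ->
  0 <= lqnorm p q b.
Proof.
by move=> p1 q1 b0; apply: le_trans (lqnorm_ge_term 0 p1 q1 b0); exact: poweR_ge0.
Qed.

(** Young's inequality for the convolution with a geometric kernel.  For finite
    [q], the weighted inequality is raised to the power [q / p], summed over
    [k], and the two sums are interchanged; the sums of the kernel over rows and
    over columns are bounded by the same constant. *)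
Lemma lqnorm_convolution p q (g A : R) : (1 <= p)%R -> 1%:E <= q ->
  (0 < g < 1)%R -> (0 < A)%R ->
  exists2 C : R, (0 < C)%R & forall b o : nat -> \bar R,
    (forall k, 0 <= b k) -> (forall k, 0 <= o k) ->
    (forall k, o k <= A%:E * \sum_(0 <= j <oo) (g ^+ gap k j)%:E * b j) ->
    lqnorm p q o <= C%:E * lqnorm p q b.
Proof.
move=> p1 q1 g01 A0; have /andP[g0 g1] := g01.
have p0 : (0 < p)%R by apply: lt_le_trans p1.
have gn0 n : (0 <= g ^+ n)%R by rewrite exprn_ge0// ltW.
case: q q1 => [r| |]//=; last first.
  move=> _; exists ((A * (2 / (1 - g))) `^ p^-1)%R.
    by rewrite powR_gt0// mulr_gt0// divr_gt0// subr_gt0.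
  have AM0 : (0 < A * (2 / (1 - g)))%R by rewrite mulr_gt0// divr_gt0// subr_gt0.
  move=> b o b0 o0 ob; apply: ge_ereal_sup => _ [k _ <-].
  set S := ereal_sup _.
  have bS j : b j <= S `^ p.
    rewrite -(@poweRVK _ p (b j)) ?gt_eqF//; apply: le_poweR => //; [exact: ltW|exact: poweR_ge0|].
    by apply: ereal_sup_ubound; exists j.
  have S0 : 0 <= S by apply: (@le_trans _ _ (b 0%N `^ p^-1)); [exact: poweR_ge0|apply: ereal_sup_ubound; exists 0%N].
  have -> : ((A * (2 / (1 - g))) `^ p^-1)%:E * S =
            ((A * (2 / (1 - g)))%:E * S `^ p) `^ p^-1.
    rewrite poweRM ?poweR_ge0//; last by rewrite lee_fin ltW.
    by rewrite poweR_EFin poweRK ?gt_eqF.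
  apply: le_poweR => //; first by rewrite invr_ge0 ltW.
  apply: (le_trans (ob k)); rewrite EFinM -muleA lee_wpmul2l//; first by rewrite lee_fin ltW.
  apply: (@le_trans _ _ (\sum_(0 <= j <oo) S `^ p * (g ^+ gap k j)%:E)).
    apply: lee_nneseries => [j _ _|j _]; first by rewrite mule_ge0// lee_fin.
    by rewrite muleC lee_wpmul2r// lee_fin.
  apply: le_trans (nneseriesZl_e _ _) _ => [j||]; rewrite ?lee_fin ?poweR_ge0//.
  by rewrite [leRHS]muleC lee_wpmul2l ?poweR_ge0// gap_series_le.
rewrite lee_fin => r1; have r0 : (0 < r)%R by apply: lt_le_trans r1.
pose s := (r / p)%R; have s0 : (0 < s)%R by rewrite divr_gt0.
(* [h ^+ 2 = g]: half of the decay pays for each use of the kernel *)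
pose h := Num.sqrt g; have h0 : (0 < h)%R by rewrite sqrtr_gt0.
have h1 : (h < 1)%R by rewrite -[ltRHS]sqrtr1 ltr_sqrt.
have h01 : (0 < h < 1)%R by rewrite h0 h1.
have hg : (h ^+ 2 = g)%R by rewrite sqr_sqrtr// ltW.
have hs1 : (0 < h `^ s < 1)%R.
  rewrite powR_gt0//= (_ : 1%R = 1 `^ s)%R; last by rewrite powR1.
  by apply: gt0_ltr_powR => //; rewrite nnegrE ltW.
pose M : R := (2 / (1 - h))%R; have M0 : (0 < M)%R by rewrite divr_gt0// subr_gt0.
pose M' : R := (2 / (1 - h `^ s))%R.
have M'0 : (0 < M')%R by rewrite divr_gt0// subr_gt0; case/andP: hs1.
pose K := (A `^ s * M `^ s * M')%R.
have K0 : (0 < K)%R by rewrite /K; posr.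
exists (K `^ r^-1)%R; first exact: powR_gt0.
move=> b o b0 o0 ob.
have hs0 n : 0 <= ((h `^ s) ^+ n)%:E by rewrite lee_fin exprn_ge0// powR_ge0.
have os k : o k `^ s <=
    (A `^ s * M `^ s)%:E * \sum_(0 <= j <oo) ((h `^ s) ^+ gap k j)%:E * b j `^ s.
  apply: le_trans (le_poweR (ltW s0) (o0 k) (ob k)) _.
  rewrite poweRM//; last 2 first.
  - by rewrite lee_fin ltW.
  - by apply: nneseries_ge0 => j _ _; rewrite mule_ge0// lee_fin.
  rewrite poweR_EFin EFinM -muleA lee_wpmul2l ?lee_fin ?powR_ge0//.
  have := @weighted_series_pow _ h s M (gap k) b h01 s0 M0 b0 (gap_series_le k h01).
  by under eq_eseriesr do rewrite hg.
have S0 : 0 <= \sum_(0 <= k <oo) b k `^ s by apply: nneseries_ge0 => *; exact: poweR_ge0.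
rewrite -poweR_EFin -poweRM//; last by rewrite lee_fin ltW.
apply: le_poweR; first by rewrite invr_ge0 ltW.
  by apply: nneseries_ge0 => *; exact: poweR_ge0.
have t0 i j : 0 <= ((h `^ s) ^+ gap i j)%:E * b j `^ s by rewrite mule_ge0 ?poweR_ge0.
apply: (@le_trans _ _ (\sum_(0 <= k <oo) (A `^ s * M `^ s)%:E *
    \sum_(0 <= j <oo) ((h `^ s) ^+ gap k j)%:E * b j `^ s)).
  by apply: lee_nneseries => [k _ _|k _]; [exact: poweR_ge0|exact: os].
rewrite nneseriesZl; last by move=> k _; exact: nneseries_ge0.
rewrite [leRHS](_ : _ = (A `^ s * M `^ s)%:E *
  (M'%:E * \sum_(0 <= k <oo) b k `^ s)); last by rewrite /K [in LHS]EFinM muleA.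
apply: lee_wpmul2l; first by rewrite lee_fin mulr_ge0 ?powR_ge0.
rewrite nneseries_interchange//.
apply: (@le_trans _ _ (\sum_(0 <= j <oo) M'%:E * b j `^ s)).
  apply: lee_nneseries => [j _ _|j _]; first exact: nneseries_ge0.
  under eq_eseriesr do rewrite muleC gapC.
  apply: le_trans (nneseriesZl_e _ _) _ => //; first exact: poweR_ge0.
  by rewrite [leRHS]muleC lee_wpmul2l ?poweR_ge0// gap_series_le.
by rewrite nneseriesZl// => k _; exact: poweR_ge0.
Qed.

End DiscreteNorms.

Section Dyadic.
Context {R : realType}.
Implicit Types (r t : R).

Definition dyad (r : R) (j : nat) : R := r / 2 ^+ j.

Lemma dyad_gt0 r j : 0 < r -> 0 < dyad r j.
Proof. by move=> r0; rewrite divr_gt0// exprn_gt0. Qed.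

Lemma dyadS r j : dyad r j = 2 * dyad r j.+1.
Proof. by rewrite /dyad exprS; field; rewrite expf_eq0/= pnatr_eq0 andbF. Qed.

Lemma dyad0 r : dyad r 0 = r.
Proof. by rewrite /dyad expr0 divr1. Qed.

Lemma dyad_mono r i j : 0 < r -> (i <= j)%N -> dyad r j <= dyad r i.
Proof.
move=> r0 ij; rewrite /dyad ler_pM2l// lef_pV2 ?posrE ?exprn_gt0//.
by rewrite ler_eXn2l// ltr1n.
Qed.

Lemma dyad_le r j : 0 < r -> dyad r j <= r.
Proof. by move=> r0; rewrite -[leRHS]dyad0; exact: dyad_mono. Qed.

Lemma exp2_unbounded (x : R) : exists n : nat, x < 2 ^+ n.
Proof.
have [n] : exists n : nat, x < n%:R.
  exists (Num.truncn `|x|).+1; apply: le_lt_trans (ler_norm x) _.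
  by have /andP[] := Num.Theory.truncn_itv (normr_ge0 x).
by move=> xn; exists n; apply: lt_trans xn _; rewrite -natrX ltr_nat ltn_expl.
Qed.

Lemma dyad_cover r t : 0 < t -> t <= r -> exists j, dyad r j.+1 < t <= dyad r j.
Proof.
move=> t0 tr; have [n0 hn0] := exp2_unbounded (r / t).
have ex : exists n, dyad r n < t.
  by exists n0; rewrite /dyad ltr_pdivrMr ?exprn_gt0// mulrC -ltr_pdivrMr.
case: (ex_minnP ex) => -[|j]; first by rewrite dyad0 ltNge tr.
move=> jt jmin; exists j; rewrite jt/= leNgt; apply/negP => /jmin.
by rewrite ltnn.
Qed.

Lemma dyad_cover_large r t : 0 < r -> r < t ->
  exists j, 2 ^+ j * r < t <= 2 ^+ j.+1 * r.
Proof.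
move=> r0 rt; have [n0 hn0] := exp2_unbounded (t / r).
have ex : exists n, t <= 2 ^+ n * r.
  by exists n0; rewrite -ler_pdivrMr// ltW.
case: (ex_minnP ex) => -[|j]; first by rewrite expr0 mul1r leNgt rt.
move=> jt jmin; exists j; rewrite jt andbT ltNge; apply/negP => /jmin.
by rewrite ltnn.
Qed.

End Dyadic.

Section StepFunctions.
Context {R : realType}.
Local Open Scope ereal_scope.
Local Notation leb := (@lebesgue_measure R).

(** A step function on disjoint sets bounds an integral from below; in the next
    lemma, a step function on two families of sets that cover the domain, one meant
    for small and one for large [t], bounds it from above. *)
Lemma step_function_le (I : nat -> set R) (v : nat -> \bar R) (F : R -> \bar R)
    (E : set R) :
  (forall j, measurable (I j)) -> trivIset setT I -> (forall j, I j `<=` E) ->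
  (forall j, 0 <= v j) -> (forall t, E t -> 0 <= F t) ->
  (forall j t, I j t -> v j <= F t) ->
  \sum_(0 <= j <oo) v j * leb (I j) <= \int[leb]_(t in E) F t.
Proof.
move=> mI tI IE v0 F0 vF.
have mf j : measurable_fun setT (fun t => (\1_(I j) t)%:E : \bar R).
  by apply/measurable_EFinP; exact: measurable_indic.
have -> : \sum_(0 <= j <oo) v j * leb (I j) =
    \int[leb]_t \sum_(0 <= j <oo) v j * (\1_(I j) t)%:E.
  rewrite integral_nneseries//; last 2 first.
  - by move=> j; apply: emeasurable_funM; [exact: measurable_cst|exact: mf].
  - by move=> j t _; rewrite mule_ge0// lee_fin.
  apply: eq_eseriesr => j _; rewrite ge0_integralZl//; last exact: mf.
  congr (_ * _); rewrite -[in LHS](setIT (I j)); symmetry.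
  by apply: integral_indic => //; exact: mI.
rewrite [leRHS]integral_mkcond; apply: le_integralT => t.
  by apply: nneseries_ge0 => j _ _; rewrite mule_ge0// lee_fin.
have FE0 : 0 <= (F \_ E) t by rewrite /patch; case: ifPn => // /set_mem/F0.
apply: nneseries_le => [j|n]; first by rewrite mule_ge0// lee_fin.
elim: n => [|n IH]; first by rewrite big_geq.
rewrite big_nat_recr//= indicE; case: (boolP (t \in I n)) => [/set_mem tn|_]; last first.
  by rewrite mule0 adde0.
rewrite mule1 big_nat big1 ?add0e => [|i /andP[_ i_n]].
  by rewrite /patch mem_set ?vF//; exact: IE tn.
rewrite indicE; case: (boolP (t \in I i)) => [/set_mem ti|_]; last by rewrite mule0.
have /trivIsetP/(_ i n Logic.I Logic.I) := tI; rewrite neq_ltn i_n => /(_ isT) e.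
by have : (I i `&` I n) t by []; rewrite e.
Qed.

Lemma step_function_ge (I J : nat -> set R) (v w : nat -> \bar R) (F : R -> \bar R)
    (E : set R) :
  (forall j, measurable (I j)) -> (forall j, measurable (J j)) ->
  (forall t, E t -> exists j, I j t \/ J j t) ->
  (forall j, 0 <= v j) -> (forall j, 0 <= w j) -> (forall t, E t -> 0 <= F t) ->
  (forall j t, I j t -> F t <= v j) -> (forall j t, J j t -> F t <= w j) ->
  \int[leb]_(t in E) F t <=
    \sum_(0 <= j <oo) v j * leb (I j) + \sum_(0 <= j <oo) w j * leb (J j).
Proof.
move=> mI mJ EIJ v0 w0 F0 vF wF.
have mf (K : nat -> set R) j : measurable (K j) ->
    measurable_fun setT (fun t => (\1_(K j) t)%:E : \bar R).
  by move=> mK; apply/measurable_EFinP; exact: measurable_indic.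
have t0 (K : nat -> set R) (u : nat -> \bar R) j t : 0 <= u j -> 0 <= u j * (\1_(K j) t)%:E.
  by move=> u0; rewrite mule_ge0// lee_fin.
have st (K : nat -> set R) (u : nat -> \bar R) : (forall j, measurable (K j)) ->
    (forall j, 0 <= u j) -> \sum_(0 <= j <oo) u j * leb (K j) =
    \int[leb]_t \sum_(0 <= j <oo) u j * (\1_(K j) t)%:E.
  move=> mK u0; rewrite integral_nneseries//; last 2 first.
  - by move=> j; apply: emeasurable_funM; [exact: measurable_cst|exact: mf].
  - by move=> j t _; exact: t0.
  apply: eq_eseriesr => j _; rewrite ge0_integralZl//; last exact: mf.
  congr (_ * _); rewrite -[in LHS](setIT (K j)); symmetry.
  by apply: integral_indic => //; exact: mK.
have mS (K : nat -> set R) (u : nat -> \bar R) : (forall j, measurable (K j)) ->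
    (forall j, 0 <= u j) ->
    measurable_fun setT (fun t => \sum_(0 <= j <oo) u j * (\1_(K j) t)%:E).
  move=> mK u0; apply: ge0_emeasurable_sum => [j t _ _|j _]; first exact: t0.
  by apply: emeasurable_funM; [exact: measurable_cst|exact: mf].
have S0 (K : nat -> set R) (u : nat -> \bar R) t : (forall j, 0 <= u j) ->
    0 <= \sum_(0 <= j <oo) u j * (\1_(K j) t)%:E.
  by move=> u0; apply: nneseries_ge0 => j _ _; exact: t0.
rewrite !st// -ge0_integralD//; try by [move=> ? _; exact: S0|exact: mS].
rewrite [leLHS]integral_mkcond; apply: le_integralT => t.
  by rewrite /patch; case: ifPn => // /set_mem/F0.
rewrite /patch; case: ifPn => [/set_mem Et|_]; last by rewrite adde_ge0// S0.
have ge (K : nat -> set R) (u : nat -> \bar R) j : (forall j, 0 <= u j) ->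
    K j t -> F t <= u j -> F t <= \sum_(0 <= j <oo) u j * (\1_(K j) t)%:E.
  move=> u0 Kt Fu.
  apply: le_trans (nneseries_ge_term j (fun j => t0 K u j t (u0 j))).
  by rewrite indicE mem_set// mule1.
have [j [Ij|Jj]] := EIJ t Et.
  apply: (le_trans (ge I v j v0 Ij (vF j t Ij))).
  by rewrite leeDl// S0.
apply: (le_trans (ge J w j w0 Jj (wF j t Jj))).
by rewrite leeDr// S0.
Qed.

End StepFunctions.

Section Discretization.
Context {R : realType}.
Local Open Scope ereal_scope.
Implicit Types (alpha p D : R) (q : \bar R) (E : R -> \bar R).

(** The seminorm only depends on the function [E] that gives the oscillation at
    each radius; all the comparisons between seminorms are about such
    functions. *)
Definition seminorm_of alpha p q E : \bar R :=
  match q with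
  | q'%:E => ((\int[lebesgue_measure]_(t in `]0%R, +oo[%classic)
      (E t `^ (q' / p) / (t `^ (alpha * q' + 1))%:E)) `^ q'^-1)
  | _ => ereal_sup [set ((t `^ alpha)^-1)%:E * E t `^ p^-1 | t in `]0%R, +oo[%classic]
  end.

(** As [E] integrates [p]-th powers, the weight is chosen so that the [p]-th root of
    a term carries the radius to the power [- alpha]. *)
Definition dyadic_terms alpha p (r : R) E (j : nat) : \bar R :=
  ((dyad r j) `^ (- (alpha * p)))%:E * E (dyad r j).

(** What doubling gives for the oscillation as a function of the radius; it
    makes the value at one radius control a whole dyadic interval. *)
Definition almost_increasing D E := forall t s, (0 < t)%R -> (t <= s)%R ->
  (s <= 2 * t)%R -> E t <= D%:E * E s.

Lemma dive_pos (x : \bar R) (r : R) : (0 < r)%R -> x / r%:E = (r^-1)%:E * x.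
Proof. by move=> r0; rewrite inver gt_eqF// muleC. Qed.

Lemma dyadic_terms_pow alpha p (r s : R) E j : (0 < p)%R -> (0 < r)%R ->
  (forall t, 0 <= E t) ->
  dyadic_terms alpha p r E j `^ s =
    (dyad r j `^ (- (alpha * p * s)))%:E * E (dyad r j) `^ s.
Proof.
move=> p0 r0 E0; rewrite /dyadic_terms poweRM ?lee_fin ?powR_ge0//.
by rewrite poweR_EFin -powRrM mulNr.
Qed.

Lemma dyadic_terms_ge0 alpha p r E j : (forall t, 0 <= E t) ->
  0 <= dyadic_terms alpha p r E j.
Proof. by move=> E0; rewrite mule_ge0// lee_fin powR_ge0. Qed.

(** The value at [dyad r j] bounds the integrand from below on the interval from
    [dyad r j] to twice that radius. *)
Lemma lqnorm_le_seminorm alpha p q D : (0 < alpha)%R -> (1 <= p)%R -> 1%:E <= q ->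
  (0 < D)%R ->
  exists2 C : R, (0 < C)%R & forall E r, (0 < r)%R -> (forall t, 0 <= E t) ->
    almost_increasing D E ->
    lqnorm p q (dyadic_terms alpha p r E) <= C%:E * seminorm_of alpha p q E.
Proof.
move=> al0 p1 q1 D0; have p0 : (0 < p)%R by apply: lt_le_trans p1.
case: q q1 => [q| |]//=; last first.
  move=> _; exists 1%R => // E r r0 E0 _; rewrite mul1e.
  apply: ge_ereal_sup => _ [j _ <-]; apply: ereal_sup_ubound.
  exists (dyad r j); first by rewrite /= in_itv/= andbT dyad_gt0.
  rewrite dyadic_terms_pow// -mulrA mulfV ?gt_eqF// mulr1.
  by rewrite powRN.
rewrite lee_fin => q1; have q0 : (0 < q)%R by apply: lt_le_trans q1.
pose s := (q / p)%R; have s0 : (0 < s)%R by rewrite divr_gt0.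
have ps : (p * s = q)%R by rewrite /s mulrCA mulfV ?mulr1// gt_eqF.
pose e := (alpha * q + 1)%R.
pose c := ((D `^ s)^-1 * (2 `^ e)^-1)%R.
have c0 : (0 < c)%R by rewrite mulr_gt0 ?invr_gt0 ?powR_gt0.
exists (c^-1 `^ q^-1)%R; first by rewrite powR_gt0 ?invr_gt0.
move=> E r r0 E0 ED; have dr0 j : (0 < dyad r j)%R by exact: dyad_gt0.
rewrite -poweR_EFin -poweRM; last 2 first.
- by rewrite lee_fin invr_ge0 ltW.
- by apply: integral_ge0 => t _; rewrite mule_ge0 ?poweR_ge0 ?inve_ge0 ?lee_fin ?powR_ge0.
apply: le_poweR; first by rewrite invr_ge0 ltW.
  by apply: nneseries_ge0 => *; exact: poweR_ge0.
rewrite lee_pdivlMl//.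
pose I j : set R := `](dyad r j), (2 * dyad r j)%R]%classic.
pose v j : \bar R := ((D `^ s)^-1 * ((2 * dyad r j) `^ e)^-1)%R%:E * E (dyad r j) `^ s.
rewrite -nneseriesZl; last by move=> k _; exact: poweR_ge0.
rewrite (_ : (fun n => _) = (fun n => \sum_(0 <= j < n) v j * lebesgue_measure (I j))).
  apply: step_function_le.
  - by move=> j; exact: measurable_itv.
  - apply/trivIsetP => i j _ _; wlog ij : i j / (i < j)%N.
      move=> wl; rewrite neq_ltn => /orP[] ij; first by apply: wl => //; rewrite ltn_eqF.
      by rewrite setIC; apply: wl => //; rewrite ltn_eqF.
    move=> _; rewrite -subset0 => t []; rewrite /I/= !in_itv/= => /andP[t1 _] /andP[_ t2].
    suff h : (2 * dyad r j <= dyad r i)%R by have := le_lt_trans (le_trans t2 h) t1; rewrite ltxx.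
    by case: j ij {t2} => // j ij; rewrite -dyadS; exact: dyad_mono.
  - move=> j t /=; rewrite !in_itv/= andbT => /andP[t1 _].
    exact: lt_trans t1.
  - move=> j; rewrite mule_ge0 ?poweR_ge0// lee_fin mulr_ge0// invr_ge0 powR_ge0//.
  - by move=> t _; rewrite mule_ge0 ?poweR_ge0 ?inve_ge0 ?lee_fin ?powR_ge0.
  move=> j t; rewrite /I/= in_itv/= => /andP[t1 t2].
  have t0 : (0 < t)%R by exact: lt_trans t1.
  rewrite dive_pos ?powR_gt0// /v mulrC EFinM -muleA.
  apply: lee_pmul => //.
  + by rewrite lee_fin invr_ge0 powR_ge0.
  + by rewrite mule_ge0 ?poweR_ge0// lee_fin invr_ge0 powR_ge0.
  + rewrite lee_fin lef_pV2 ?posrE ?powR_gt0 ?mulr_gt0//.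
    apply: ge0_ler_powR => //; rewrite ?nnegrE ?mulr_ge0//; try exact: ltW.
    by rewrite addr_ge0// mulr_ge0// ltW.
  rewrite lee_pdivrMl ?powR_gt0// -poweR_EFin -poweRM ?lee_fin//; last exact: ltW.
  by apply: le_poweR => //; [exact: ltW|apply: ED => //; exact: ltW].
apply/funext => n; apply: eq_bigr => j _.
rewrite dyadic_terms_pow// lebesgue_measure_itv/= lte_fin ltr_pMl// ltr1n.
rewrite -EFinB /v muleAC -EFinM [in LHS]muleA -EFinM; congr (_%:E * _).
rewrite (_ : 2 * dyad r j - dyad r j = dyad r j)%R; last by ring.
rewrite /c -!mulrA; congr (_ * _)%R.
rewrite powRM//; last exact: ltW.
rewrite invfM -!mulrA; congr (_ * _)%R.
rewrite -[X in _ = (_ * X)%R](@powRr1 _ (dyad r j)); last exact: ltW.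
rewrite -powRN -powRD; last by apply/implyP => _; rewrite gt_eqF.
by rewrite ps /e; congr (_ `^ _)%R; ring.
Qed.

(** Radii below [r] are covered by dyadic intervals.  Above [r] the oscillation
    does not grow, and the integral of the remaining power of [t] is a
    geometric series, which the first dyadic term absorbs. *)
Lemma seminorm_le_lqnorm beta p q D : (0 < beta)%R -> (1 <= p)%R -> 1%:E <= q ->
  (0 < D)%R ->
  exists2 C : R, (0 < C)%R & forall E r, (0 < r)%R -> (forall t, 0 <= E t) ->
    almost_increasing D E -> (forall t, (r <= t)%R -> E t <= E r) ->
    seminorm_of beta p q E <= C%:E * lqnorm p q (dyadic_terms beta p r E).
Proof.
move=> be0 p1 q1 D0; have p0 : (0 < p)%R by apply: lt_le_trans p1.
have ED' E r j t : (0 < r)%R -> (forall t, 0 <= E t) -> almost_increasing D E ->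
    (dyad r j.+1 < t)%R -> (t <= dyad r j)%R -> E t <= D%:E * E (dyad r j).
  move=> r0 E0 ED t1 t2; apply: ED => //; first exact: lt_trans (dyad_gt0 j.+1 r0) t1.
  by rewrite dyadS ler_pM2l// ltW.
case: q q1 => [q| |]//=; last first.
  move=> _; exists (1 + D `^ p^-1 * 2 `^ beta)%R.
    by rewrite addr_gt0// mulr_gt0// powR_gt0.
  move=> E r r0 E0 ED Er.
  have S0 j : dyadic_terms beta p r E j `^ p^-1 <= lqnorm p +oo (dyadic_terms beta p r E).
    by apply: ereal_sup_ubound; exists j.
  have bj j : dyadic_terms beta p r E j `^ p^-1 =
      ((dyad r j `^ beta)^-1)%:E * E (dyad r j) `^ p^-1.
    by rewrite dyadic_terms_pow// -mulrA mulfV ?gt_eqF// mulr1 powRN.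
  have D1 : (0 <= D `^ p^-1 * 2 `^ beta)%R by rewrite mulr_ge0// powR_ge0.
  have <- : lqnorm p +oo (dyadic_terms beta p r E) =
    ereal_sup [set dyadic_terms beta p r E k `^ p^-1 | k in setT] by [].
  apply: ge_ereal_sup => x [t /=]; rewrite in_itv/= andbT => t0 <-.
  have [tr|rt] := leP t r.
    have [j /andP[t1 t2]] := dyad_cover t0 tr.
    apply: (@le_trans _ _ ((D `^ p^-1 * 2 `^ beta)%:E * lqnorm p +oo (dyadic_terms beta p r E))); last first.
      apply: lee_wpmul2r; first by apply: le_trans (S0 0%N); exact: poweR_ge0.
      by rewrite lee_fin lerDr.
    apply: (@le_trans _ _ ((D `^ p^-1 * 2 `^ beta)%:E * dyadic_terms beta p r E j `^ p^-1)); last first.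
      by apply: lee_wpmul2l; rewrite ?lee_fin.
    rewrite bj muleA -EFinM.
    have -> : (D `^ p^-1 * 2 `^ beta * (dyad r j `^ beta)^-1 =
        (dyad r j.+1 `^ beta)^-1 * D `^ p^-1)%R.
      rewrite dyadS powRM//; last by rewrite ltW// dyad_gt0.
      by field; rewrite !gt_eqF ?powR_gt0 ?dyad_gt0.
    rewrite EFinM -muleA; apply: lee_pmul.
    - by rewrite lee_fin invr_ge0 powR_ge0.
    - exact: poweR_ge0.
    - rewrite lee_fin lef_pV2 ?posrE ?powR_gt0 ?dyad_gt0//.
      apply: ge0_ler_powR; rewrite ?nnegrE; apply: ltW => //; exact: dyad_gt0.
    rewrite -poweR_EFin -poweRM ?lee_fin//; last exact: ltW.
    by apply: le_poweR; [rewrite invr_ge0 ltW|exact: E0|exact: ED'].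
  apply: (@le_trans _ _ (lqnorm p +oo (dyadic_terms beta p r E))); last first.
    rewrite -[leLHS]mul1e; apply: lee_wpmul2r; last by rewrite lee_fin lerDl.
    by apply: le_trans (S0 0%N); exact: poweR_ge0.
  apply: le_trans (S0 0%N); rewrite bj dyad0; apply: lee_pmul.
  - by rewrite lee_fin invr_ge0 powR_ge0.
  - exact: poweR_ge0.
  - rewrite lee_fin lef_pV2 ?posrE ?powR_gt0//.
    by apply: ge0_ler_powR; rewrite ?nnegrE; apply: ltW.
  by apply: le_poweR; [rewrite invr_ge0 ltW|exact: E0|apply: Er; exact: ltW].
rewrite lee_fin => q1; have q0 : (0 < q)%R by apply: lt_le_trans q1.
pose s := (q / p)%R; have s0 : (0 < s)%R by rewrite divr_gt0.
have ps : (p * s = q)%R by rewrite /s mulrCA mulfV ?mulr1// gt_eqF.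
pose e := (beta * q + 1)%R.
have e0 : (0 < e)%R by rewrite addr_gt0// mulr_gt0.
pose g := (2 `^ (- (beta * q)))%R.
have g01 : (0 < g < 1)%R.
  rewrite powR_gt0//= /g powRN invf_lt1 ?powR_gt0//.
  rewrite -[ltLHS](congr1 (fun f => f (beta * q)%R) (@powR1 R)).
  by apply: gt0_ltr_powR; rewrite ?nnegrE ?ltr1n ?mulr_gt0.
have /andP[g0 g1] := g01.
pose c1 := (D `^ s * 2 `^ (beta * q))%R; have c10 : (0 < c1)%R by rewrite mulr_gt0 ?powR_gt0.
pose c2 := ((1 - g)^-1)%R; have c20 : (0 < c2)%R by rewrite invr_gt0 subr_gt0.
exists ((c1 + c2) `^ q^-1)%R; first by rewrite powR_gt0 ?addr_gt0.
move=> E r r0 E0 ED Er; have dr0 j : (0 < dyad r j)%R by exact: dyad_gt0.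
have S0 : 0 <= \sum_(0 <= k <oo) dyadic_terms beta p r E k `^ s.
  by apply: nneseries_ge0 => *; exact: poweR_ge0.
rewrite -poweR_EFin -poweRM//; last by rewrite lee_fin ltW ?addr_gt0.
have F0 t : 0 <= E t `^ s / (t `^ e)%:E.
  by rewrite mule_ge0 ?poweR_ge0 ?inve_ge0 ?lee_fin ?powR_ge0.
apply: le_poweR; [by rewrite invr_ge0 ltW|exact: integral_ge0|].
pose I j : set R := `](dyad r j.+1), (dyad r j)]%classic.
pose J j : set R := `](2 ^+ j * r)%R, (2 ^+ j.+1 * r)%R]%classic.
pose v j : \bar R := (D `^ s * (dyad r j.+1 `^ e)^-1)%:E * E (dyad r j) `^ s.
pose w j : \bar R := (((2 ^+ j * r) `^ e)^-1)%:E * E r `^ s.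
have jr0 j : (0 < 2 ^+ j * r)%R by rewrite mulr_gt0// exprn_gt0.
have := @step_function_ge _ I J v w (fun t => E t `^ s / (t `^ e)%:E) `]0%R, +oo[%classic.
move=> /(_ (fun=> measurable_itv _) (fun=> measurable_itv _)) step.
apply: le_trans (step _ _ _ _ _ _) _ => //.
- move=> t /=; rewrite in_itv/= andbT => t0; have [tr|rt] := leP t r.
    by have [j tj] := dyad_cover t0 tr; exists j; left; rewrite /I/= in_itv.
  by have [j tj] := dyad_cover_large r0 rt; exists j; right; rewrite /J/= in_itv.
- by move=> j; rewrite mule_ge0 ?poweR_ge0// lee_fin mulr_ge0 ?invr_ge0 ?powR_ge0.
- by move=> j; rewrite mule_ge0 ?poweR_ge0// lee_fin invr_ge0 powR_ge0.
- move=> j t; rewrite /I/= in_itv/= => /andP[t1 t2].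
  have t0 : (0 < t)%R by exact: lt_trans t1.
  rewrite dive_pos ?powR_gt0// /v mulrC EFinM -muleA.
  apply: lee_pmul.
  + by rewrite lee_fin invr_ge0 powR_ge0.
  + exact: poweR_ge0.
  + rewrite lee_fin lef_pV2 ?posrE ?powR_gt0//.
    by apply: ge0_ler_powR; rewrite ?nnegrE; apply: ltW.
  rewrite -poweR_EFin -poweRM ?lee_fin//; last exact: ltW.
  by apply: le_poweR; [exact: ltW|exact: E0|exact: ED'].
- move=> j t; rewrite /J/= in_itv/= => /andP[t1 t2].
  have t0 : (0 < t)%R by exact: lt_trans t1.
  have rj : (r <= 2 ^+ j * r)%R by rewrite ler_peMl ?exprn_ege1 ?ler1n// ltW.
  rewrite dive_pos ?powR_gt0// /w; apply: lee_pmul.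
  + by rewrite lee_fin invr_ge0 powR_ge0.
  + exact: poweR_ge0.
  + rewrite lee_fin lef_pV2 ?posrE ?powR_gt0//.
    by apply: ge0_ler_powR; rewrite ?nnegrE; apply: ltW.
  by apply: le_poweR; [exact: ltW|exact: E0|apply: Er; apply: ltW; exact: le_lt_trans t1].
rewrite EFinD ge0_muleDl; [|by rewrite lee_fin ltW..].
apply: leeD.
  rewrite -nneseriesZl; last by move=> k _; exact: poweR_ge0.
  apply: lee_nneseries => [j _ _|j _].
    rewrite mule_ge0// mule_ge0 ?poweR_ge0// lee_fin mulr_ge0 ?invr_ge0 ?powR_ge0//.
  rewrite dyadic_terms_pow// lebesgue_measure_itv/= lte_fin.
  have jS : (dyad r j.+1 < dyad r j)%R by rewrite (dyadS r j) ltr_pMl// ltr1n.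
  rewrite jS -EFinB /v muleAC -EFinM [leRHS]muleA -EFinM.
  apply: lee_wpmul2r; first exact: poweR_ge0.
  rewrite lee_fin le_eqVlt; apply/orP; left; apply/eqP; rewrite (dyadS r j).
  rewrite (_ : 2 * dyad r j.+1 - dyad r j.+1 = dyad r j.+1)%R; last by ring.
  have eX : ((dyad r j.+1 `^ e)^-1 * dyad r j.+1 = dyad r j.+1 `^ (- (beta * q)))%R.
    rewrite -[X in (_ * X)%R = _](@powRr1 _ (dyad r j.+1)); last exact: ltW.
    rewrite -powRN -powRD; last by apply/implyP => _; rewrite gt_eqF.
    by congr (_ `^ _)%R; rewrite /e; ring.
  rewrite -[LHS]mulrA eX powRM//; last exact: ltW.
  rewrite -[(beta * p * _)%R]mulrA ps /c1 -!mulrA; congr (_ * _)%R.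
  by rewrite [RHS]mulrA -powRD ?subrr ?powRr0 ?mul1r//; apply/implyP; rewrite pnatr_eq0.
apply: (@le_trans _ _ (\sum_(0 <= j <oo) (dyadic_terms beta p r E 0%N `^ s * (g ^+ j)%:E))).
  apply: lee_nneseries => [j _ _|j _].
    by rewrite mule_ge0// mule_ge0 ?poweR_ge0// lee_fin invr_ge0 powR_ge0.
  rewrite dyadic_terms_pow// lebesgue_measure_itv/= lte_fin dyad0.
  rewrite exprS -mulrA ltr_pMl// ltr1n -EFinB /w muleAC -EFinM [leRHS]muleAC -EFinM.
  apply: lee_wpmul2r; first exact: poweR_ge0.
  rewrite lee_fin le_eqVlt; apply/orP; left; apply/eqP.
  rewrite (_ : 2 * (2 ^+ j * r) - 2 ^+ j * r = 2 ^+ j * r)%R; last by ring.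
  rewrite -[X in (_ * X)%R = _](@powRr1 _ (2 ^+ j * r)%R); last exact: ltW.
  rewrite -powRN -powRD; last by apply/implyP => _; rewrite gt_eqF.
  rewrite (_ : - e + 1 = - (beta * q))%R; last by rewrite /e; ring.
  rewrite powRM ?exprn_ge0//; last exact: ltW.
  rewrite -mulrA ps mulrC; congr (_ * _)%R.
  by rewrite /g -(powR_mulrn j (powR_ge0 2 _)) -(powR_mulrn j (ler0n R 2)) -!powRrM mulrC.
apply: le_trans (nneseriesZl_e _ _) _ => [j||]; rewrite ?lee_fin ?poweR_ge0//.
  by rewrite exprn_ge0// ltW.
rewrite muleC; apply: lee_pmul => //.
- by apply: nneseries_ge0 => j _ _; rewrite lee_fin exprn_ge0// ltW.
- exact: poweR_ge0.
- exact: geometric_series_le.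
by apply: (@nneseries_ge_term _ (fun j => dyadic_terms beta p r E j `^ s)) => j; exact: poweR_ge0.
Qed.

End Discretization.

(** * Averages and mean oscillation in a doubling space *)

Section RealPowers.
Context {R : realType}.
Implicit Types (a b c p : R).

Lemma le_powR a b p : 0 <= p -> 0 <= a -> a <= b -> a `^ p <= b `^ p.
Proof.
by move=> p0 a0 ab; apply: ge0_ler_powR; rewrite ?nnegrE// (le_trans a0).
Qed.

(** The larger summand is at least half of the sum; this covers all [p >= 0]. *)
Lemma powRD2_le a b p : 0 <= p -> 0 <= a -> 0 <= b ->
  (a + b) `^ p <= 2 `^ p * (a `^ p + b `^ p).
Proof.
move=> p0 a0 b0; wlog ab : a b a0 b0 / a <= b.
  move=> wl; have [/wl|/ltW ba] := leP a b; first exact.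
  by rewrite addrC [X in _ * X]addrC; exact: wl.
apply: (@le_trans _ _ ((2 * b) `^ p)).
  by apply: le_powR; rewrite ?addr_ge0// mulrDl mul1r lerD2r.
by rewrite powRM// ler_wpM2l ?powR_ge0// lerDr powR_ge0.
Qed.

Lemma dist_powR_le (x y z : R) p : 0 <= p ->
  `|x - y| `^ p <= 2 `^ p * (`|x - z| `^ p + `|z - y| `^ p).
Proof.
move=> p0; apply: le_trans (powRD2_le p0 (normr_ge0 _) (normr_ge0 _)).
by apply: le_powR => //; exact: ler_distD.
Qed.

(** Young's inequality in the form of the tangent line of [a `^ p] at [c]. *)
Lemma powR_tangent a c p : 1 <= p -> 0 <= a -> 0 <= c ->
  p * c `^ (p - 1) * a <= a `^ p + (p - 1) * c `^ p.
Proof.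
move=> p1 a0 c0; have p0 : 0 < p by apply: lt_le_trans p1.
move: p1; rewrite le_eqVlt => /predU1P[<-|p1].
  by rewrite subrr powRr0 mul0r addr0 !mul1r powRr1.
have pB : 0 < p - 1 by rewrite subr_gt0.
have := @conjugate_powR R a (c `^ (p - 1)) p (p / (p - 1)) a0 (powR_ge0 _ _) p0.
rewrite divr_gt0// => /(_ isT) h.
have {}h := h ltac:(by field; rewrite !gt_eqF).
rewrite -powRrM mulrCA mulfV ?gt_eqF// mulr1 in h.
rewrite -(ler_pM2l p0) in h.
apply: le_trans (le_trans h _); first by rewrite le_eqVlt; apply/orP; left; apply/eqP; ring.
by rewrite le_eqVlt; apply/orP; left; apply/eqP; field; rewrite !gt_eqF.
Qed.

End RealPowers.

Section Averages.
Context {d : measure_display} {T : measurableType d} {R : realType}.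
Variable mu : {measure set T -> \bar R}.
Implicit Types (A : set T) (u : T -> R).

Definition ravg A u : R := (fine (mu A))^-1 * (\int[mu]_(x in A) u x)%R.

Lemma integrable_cst_lty A (c : R) : measurable A -> (mu A < +oo)%E ->
  mu.-integrable A (fun=> c%:E).
Proof.
move=> mA fA; apply/integrableP; split; first exact: measurable_cst.
by rewrite integral_cst//= lte_mul_pinfty// lee_fin.
Qed.

Lemma integrable_dist A u c : measurable A -> (mu A < +oo)%E ->
  mu.-integrable A (EFin \o u) -> mu.-integrable A (fun x => (`|u x - c|)%:E).
Proof.
move=> mA fA iu.
have -> : (fun x => (`|u x - c|)%:E) = (abse \o (fun x => (u x)%:E - (cst c x)%:E))%E.
  by apply/funext => x.
apply: integrable_abse; apply: integrableB => //.
exact: integrable_cst_lty.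
Qed.

(** Jensen's inequality for the power [p], by integrating the tangent line at
    the mean of [|u - c|]. *)
Lemma ravg_powR_le A u (c p : R) : 1 <= p ->
  measurable A -> (0 < mu A)%E -> (mu A < +oo)%E -> mu.-integrable A (EFin \o u) ->
  ((`|ravg A u - c| `^ p)%:E <=
    ((fine (mu A))^-1)%:E * \int[mu]_(x in A) (`|u x - c| `^ p)%:E)%E.
Proof.
move=> p1 mA A0 fA iu; have p0 : 0 < p by apply: lt_le_trans p1.
set m := fine (mu A).
have m0 : 0 < m by rewrite /m fine_gt0// A0.
have mE : mu A = m%:E by rewrite fineK// ge0_fin_numE.
have id := integrable_dist c mA fA iu.
pose l := (\int[mu]_(x in A) `|u x - c|)%R.
have lE : (\int[mu]_(x in A) (`|u x - c|)%:E = l%:E)%E.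
  by rewrite fineK//; exact: integrable_fin_num.
have l0 : 0 <= l by rewrite -lee_fin -lE; apply: integral_ge0 => x _; rewrite lee_fin.
have ic : mu.-integrable A (EFin \o cst c) by exact: integrable_cst_lty.
have hl : `|ravg A u - c| <= m^-1 * l.
  have -> : ravg A u - c = m^-1 * (\int[mu]_(x in A) (u x - c))%R.
    rewrite RintegralB// Rintegral_cst// /ravg -/m mulrBr; congr (_ - _).
    by rewrite mulrCA mulVf ?mulr1// gt_eqF.
  rewrite normrM ger0_norm ?invr_ge0 ?(ltW m0)// ler_wpM2l ?invr_ge0 ?(ltW m0)//.
  apply: le_normr_Rintegral => //.
  rewrite (_ : _ \o _ = (fun x => (u x)%:E - (cst c x)%:E)%E); last by apply/funext.
  exact: integrableB.
set k := m^-1 * l in hl; have k0 : 0 <= k by rewrite mulr_ge0 ?invr_ge0 ?(ltW m0).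
have mu_u : measurable_fun A u by apply/measurable_EFinP; case/integrableP: iu.
have mpow : measurable_fun A (fun x => (`|u x - c| `^ p)%:E).
  apply/measurable_EFinP; apply: (measurableT_comp (f := @powR R ^~ p)).
    exact: measurable_powR.
  by apply: measurableT_comp => //; apply: measurable_funB.
apply: (@le_trans _ _ ((k `^ p)%:E)); first by rewrite lee_fin le_powR// ltW.
rewrite lee_pdivlMl//.
have c1 : 0 <= (p - 1) * k `^ p by rewrite mulr_ge0 ?powR_ge0// subr_ge0.
have : ((p * k `^ (p - 1))%:E * \int[mu]_(x in A) (`|u x - c|)%:E <=
    \int[mu]_(x in A) (`|u x - c| `^ p)%:E + ((p - 1) * k `^ p)%:E * mu A)%E.
  rewrite -integral_cst// -ge0_integralD//.
  rewrite -integralZl_nonneg//; last by rewrite mulr_ge0 ?powR_ge0// ltW.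
  apply: le_integral_in => x _; first by rewrite lee_fin !mulr_ge0 ?powR_ge0// ltW.
  by rewrite -EFinM -EFinD lee_fin powR_tangent.
rewrite lE mE -!EFinM.
have -> : p * k `^ (p - 1) * l = m * k `^ p + (p - 1) * k `^ p * m.
  rewrite -(mulr_powRB1 k0 p0) [in LHS](_ : l = m * k).
    by ring.
  by rewrite /k mulVKf// gt_eqF.
by rewrite EFinD leeD2rE.
Qed.

End Averages.

Section Doubling.
Context {R : realType} {W : completeMetricType R}.
Implicit Types (mu nu : {measure set (borel W) -> \bar R}) (X : set W) (D : R).
Hypothesis sep : separable_metric W.

Definition doubling_on mu X D := forall x r, X x -> 0 < r ->
  0 < vol mu x r /\ vol mu x (2 * r) <= D * vol mu x r.

Lemma doubling_iter mu X D n x r : 1 <= D -> doubling_on mu X D -> X x -> 0 < r ->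
  vol mu x (2 ^+ n * r) <= D ^+ n * vol mu x r.
Proof.
move=> D1 dX Xx r0; elim: n => [|n IH]; first by rewrite !expr0 !mul1r.
rewrite !exprS -!mulrA.
have /(_ (2 ^+ n * r)) [] := dX x _ Xx; first by posr.
move=> _ /le_trans; apply; rewrite ler_wpM2l//; exact: le_trans D1.
Qed.

(** Balls of comparable radii at comparable positions have comparable volumes. *)
Lemma vol_compare mu X D n x y r s : finite_total mu -> 1 <= D ->
  doubling_on mu X D -> X y -> 0 < s -> mdist y x + r <= 2 ^+ n * s ->
  vol mu x r <= D ^+ n * vol mu y s.
Proof.
move=> fin D1 dX Xy s0 rs; apply: le_trans (doubling_iter n D1 dX Xy s0).
exact: le_vol.
Qed.

Local Open Scope ereal_scope.

(** Pointwise bounds hold only on the set [X] of full measure that carries the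
    geometry. *)
Lemma le_integral_ae (mu : {measure set (borel W) -> \bar R}) X
    (f g : borel W -> \bar R) :
  measurable (X : set (borel W)) -> mu (~` X) = 0 -> measurable_fun setT f ->
  (forall x, 0 <= f x) -> (forall x, 0 <= g x) -> (forall x, X x -> f x <= g x) ->
  \int[mu]_x f x <= \int[mu]_x g x.
Proof.
move=> mX X0 mf f0 g0 fg.
rewrite -(integral_null_compl mX X0 measurableT mf)//.
by apply: le_integral_set => // x [_ Xx]; exact: fg.
Qed.

Lemma wavg_add_cst mu t (g : borel W -> \bar R) (c : \bar R) z : finite_total mu ->
  measurable_fun setT g -> (forall x, 0 <= g x) -> 0 <= c ->
  wavg mu mu t (fun y => g y + c) z <= wavg mu mu t g z + c.
Proof.
move=> fmu mg g0 c0; have mB := measurable_ball_metric z t.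
rewrite /wavg ge0_integralD//; last exact: measurable_funTS.
rewrite ge0_muleDr ?integral_ge0// leeD2l// integral_cst//.
rewrite volE// muleCA -EFinM.
have [->|v0] := eqVneq (vol mu z t) 0%R; first by rewrite mulr0 mule0.
by rewrite mulVf// mule1.
Qed.

Definition osc_at mu (p : R) (f : W -> R) (t : R) (x : W) : \bar R :=
  wavg mu mu t (fun y => (`|f y - f x| `^ p)%:E) x.

Definition osc mu p f t : \bar R := \int[mu]_x osc_at mu p f t x.

Lemma osc_at_ge0 mu p f t x : 0 <= osc_at mu p f t x.
Proof. by apply: wavg_ge0 => y; rewrite lee_fin powR_ge0. Qed.

Lemma osc_ge0 mu p f t : 0 <= osc mu p f t.
Proof. by apply: integral_ge0 => x _; exact: osc_at_ge0. Qed.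

Lemma measurable_osc_at mu p (f : borel W -> R) t : finite_total mu ->
  measurable_fun setT f -> measurable_fun setT (osc_at mu p f t : borel W -> \bar R).
Proof.
move=> fmu mf; apply: (@measurable_wavg2 _ _ sep mu mu t
  (fun xy => (`|f xy.2 - f xy.1| `^ p)%:E)) => //.
exact: measurable_pow_dist.
Qed.

Lemma wavg_radius_le mu eta X D (g : W -> \bar R) t s x : finite_total mu ->
  (1 <= D)%R -> doubling_on mu X D -> X x -> (0 < t)%R -> (t <= s)%R ->
  (s <= 2 * t)%R -> (forall y, 0 <= g y) ->
  wavg mu eta t g x <= D%:E * wavg mu eta s g x.
Proof.
move=> fmu D1 dX Xx t0 ts s2 g0.
have s0 : (0 < s)%R by exact: lt_le_trans ts.
have [vt v2t] := dX x t Xx t0; have [vs _] := dX x s Xx s0.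
rewrite /wavg muleA -EFinM; apply: lee_pmul.
- by rewrite lee_fin invr_ge0 vol_ge0.
- exact: integral_ge0.
- rewrite lee_fin ler_pdivlMr// ler_pdivrMl// mulrC.
  by apply: le_trans v2t; apply: le_vol => //; rewrite mdistxx add0r.
- by apply: le_integral_set => //; exact: sub_ballr.
Qed.

(** A larger ball contains the smaller one, and doubling bounds the quotient of
    the volumes. *)
Lemma almost_increasing_osc mu X D p (f : borel W -> R) : finite_total mu ->
  measurable (X : set (borel W)) -> mu (~` X) = 0 ->
  (1 <= D)%R -> doubling_on mu X D -> measurable_fun setT f ->
  almost_increasing D (osc mu p f).
Proof.
move=> fmu mX X0 D1 dX mf t s t0 ts s2.
have D0 : (0 <= D)%R by exact: le_trans D1.
rewrite /osc -integralZl_nonneg//; last by move=> x _; exact: osc_at_ge0.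
apply: (le_integral_ae mX X0) => [|x|x|x Xx].
- exact: measurable_osc_at.
- exact: osc_at_ge0.
- by rewrite mule_ge0 ?osc_at_ge0// lee_fin.
- by apply: (wavg_radius_le _ fmu D1 dX Xx) => // y; rewrite lee_fin powR_ge0.
Qed.

Lemma osc_radius_le mu X D n p (f : borel W -> R) t : finite_total mu ->
  measurable (X : set (borel W)) -> mu (~` X) = 0 ->
  (1 <= D)%R -> doubling_on mu X D -> measurable_fun setT f -> (0 < t)%R ->
  osc mu p f t <= (D ^+ n)%:E * osc mu p f (2 ^+ n * t).
Proof.
move=> fmu mX X0 D1 dX mf t0; elim: n => [|n IH]; first by rewrite !expr0 !mul1r mul1e.
apply: (le_trans IH); rewrite exprSr EFinM -muleA lee_wpmul2l//.
  by rewrite lee_fin exprn_ge0// (le_trans _ D1).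
have nt : (0 < 2 ^+ n * t)%R by posr.
apply: (almost_increasing_osc _ fmu mX X0 D1 dX mf) => //.
  by rewrite exprS -mulrA ler_peMl ?ler1n// ltW.
by rewrite exprS mulrA.
Qed.

(** Balls of radius at least [r] all contain [X], so that they agree up to null
    sets. *)
Lemma osc_large mu X p (f : borel W -> R) r t : finite_total mu ->
  measurable (X : set (borel W)) -> mu (~` X) = 0 -> measurable_fun setT f ->
  (forall x, X x -> X `<=` ball x r) -> (r <= t)%R -> osc mu p f t = osc mu p f r.
Proof.
move=> fmu mX X0 mf Xr rt.
have mo s := measurable_osc_at p s fmu mf.
have o0 s x := osc_at_ge0 mu p f s x.
rewrite /osc -!(integral_null_compl mX X0 measurableT (mo _))//.
apply: eq_integral => x; rewrite inE => -[_ Xx].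
have m0 (g : borel W -> \bar R) : measurable_fun setT g -> (forall y, 0 <= g y) ->
    \int[mu]_(y in ball x t) g y = \int[mu]_(y in ball x r) g y.
  move=> mg g0.
  have e s : (r <= s)%R -> \int[mu]_(y in ball x s) g y = \int[mu]_(y in X) g y.
    move=> rs; rewrite -(integral_null_compl mX X0); last 3 first.
    - exact: measurable_ball_metric.
    - exact: measurable_funTS.
    - by [].
    congr integral; apply/seteqP; split => [y []//|y Xy]; split => //.
    by apply: (sub_ballr rs); exact: Xr.
  by rewrite !e.
have mp := measurable_powR_dist (f x) p mf.
have v : vol mu x t = vol mu x r.
  have := m0 (cst 1) (measurable_cst _) (fun=> lee01).
  rewrite !integral_cst ?mul1e; [|exact: measurable_ball_metric..].
  by rewrite /vol => ->.
by rewrite /osc_at /wavg v m0// => y; rewrite lee_fin powR_ge0.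
Qed.

Lemma integrable_powR_finite mu (A : set (borel W)) (f : borel W -> R) (p : R) :
  finite_total mu -> (1 <= p)%R -> measurable A -> measurable_fun setT f ->
  \int[mu]_x (`|f x| `^ p)%:E < +oo -> mu.-integrable A (EFin \o f).
Proof.
move=> fmu p1 mA mf fp; have p0 : (0 < p)%R by apply: lt_le_trans p1.
apply: (@integrableS _ _ _ mu setT) => //.
apply/integrableP; split; first exact/measurable_EFinP.
apply: (@le_lt_trans _ _ (\int[mu]_x (1 + (`|f x| `^ p)%:E))).
  apply: le_integralT => x; first exact: abse_ge0.
  rewrite /= -EFinD lee_fin; have [f1|f1] := leP `|f x|%R 1%R.
    by apply: le_trans f1 _; rewrite lerDl powR_ge0.
  apply: (@le_trans _ _ (`|f x| `^ p)%R); last by rewrite lerDr.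
  by apply: le1r_powR => //; exact: ltW.
rewrite ge0_integralD//; last exact: (measurable_powR_norm p mf).
by rewrite integral_cst// mul1e lte_add_pinfty.
Qed.

(** A point value differs from the mean over a set of comparable size by at
    most the mean oscillation around the point. *)
Lemma dist_ravg_le mu (p K s : R) (u : W -> R) (x : W) (B : set (borel W)) :
  finite_total mu -> (1 <= p)%R -> measurable B -> (0 < fine (mu B))%R ->
  mu.-integrable B (EFin \o u) -> B `<=` ball x s ->
  (vol mu x s <= K * fine (mu B))%R ->
  (`|u x - ravg mu B u| `^ p)%:E <= K%:E * osc_at mu p u s x.
Proof.
move=> fmu p1 mB B0 iu Bs vK.
have fB : mu B \is a fin_num by exact: fin_num_finite_total.
have B0' : 0 < mu B by rewrite -(fineK fB) lte_fin.
have Bv : (fine (mu B) <= vol mu x s)%R.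
  rewrite fine_le//; first by apply: fin_num_finite_total => //; exact: measurable_ball_metric.
  by apply: le_measure; rewrite ?inE//; exact: measurable_ball_metric.
have v0 : (0 < vol mu x s)%R by exact: lt_le_trans Bv.
rewrite distrC; apply: le_trans (ravg_powR_le _ p1 mB B0' _ iu) _.
  by rewrite -ge0_fin_numE.
rewrite /osc_at /wavg muleA -EFinM; apply: lee_pmul.
- by rewrite lee_fin invr_ge0 ltW.
- by apply: integral_ge0 => y _; rewrite lee_fin powR_ge0.
- by rewrite lee_fin ler_pdivlMr// ler_pdivrMl// mulrC.
- by apply: le_integral_set => // y _; rewrite lee_fin powR_ge0.
Qed.

(** Two means are compared by averaging the previous bound over the first set. *)
Lemma ravg_dist_le mu (p K s : R) (u : W -> R) (A B : set (borel W)) :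
  finite_total mu -> (1 <= p)%R -> (0 <= K)%R ->
  measurable A -> (0 < fine (mu A))%R -> mu.-integrable A (EFin \o u) ->
  measurable B -> (0 < fine (mu B))%R -> mu.-integrable B (EFin \o u) ->
  (forall x, A x -> B `<=` ball x s /\ (vol mu x s <= K * fine (mu B))%R) ->
  (`|ravg mu A u - ravg mu B u| `^ p)%:E <=
    K%:E * (((fine (mu A))^-1)%:E * \int[mu]_(x in A) osc_at mu p u s x).
Proof.
move=> fmu p1 K0 mA A0 iA mB B0 iB AB.
have fA : mu A \is a fin_num by exact: fin_num_finite_total.
have A0' : 0 < mu A by rewrite -(fineK fA) lte_fin.
apply: le_trans (ravg_powR_le _ p1 mA A0' _ iA) _; first by rewrite -ge0_fin_numE.
rewrite muleCA lee_wpmul2l ?lee_fin ?invr_ge0 ?(ltW A0)//.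
rewrite -integralZl_nonneg//; last by move=> x _; exact: osc_at_ge0.
apply: le_integral_in => x Ax; first by rewrite lee_fin powR_ge0.
by have [? ?] := AB x Ax; exact: dist_ravg_le.
Qed.

(** The integral over a moving ball is measurable for nonnegative integrands, so
    [u] is split into its positive and negative parts. *)
Lemma measurable_ravg_ball mu (u : borel W -> R) t : finite_total mu ->
  measurable_fun setT u ->
  measurable_fun setT (fun x : borel W => ravg mu (ball x t) u).
Proof.
move=> fmu mu_; apply: measurable_funM; first exact: measurable_volV.
apply: (measurableT_comp (f := fine)); first exact: fine_measurable.
have -> : (fun x : borel W => \int[mu]_(y in ball x t) (u y)%:E) =
  (fun x => \int[mu]_(y in ball x t) ((EFin \o u)^\+ y) -
            \int[mu]_(y in ball x t) ((EFin \o u)^\- y)).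
  by apply/funext => x; rewrite integralE.
have mE : measurable_fun setT (EFin \o u) by exact/measurable_EFinP.
apply: emeasurable_funB.
  apply: (@measurable_ball_integral _ _ sep mu ((EFin \o u)^\+ \o snd)) => //.
    by apply: measurableT_comp; [exact: measurable_funepos|exact: measurable_snd].
  by move=> xy; exact: funepos_ge0.
apply: (@measurable_ball_integral _ _ sep mu ((EFin \o u)^\- \o snd)) => //.
  by apply: measurableT_comp; [exact: measurable_funeneg|exact: measurable_snd].
by move=> xy; exact: funeneg_ge0.
Qed.

End Doubling.

(** * The trace operator *)

Section Limits.
Context {R : realType}.

Lemma ereal_cvg0 {T : Type} {F : set_system T} {FF : Filter F} (f : T -> \bar R) :
  (forall r, 0 <= f r)%E ->
  (forall e : R, 0 < e -> \forall r \near F, (f r <= e%:E)%E) ->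
  f r @[r --> F] --> 0%E.
Proof.
move=> f0 fe; apply/fine_cvgP; split.
  apply: filterS (fe 1 ltr01) => r fr.
  by rewrite ge0_fin_numE// (le_lt_trans fr)// ltry.
apply/cvgrPdist_le => e e0; apply: filterS (fe e e0) => r fr /=.
have ff : f r \is a fin_num by rewrite ge0_fin_numE// (le_lt_trans fr)// ltry.
by rewrite sub0r normrN ger0_norm ?fine_ge0// -lee_fin fineK.
Qed.

Lemma geometric_small (h M e : R) : 0 < h < 1 -> 0 < e ->
  exists N, forall n, (N <= n)%N -> M * h ^+ n <= e.
Proof.
move=> /andP[h0 h1] e0.
have hN : `|h| < 1 by rewrite gtr0_norm.
have /cvgrPdist_le/(_ e e0)[N _ hE] := cvg_geometric M hN.
exists N => n Nn; apply: le_trans (ler_norm _) _.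
by have := hE n Nn; rewrite /= sub0r normrN.
Qed.

(** Increments bounded by a geometric sequence give a limit together with a bound
    for its distance to the first term. *)
Lemma geometric_cauchy (u : nat -> R) (c h : R) : 0 < h < 1 ->
  (forall i, `|u i - u i.+1| <= c * h ^+ i) ->
  exists2 L, u i @[i --> \oo] --> L & `|L - u 0%N| <= c / (1 - h).
Proof.
move=> h01 uc; have /andP[h0 h1] := h01.
have c0 : 0 <= c by have := uc 0%N; rewrite expr0 mulr1; apply: le_trans.
have hN : `|h| < 1 by rewrite gtr0_norm.
have cv : cvgn (series (telescope u)).
  apply: normed_cvg; apply: (series_le_cvg _ _ _ (is_cvg_geometric_series (a := c) hN)).
  - by move=> n; exact: normr_ge0.
  - by move=> n; rewrite /geometric/= mulr_ge0// exprn_ge0// ltW.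
  - by move=> n; rewrite /= distrC.
rewrite telescopeK in cv; pose l := limn [sequence u n - u 0%N]_n.
have ul : u i @[i --> \oo] --> l + u 0%N.
  suff : (u n - u 0%N) + u 0%N @[n --> \oo] --> l + u 0%N.
    by rewrite (_ : (fun n => _) = u)//; apply/funext => n; rewrite subrK.
  by apply: cvgD; [exact: cv|exact: cvg_cst].
exists (l + u 0%N) => //; rewrite addrK.
have bnd n : `|u n - u 0%N| <= c / (1 - h).
  apply: (@le_trans _ _ (c * \sum_(0 <= k < n) h ^+ k)); last first.
    by rewrite ler_wpM2l// geometric_sum_le.
  elim: n => [|n IH]; first by rewrite subrr normr0 big_geq// mulr0.
  rewrite big_nat_recr//= mulrDr.
  apply: le_trans (ler_distD (u n) _ _) _; rewrite [leLHS]addrC; apply: lerD => //.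
  by rewrite distrC.
rewrite -(cvg_lim _ (cvg_norm cv))//.
by apply: limr_le; [exact: is_cvg_norm|exact: nearW].
Qed.

End Limits.

Section Trace.
Context {R : realType} {W : completeMetricType R}.
Variables (nu pi : {measure set (borel W) -> \bar R}) (S : set W).
Variables (D A Dp theta delta p : R).
Hypothesis sep : separable_metric W.
Hypotheses (fnu : finite_total nu) (fpi : finite_total pi).
Hypotheses (mS : measurable (S : set (borel W))) (piS : pi (~` S) = 0%E).
Hypotheses (D1 : 1 <= D) (dnu : doubling_on nu setT D).
Hypotheses (Dp1 : 1 <= Dp) (dpi : doubling_on pi S Dp).
Hypotheses (A0 : 0 < A) (delta0 : 0 < delta) (theta0 : 0 < theta) (p1 : 1 <= p).
Hypothesis upper : forall z r, S z -> 0 < r -> r <= 4 * delta ->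
  vol pi z r * r `^ theta <= A * vol nu z r.
Variable h : R.
Hypothesis h01 : 0 < h < 1.
Variable u : borel W -> R.
Hypothesis mu_u : measurable_fun setT u.
Hypothesis up : (\int[nu]_x (`|u x| `^ p)%:E < +oo)%E.

Local Open Scope ereal_scope.

Let p0 : (0 < p)%R. Proof. exact: lt_le_trans p1. Qed.
Let D0 : (0 < D)%R. Proof. exact: lt_le_trans D1. Qed.
Let h0 : (0 < h)%R. Proof. by case/andP: h01. Qed.
Let h1 : (h < 1)%R. Proof. by case/andP: h01. Qed.

Definition trace_radius (j : nat) : R := dyad (2 * delta) j.
Local Notation rad := trace_radius.

Let rad0 j : (0 < rad j)%R. Proof. by apply: dyad_gt0; posr. Qed.

Definition trace_avg (j : nat) (z : W) : R := ravg nu (ball z (rad j)) u.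

(** The [p]-th powers of the differences of the means over dyadic balls centred
    at a boundary point are controlled by the mean of the local oscillation. *)
Definition ball_osc (j : nat) (z : W) : \bar R :=
  wavg nu nu (rad j) (osc_at nu p u (4 * rad j)) z.

Let K : R := D ^+ 4.
Let lam : R := (h `^ p)^-1.
Let K0 : (0 < K)%R. Proof. by rewrite /K; posr. Qed.
Let lam0 : (0 < lam)%R. Proof. by rewrite /lam; posr. Qed.

(** Weighting the later scales by growing powers of [lam], that is, by the inverse
    of [h `^ p], makes a finite tail bound the [i]-th increment of the means by a
    multiple of [h ^+ i]. *)
Definition osc_tail (k : nat) (z : W) : \bar R :=
  \sum_(0 <= i <oo) (lam ^+ i)%:E * ball_osc (k + i) z.

(** The upper limit exists everywhere and is measurable; it is the limit of the
    means wherever these converge. *)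
Definition trace (z : W) : R := fine (limn_esup (fun j => (trace_avg j z)%:E)).

Let int_ball x r : nu.-integrable (ball x r) (EFin \o u).
Proof.
by apply: integrable_powR_finite up => //; exact: measurable_ball_metric.
Qed.

Let vol0 x r : (0 < r)%R -> (0 < vol nu x r)%R.
Proof. by move=> r0; have [] := dnu (x := x) I r0. Qed.

Let bosc0 j z : 0 <= ball_osc j z.
Proof. by apply: wavg_ge0 => y; exact: osc_at_ge0. Qed.

Let mbosc j : measurable_fun setT (ball_osc j : borel W -> \bar R).
Proof.
apply: measurable_wavg => //; last by move=> x; exact: osc_at_ge0.
exact: measurable_osc_at.
Qed.

Let lamb0 i k z : 0 <= (lam ^+ i)%:E * ball_osc (k + i) z.
Proof. by rewrite mule_ge0// lee_fin exprn_ge0// ltW. Qed.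

Let tail0 k z : 0 <= osc_tail k z.
Proof. exact: nneseries_ge0. Qed.

Let mtail k : measurable_fun setT (osc_tail k : borel W -> \bar R).
Proof.
apply: ge0_emeasurable_sum => [j x _ _|j _]; first exact: lamb0.
by apply: emeasurable_funM => //; exact: measurable_cst.
Qed.

Lemma ball_osc_le_tail k z : ball_osc k z <= osc_tail k z.
Proof.
have := nneseries_ge_term 0 (fun i => lamb0 i k z).
by rewrite expr0 mul1e addn0.
Qed.

Let le_K n (x : \bar R) : 0 <= x -> (n <= 4)%N -> (D ^+ n)%:E * x <= K%:E * x.
Proof.
by move=> x0 n4; apply: lee_wpmul2r => //; rewrite lee_fin ler_weXn2l.
Qed.

Let radS j : rad j = (2 * rad j.+1)%R.
Proof. exact: dyadS. Qed.

Let vol_le n x y r s : (0 < s)%R -> (mdist y x + r <= 2 ^+ n * s)%R -> (n <= 4)%N ->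
  (vol nu x r <= K * vol nu y s)%R.
Proof.
move=> s0 rs n4; apply: le_trans (vol_compare fnu D1 dnu I s0 rs) _.
by rewrite ler_wpM2r ?vol_ge0// ler_weXn2l.
Qed.

(** The two balls have the same centre and radii in the ratio two, and both lie in
    the ball of four times the larger radius around each point of the first. *)
Lemma trace_avg_step j z :
  (`|trace_avg j z - trace_avg j.+1 z| `^ p)%:E <= K%:E * ball_osc j z.
Proof.
apply: (@ravg_dist_le _ _ nu p K (4 * rad j)) => //; try exact: measurable_ball_metric;
  try exact: vol0; try exact: int_ball; first exact: ltW.
move=> x; rewrite in_ball => zx; split.
  apply: sub_ball; rewrite metric_sym.
  by rewrite radS in zx *; move: (rad0 j.+1) zx; lra.
apply: (@vol_le 4) => //.
by rewrite radS in zx *; move: (rad0 j.+1) zx; lra.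
Qed.

Lemma trace_avg_near j z w : (mdist z w < rad j)%R ->
  (`|trace_avg j z - trace_avg j w| `^ p)%:E <= K%:E * ball_osc j z.
Proof.
move=> zw; apply: (@ravg_dist_le _ _ nu p K (4 * rad j)) => //; try exact: measurable_ball_metric;
  try exact: vol0; try exact: int_ball; first exact: ltW.
move=> x; rewrite in_ball => zx; have xw := metric_triangle x z w.
rewrite (metric_sym x z) in xw; split.
  by apply: sub_ball; move: xw zx zw (rad0 j); lra.
by apply: (@vol_le 3) => //; rewrite metric_sym; move: xw zx zw (rad0 j); lra.
Qed.

Lemma wavg_dist_trace_avg j z :
  wavg nu nu (rad j) (fun x => (`|u x - trace_avg j z| `^ p)%:E) z <=
  K%:E * ball_osc j z.
Proof.
rewrite /ball_osc /wavg muleCA lee_wpmul2l// ?lee_fin ?invr_ge0 ?vol_ge0//.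
rewrite -integralZl_nonneg//; [|exact: ltW|by move=> x _; exact: osc_at_ge0].
apply: le_integral_in => x; first by rewrite lee_fin powR_ge0.
rewrite in_ball => zx; apply: dist_ravg_le => //; first exact: measurable_ball_metric.
- exact: vol0.
- by apply: sub_ball; rewrite metric_sym; move: zx (rad0 j); lra.
- by apply: (@vol_le 3) => //; move: zx (rad0 j); lra.
Qed.

Let C0 : R := K * ((1 - h)^-1) `^ p.
Let C00 : (0 < C0)%R.
Proof. by apply: mulr_gt0 => //; apply: powR_gt0; rewrite invr_gt0 subr_gt0. Qed.

Lemma trace_of_cvg z (L : R) : trace_avg j z @[j --> \oo] --> L -> trace z = L.
Proof.
move=> aL; have aE : (trace_avg j z)%:E @[j --> \oo] --> L%:E.
  by apply: cvg_EFin => //; exact: nearW.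
by rewrite /trace (cvg_limn_einf_sup aE).2.
Qed.

(** The weights [lam ^+ i] turn summability of the [p]-th powers into geometric
    decay of the increments, hence convergence without Minkowski's inequality. *)
Lemma trace_avg_cvg k z : osc_tail k z < +oo ->
  trace_avg j z @[j --> \oo] --> trace z /\
  (`|trace z - trace_avg k z| `^ p)%:E <= C0%:E * osc_tail k z.
Proof.
move=> tfin; have tf : osc_tail k z \is a fin_num by rewrite ge0_fin_numE.
pose M := fine (osc_tail k z); have ME : osc_tail k z = M%:E by rewrite fineK.
have M0 : (0 <= M)%R by exact/fine_ge0.
pose c := ((K * M) `^ p^-1)%R.
have KM0 : (0 <= K * M)%R by rewrite mulr_ge0// ltW.
have pV0 : (0 <= p^-1)%R by rewrite invr_ge0 ltW.
have step i : (`|trace_avg (i + k) z - trace_avg (i.+1 + k) z| <= c * h ^+ i)%R.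
  have hi : (h ^+ i)%R = (((h `^ p) ^+ i) `^ p^-1)%R.
    rewrite -[in RHS]powR_mulrn ?powR_ge0// -!powRrM -[LHS]powR_mulrn; last exact: ltW.
    by congr (_ `^ _)%R; field; rewrite gt_eqF.
  rewrite /c hi -powRM ?exprn_ge0 ?powR_ge0//.
  rewrite -[leLHS](@powRr1 _ _ (normr_ge0 _)) -(@mulfV _ p) ?gt_eqF// powRrM.
  apply: le_powR => //.
  have := nneseries_ge_term i (fun i => lamb0 i k z); rewrite -/(osc_tail k z) ME.
  have := trace_avg_step (i + k) z; rewrite -addSn addnC => st lt.
  have bf : ball_osc (k + i) z \is a fin_num.
    rewrite ge0_fin_numE// ltey; apply/eqP => b; move: lt.
    by rewrite b gt0_muley ?leye_eq// lte_fin exprn_gt0.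
  move: st lt; rewrite -(fineK bf) -!EFinM !lee_fin => st lt.
  apply: (le_trans st); rewrite -mulrA ler_wpM2l//; first exact: ltW.
  by rewrite -ler_pdivrMr ?exprn_gt0 ?powR_gt0// -exprVn mulrC.
have [L uL Lb] := geometric_cauchy h01 step.
have aL : trace_avg j z @[j --> \oo] --> L by rewrite -(cvg_shiftn k).
have tL := trace_of_cvg aL.
split; first by rewrite tL.
rewrite ME -EFinM lee_fin tL add0n in Lb *.
apply: (@le_trans _ _ ((c / (1 - h)) `^ p)%R); first exact: le_powR (ltW p0) _ Lb.
rewrite powRM ?powR_ge0//; last by rewrite invr_ge0 subr_ge0 ltW.
by rewrite /c -powRrM mulVf ?gt_eqF// powRr1// /C0 mulrAC.
Qed.

Definition trace_error (k : nat) (z : W) : \bar R :=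
  (`|trace z - trace_avg k z| `^ p)%:E.

Lemma trace_error_le k z : trace_error k z <= C0%:E * osc_tail k z.
Proof.
have [->|t] := eqVneq (osc_tail k z) +oo; first by rewrite gt0_muley ?leey.
by apply: (trace_avg_cvg _).2; rewrite ltey.
Qed.

Lemma measurable_trace : measurable_fun setT (trace : borel W -> R).
Proof.
apply: measurableT_comp; first exact: fine_measurable.
apply: measurable_fun_limn_esup => j; apply/measurable_EFinP.
exact: measurable_ravg_ball.
Qed.

Let terr0 k z : 0 <= trace_error k z.
Proof. by rewrite lee_fin powR_ge0. Qed.

Let mterr k : measurable_fun setT (trace_error k : borel W -> \bar R).
Proof.
apply/measurable_EFinP; apply: (measurableT_comp (f := @powR R ^~ p)).
  exact: measurable_powR.
apply: measurableT_comp => //; apply: measurable_funB; first exact: measurable_trace.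
exact: measurable_ravg_ball.
Qed.

(** Averaging over balls centred on the boundary and then integrating over the
    boundary costs the factor [r `^ (- theta)] by the codimension hypothesis. *)
Lemma integral_boundary_wavg_le (r : R) (g : borel W -> \bar R) :
  (0 < r)%R -> (r <= 2 * delta)%R -> measurable_fun setT g -> (forall x, 0 <= g x) ->
  \int[pi]_z wavg nu nu r g z <= (A * D * r `^ (- theta))%:E * \int[nu]_x g x.
Proof.
move=> r0 r2 mg g0.
apply: (@integral_wavg_le _ _ sep pi nu nu S setT) => //.
- by rewrite setCT measure0.
- by posr.
move=> y z _ Sz; rewrite in_ball => yz; split; first exact: vol0.
have r20 : (0 < 2 * r)%R by posr.
have r24 : (2 * r <= 4 * delta)%R by move: r2; lra.
have up2 := upper Sz r20 r24.
have [_ d2] := dnu (x := z) I r0.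
have e2 : (r `^ theta <= (2 * r) `^ theta)%R.
  by apply: le_powR; [exact: ltW|exact: ltW|move: r0; lra].
rewrite powRN mulrAC ler_pdivlMr ?powR_gt0//.
apply: (@le_trans _ _ (vol pi z (2 * r) * (2 * r) `^ theta)%R).
  apply: ler_pM; rewrite ?vol_ge0 ?powR_ge0//.
  by apply: le_vol => //; rewrite metric_sym; move: yz; lra.
by apply: (le_trans up2); rewrite -mulrA ler_wpM2l//; exact: ltW.
Qed.

Let rad_le j : (rad j <= 2 * delta)%R.
Proof. by apply: dyad_le; posr. Qed.

Definition weighted_osc (k : nat) : \bar R :=
  \sum_(0 <= i <oo) (lam ^+ i)%:E *
    ((rad (k + i) `^ (- theta))%:E * osc nu p u (4 * rad (k + i))).

Let wosc0 k i : 0 <= (lam ^+ i)%:E *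
  ((rad (k + i) `^ (- theta))%:E * osc nu p u (4 * rad (k + i))).
Proof.
by rewrite !mule_ge0 ?osc_ge0// lee_fin ?powR_ge0// exprn_ge0// ltW.
Qed.

Let AD0 : (0 < A * D)%R. Proof. by posr. Qed.

Lemma integral_ball_osc_le j : \int[pi]_z ball_osc j z <=
  (A * D)%:E * ((rad j `^ (- theta))%:E * osc nu p u (4 * rad j)).
Proof.
rewrite muleA -EFinM; apply: integral_boundary_wavg_le => //.
- exact: measurable_osc_at.
- by move=> x; exact: osc_at_ge0.
Qed.

Lemma integral_osc_tail_le k :
  \int[pi]_z osc_tail k z <= (A * D)%:E * weighted_osc k.
Proof.
rewrite /osc_tail integral_nneseries//; last first.
  by move=> i; apply: emeasurable_funM => //; exact: measurable_cst.
rewrite /weighted_osc -nneseriesZl//.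
apply: lee_nneseries => [i _ _|i _]; first by apply: integral_ge0.
rewrite integralZl_nonneg//; last by rewrite exprn_ge0// ltW.
rewrite [leRHS]muleCA lee_wpmul2l// ?lee_fin ?exprn_ge0 ?(ltW lam0)//.
exact: integral_ball_osc_le.
Qed.

Lemma integral_ball_osc_le_weighted k :
  \int[pi]_z ball_osc k z <= (A * D)%:E * weighted_osc k.
Proof.
apply: le_trans (integral_osc_tail_le k).
by apply: le_integralT => // z; exact: ball_osc_le_tail.
Qed.

Lemma integral_trace_error_le k :
  \int[pi]_z trace_error k z <= (C0 * (A * D))%:E * weighted_osc k.
Proof.
rewrite (EFinM C0) -muleA.
apply: (@le_trans _ _ (C0%:E * \int[pi]_z osc_tail k z)); last first.
  by apply: lee_wpmul2l; [rewrite lee_fin ltW|exact: integral_osc_tail_le].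
rewrite -integralZl_nonneg//; last exact: ltW.
by apply: le_integralT => // z; exact: trace_error_le.
Qed.

(** Between two boundary points at distance less than [rad k] the trace passes
    through the means at scale [k]: the two trace errors and the difference of
    the means are all integrals of oscillations of [u] over balls centred on the
    boundary. *)
Lemma osc_trace_le k : osc pi p trace (rad k) <=
  (4 `^ p * (Dp * C0 + K + C0) * (A * D))%:E * weighted_osc k.
Proof.
have Dp0 : (0 < Dp)%R by exact: lt_le_trans Dp1.
have E40 : (0 <= 4 `^ p :> R)%R by exact: powR_ge0.
have b1 z : 0 <= K%:E * ball_osc k z by rewrite mule_ge0// lee_fin ltW.
have b2 z : 0 <= K%:E * ball_osc k z + trace_error k z by rewrite adde_ge0.
have w0 z : 0 <= wavg pi pi (rad k) (trace_error k) z by exact: wavg_ge0.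
have mK : measurable_fun setT (fun z : borel W => K%:E * ball_osc k z).
  by apply: emeasurable_funM => //; exact: measurable_cst.
have mw : measurable_fun setT (wavg pi pi (rad k) (trace_error k) : borel W -> \bar R).
  exact: measurable_wavg.
apply: (@le_trans _ _ ((4 `^ p)%:E * \int[pi]_z
   (wavg pi pi (rad k) (trace_error k) z + (K%:E * ball_osc k z + trace_error k z)))).
  rewrite -integralZl_nonneg//; last by move=> z _; exact: adde_ge0.
  apply: le_integralT => z; first exact: osc_at_ge0.
  apply: (@le_trans _ _ ((4 `^ p)%:E * wavg pi pi (rad k)
      (fun y => trace_error k y + (K%:E * ball_osc k z + trace_error k z)) z)); last first.
    by apply: lee_wpmul2l; rewrite ?lee_fin//; exact: wavg_add_cst.
  rewrite /osc_at /wavg muleCA lee_wpmul2l// ?lee_fin ?invr_ge0 ?vol_ge0//.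
  rewrite -integralZl_nonneg//; last by move=> y _; exact: adde_ge0.
  apply: le_integral_in => y; first by rewrite lee_fin powR_ge0.
  rewrite in_ball => zy.
  have d1 := dist_powR_le (trace y) (trace z) (trace_avg k y) (ltW p0).
  have d2 := dist_powR_le (trace_avg k y) (trace z) (trace_avg k z) (ltW p0).
  have n1 := trace_avg_near zy; rewrite distrC in n1.
  have t2 : (1 <= 2 `^ p :> R)%R.
    by rewrite -[leLHS](powRr0 2) ler_powR ?ler1n// ltW.
  have e4 : (4 `^ p = 2 `^ p * 2 `^ p :> R)%R.
    by rewrite -powRM//; congr (_ `^ _)%R; ring.
  rewrite (distrC (trace_avg k z)) in d2.
  apply: (@le_trans _ _ ((4 `^ p)%:E * (trace_error k y +
      ((`|trace_avg k y - trace_avg k z| `^ p)%:E + trace_error k z)))); last first.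
    by apply: lee_wpmul2l; rewrite ?lee_fin// leeD2l// leeD2r.
  rewrite /trace_error -!EFinD -EFinM lee_fin e4.
  apply: (le_trans d1); rewrite -mulrA ler_wpM2l ?powR_ge0// mulrDr.
  by apply: lerD => //; rewrite ler_peMl// powR_ge0.
rewrite [leRHS](_ : _ = (4 `^ p)%:E *
    (((Dp * C0 + K + C0) * (A * D))%:E * weighted_osc k)); last first.
  by rewrite muleA -EFinM; congr (_%:E * _); ring.
apply: lee_wpmul2l; first by rewrite lee_fin.
rewrite ge0_integralD//; last exact: emeasurable_funD.
rewrite ge0_integralD// integralZl_nonneg//; last exact: ltW.
have hw : \int[pi]_z wavg pi pi (rad k) (trace_error k) z <=
    Dp%:E * \int[pi]_z trace_error k z.
  apply: (@integral_wavg_le _ _ sep pi pi pi S S) => // y z Sy Sz.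
  rewrite in_ball => yz; have [v1 v2] := dpi Sz (rad0 k); split => //.
  by apply: le_trans v2; apply: le_vol => //; rewrite metric_sym; move: yz; lra.
have te := integral_trace_error_le k.
have be := integral_ball_osc_le_weighted k.
have wk0 : 0 <= weighted_osc k by exact: nneseries_ge0.
apply: (@le_trans _ _ ((Dp * (C0 * (A * D)))%:E * weighted_osc k +
   ((K * (A * D))%:E * weighted_osc k + (C0 * (A * D))%:E * weighted_osc k))).
  apply: leeD; last first.
    by apply: leeD => //; rewrite (EFinM K) -muleA lee_wpmul2l// lee_fin ltW.
  by apply: (le_trans hw); rewrite (EFinM Dp) -muleA lee_wpmul2l// lee_fin ltW.
have c1 : (0 <= Dp * (C0 * (A * D)))%R by posr.
have c2 : (0 <= K * (A * D))%R by posr.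
have c3 : (0 <= C0 * (A * D))%R by posr.
rewrite -!ge0_muleDl ?lee_fin ?addr_ge0// -!EFinD.
by apply: lee_wpmul2r => //; rewrite lee_fin le_eqVlt; apply/orP; left; apply/eqP; ring.
Qed.

(** The trace is the mean over the largest ball plus the trace error at that
    scale; the mean is bounded by Jensen's inequality. *)
Lemma integral_trace_le : \int[pi]_z (`|trace z| `^ p)%:E <=
  (2 `^ p * (C0 * (A * D)))%:E * weighted_osc 0 +
  (2 `^ p * (A * D) * (2 * delta) `^ (- theta))%:E * \int[nu]_x (`|u x| `^ p)%:E.
Proof.
have mup := measurable_powR_norm p mu_u.
have up0 x : 0 <= (`|u x| `^ p)%:E by rewrite lee_fin powR_ge0.
have E0 : (0 <= 2 `^ p :> R)%R by exact: powR_ge0.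
pose g := wavg nu nu (rad 0) (fun x => (`|u x| `^ p)%:E).
have g0 z : 0 <= g z by exact: wavg_ge0.
have mg : measurable_fun setT (g : borel W -> \bar R) by exact: measurable_wavg.
apply: (@le_trans _ _ ((2 `^ p)%:E * \int[pi]_z (trace_error 0 z + g z))).
  rewrite -integralZl_nonneg//; last by move=> z _; exact: adde_ge0.
  apply: le_integralT => z; first by rewrite lee_fin powR_ge0.
  have := dist_powR_le (trace z) 0%R (trace_avg 0 z) (ltW p0); rewrite !subr0 => d.
  have gz : (`|trace_avg 0 z| `^ p)%:E <= g z.
    have := @ravg_powR_le _ _ _ nu (ball z (rad 0)) u 0%R p p1.
    rewrite subr0 volE//; under eq_integral do rewrite subr0.
    apply=> //; [exact: measurable_ball_metric|rewrite lte_fin; exact: vol0|exact: ltry].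
  apply: (@le_trans _ _ ((2 `^ p)%:E * (trace_error 0 z + (`|trace_avg 0 z| `^ p)%:E))).
    by rewrite /trace_error -EFinD -EFinM lee_fin.
  by apply: lee_wpmul2l; rewrite ?lee_fin// leeD2l.
rewrite ge0_integralD// ge0_muleDr ?integral_ge0//.
rewrite -[(_ * _ * _ `^ (- theta))%R]mulrA !(EFinM (2 `^ p)) -!muleA.
apply: leeD; apply: lee_wpmul2l; rewrite ?lee_fin//.
  exact: integral_trace_error_le.
have := integral_boundary_wavg_le (rad0 0) (rad_le 0) mup up0.
by rewrite {2}/trace_radius dyad0.
Qed.

(** The tail is integrable on the boundary by [integral_osc_tail_le]; at every
    point where it is finite, [trace_avg_cvg] and [trace_limit] apply. *)
Lemma trace_avg_limit_ae : weighted_osc 0 < +oo ->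
  {ae pi, forall z, osc_tail 0 z < +oo}.
Proof.
move=> w0.
have it : pi.-integrable setT (osc_tail 0 : borel W -> \bar R).
  apply/integrableP; split => //.
  under eq_integral do rewrite gee0_abs//.
  apply: le_lt_trans (integral_osc_tail_le 0) _.
  by rewrite lte_mul_pinfty// lee_fin ltW.
apply: filterS (integrable_ae measurableT it) => z /(_ I).
by rewrite ge0_fin_numE.
Qed.

(** Dropping the first [k] terms of the tail gains the factor by which the
    weights have grown. *)
Lemma osc_tail_shift k z : osc_tail k z <= ((h `^ p) ^+ k)%:E * osc_tail 0 z.
Proof.
rewrite -[leRHS]mul1e.
have lk : (0 < lam ^+ k)%R by posr.
have -> : ((h `^ p) ^+ k)%:E = ((lam ^+ k)^-1)%:E by rewrite /lam exprVn invrK.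
rewrite mul1e lee_pdivlMl//.
rewrite /osc_tail -nneseriesZl//.
apply: nneseries_le => [i|n]; first by rewrite mule_ge0// lee_fin ltW.
apply: le_trans (nneseries_ge_partial (k + n) (fun i => lamb0 i 0 z)).
rewrite [leRHS](@big_cat_nat _ _ _ k _ (k + n))//= ?leq_addr//.
rewrite -[leLHS]add0e; apply: leeD.
  by apply: sume_ge0 => i _; exact: lamb0.
rewrite [leRHS](big_addn 0 (k + n) k) addKn.
apply: lee_sum => i _.
by rewrite muleA -EFinM -exprD addnC add0n (addnC i k).
Qed.

Let wdist r z : \bar R := wavg nu nu r (fun x => (`|u x - trace z| `^ p)%:E) z.

Lemma wavg_trace_le j r z : (rad j.+1 < r)%R -> (r <= rad j)%R ->
  osc_tail 0 z < +oo ->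
  wdist r z <= (D * 2 `^ p * (K + C0))%:E * (((h `^ p) ^+ j)%:E * osc_tail 0 z).
Proof.
move=> r1 r2 tz.
have r0 : (0 < r)%R by exact: lt_trans r1.
have E0 : (0 <= 2 `^ p :> R)%R by exact: powR_ge0.
have d0 y c : 0 <= (`|u y - c| `^ p)%:E by rewrite lee_fin powR_ge0.
apply: (@le_trans _ _ (D%:E * wdist (rad j) z)).
  apply: (wavg_radius_le nu fnu D1 dnu I) => //.
  by rewrite radS ler_pM2l// ltW.
rewrite -!mulrA EFinM -muleA lee_wpmul2l//; first by rewrite lee_fin ltW.
rewrite EFinM -muleA.
apply: (@le_trans _ _ ((2 `^ p)%:E * (K%:E * ball_osc j z + trace_error j z))).
  apply: (@le_trans _ _ ((2 `^ p)%:E * (wavg nu nu (rad j)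
       (fun x => (`|u x - trace_avg j z| `^ p)%:E) z + trace_error j z))); last first.
    by apply: lee_wpmul2l; rewrite ?lee_fin// leeD2r// wavg_dist_trace_avg.
  have mB := measurable_ball_metric z (rad j).
  have -> : trace_error j z = ((vol nu z (rad j))^-1)%:E *
      \int[nu]_(x in ball z (rad j)) trace_error j z.
    rewrite integral_cst// volE// muleCA -EFinM mulVf ?mulr1//.
    by rewrite gt_eqF//; exact: vol0.
  rewrite /wdist /wavg -ge0_muleDr ?integral_ge0//.
  rewrite -ge0_integralD//; last first.
    exact: (measurable_funTS (measurable_powR_dist (trace_avg j z) p mu_u)).
  rewrite [leRHS]muleCA lee_wpmul2l ?lee_fin ?invr_ge0 ?vol_ge0//.
  rewrite -integralZl_nonneg//; last by move=> x _; exact: adde_ge0.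
  apply: le_integral_in => // x _.
  rewrite /trace_error -EFinD -EFinM lee_fin (distrC (trace z)).
  exact: dist_powR_le (ltW p0).
rewrite lee_wpmul2l ?lee_fin//.
apply: (@le_trans _ _ ((K + C0)%:E * osc_tail j z)).
  rewrite EFinD ge0_muleDl ?lee_fin ?(ltW K0) ?(ltW C00)//.
  apply: leeD; last exact: trace_error_le.
  by rewrite lee_wpmul2l ?lee_fin ?(ltW K0)// ball_osc_le_tail.
rewrite lee_wpmul2l ?osc_tail_shift// lee_fin; posr.
Qed.

(** For a radius between two dyadic ones, the mean distance to the trace value is
    at most a constant times [(h `^ p) ^+ j] by the previous lemma. *)
Lemma trace_limit z : osc_tail 0 z < +oo -> wdist r z @[r --> (0 : R)^'+] --> 0.
Proof.
move=> tz; apply: ereal_cvg0 => [r|e e0].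
  by apply: wavg_ge0 => y; rewrite lee_fin powR_ge0.
have tf : osc_tail 0 z \is a fin_num by rewrite ge0_fin_numE.
have hp : (0 < h `^ p < 1)%R.
  rewrite powR_gt0//= -[ltRHS](congr1 (fun f => f p) (@powR1 R)).
  by apply: gt0_ltr_powR => //; rewrite nnegrE// ltW.
have [N hN] := geometric_small (D * 2 `^ p * (K + C0) * fine (osc_tail 0 z)) hp e0.
near=> r.
have r0 : (0 < r)%R by near: r; exact: nbhs_right_gt.
have rN : (r <= rad N)%R by near: r; apply: nbhs_right_le.
have [j /andP[j1 j2]] := dyad_cover r0 (le_trans rN (rad_le N)).
apply: (le_trans (wavg_trace_le j1 j2 tz)).
rewrite -(fineK tf) -!EFinM lee_fin mulrCA [leLHS]mulrC; apply: hN.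
rewrite leqNgt; apply/negP => jN.
have := le_trans rN (dyad_mono (_ : 0 < 2 * delta)%R jN).
by move=> /(_ ltac:(posr)); rewrite leNgt j1.
Unshelve. all: by end_near.
Qed.

End Trace.

(** * The Whitney extension *)

Lemma nneseries_small (R : realType) (u : nat -> \bar R) (e : R) :
  (forall k, 0 <= u k)%E -> (\sum_(0 <= k <oo) u k < +oo)%E -> 0 < e ->
  exists N, forall k, (N <= k)%N -> (u k <= e%:E)%E.
Proof.
move=> u0 uf e0; have := nneseries_tail_cvg uf (fun k _ => u0 k).
move=> /fine_cvgP[/= [N1 _ fin] /cvgrPdist_le /(_ e e0)[N2 _ cv]].
exists (maxn N1 N2) => k; rewrite geq_max => /andP[k1 k2].
have := cv k k2; rewrite /= sub0r normrN => le.
apply: (@le_trans _ _ (\sum_(k <= i <oo) u i)%E).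
  by rewrite (nneseries_split k 1)// addn1 big_nat1 leeDl// nneseries_ge0.
by rewrite -(fineK (fin k k1)) lee_fin; apply: le_trans le; exact: ler_norm.
Qed.

Section DistanceToSet.
Context {R : realType} {W : completeMetricType R}.
Variables (S : set W).
Hypothesis S0 : S !=set0.
Implicit Types (x y z : W).

Definition rho x : R := inf [set mdist x z | z in S].

Let has_inf_dist x : has_inf [set mdist x z | z in S].
Proof.
split; first by have [z Sz] := S0; exists (mdist x z), z.
by exists 0 => _ [z _ <-]; exact: mdist_ge0.
Qed.

Lemma rho_le x z : S z -> rho x <= mdist x z.
Proof. by move=> Sz; apply: ge_inf; [exact: (has_inf_dist x).2|exists z]. Qed.

Lemma rho_approx x e : rho x < e -> exists2 z, S z & mdist x z < e.
Proof. by move=> /(inf_lt (has_inf_dist x).1)[_ [z Sz <-] ?]; exists z. Qed.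

Lemma rho_ge x e : (forall z, S z -> e <= mdist x z) -> e <= rho x.
Proof.
move=> h; apply: lb_le_inf; first exact: (has_inf_dist x).1.
by move=> _ [z Sz <-]; exact: h.
Qed.

Lemma rho_lip x y : rho x <= rho y + mdist x y.
Proof.
rewrite -lerBlDr; apply: rho_ge => z Sz; rewrite lerBlDr.
by apply: le_trans (rho_le x Sz) _; rewrite addrC; exact: metric_triangle.
Qed.

Lemma rho_gt0 x : closed S -> ~ S x -> 0 < rho x.
Proof.
move=> cS nSx; have : open (~` S) by exact: closed_openC.
rewrite openE => /(_ x nSx) /nbhs_ballP[e /= e0 xe].
apply: lt_le_trans e0 _; apply: rho_ge => z Sz; rewrite leNgt; apply/negP => xz.
by apply: (xe z) => //; rewrite in_ball.
Qed.

End DistanceToSet.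

Section Extension.
Context {R : realType} {W : completeMetricType R}.
Variables (nu pi : {measure set (borel W) -> \bar R}) (S : set W).
Variables (D A theta p R0 : R).
Hypothesis sep : separable_metric W.
Hypotheses (fnu : finite_total nu) (fpi : finite_total pi).
Hypotheses (S0 : S !=set0) (cS : closed S) (nuS : nu S = 0%E) (piS : pi (~` S) = 0%E).
Hypotheses (D1 : 1 <= D) (dnu : doubling_on nu setT D).
Hypotheses (A0 : 0 < A) (R00 : 0 < R0) (theta0 : 0 < theta) (p1 : 1 <= p).
Hypothesis bounded : forall x y : W, mdist x y < R0.
Hypothesis upper : forall z r, S z -> 0 < r -> r <= 128 * R0 ->
  vol pi z r * r `^ theta <= A * vol nu z r.
Hypothesis lower : forall z r, S z -> 0 < r -> r <= 128 * R0 ->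
  vol nu z r <= A * (vol pi z r * r `^ theta).
Variable f : borel W -> R.
Hypothesis mf : measurable_fun setT f.
Hypothesis fp : (\int[pi]_x (`|f x| `^ p)%:E < +oo)%E.

Variables (KT : Type) (I : set KT) (pc q : KT -> W) (rk : KT -> R) (N : R).
Hypothesis rk0 : forall k, I k -> 0 < rk k.
Hypothesis qS : forall k, I k -> S (q k).
Hypothesis pq : forall k, I k -> mdist (pc k) (q k) = 8 * rk k.
Hypothesis pS : forall k z, I k -> S z -> 8 * rk k <= mdist (pc k) z.
Hypothesis N0 : 0 < N.

Definition coef (k : KT) : R := ravg pi (ball (q k) (rk k) `&` S) f.

(** The extension enters only through two properties of convex combinations with
    Lipschitz weights: if all the coefficients that matter at [x] are within [M]
    of a constant, so is the value at [x]; and the values at [x] and [y] then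
    differ by at most the Lipschitz constant of the weights times the distance
    times [M]. *)
Variable F : borel W -> R.
Hypothesis mF : measurable_fun setT F.
Hypothesis F_convex : forall x c M, ~ S x ->
  (forall k, I k -> mdist (pc k) x < 2 * rk k -> `|coef k - c| <= M) ->
  `|F x - c| <= M.
Hypothesis F_lip : forall x y c M r, ~ S x -> ~ S y -> 0 < r ->
  (forall k, I k -> mdist (pc k) x < 2 * rk k \/ mdist (pc k) y < 2 * rk k ->
    `|coef k - c| <= M /\ r <= rk k) ->
  `|F x - F y| <= N / r * mdist x y * M.

Local Open Scope ereal_scope.
Local Notation rho := (rho S).

Let p0 : (0 < p)%R. Proof. exact: lt_le_trans p1. Qed.
Let D0 : (0 < D)%R. Proof. exact: lt_le_trans D1. Qed.
Let mS : measurable (S : set (borel W)).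
Proof. by rewrite -(setCK S); apply: measurableC; apply: open_borel; exact: closed_openC. Qed.

Let vol0 x r : (0 < r)%R -> (0 < vol nu x r)%R.
Proof. by move=> r0; have [] := dnu (x := x) Logic.I r0. Qed.

Let rho0 x : ~ S x -> (0 < rho x)%R. Proof. exact: rho_gt0. Qed.

Let rhoR0 x : (rho x <= R0)%R.
Proof.
have [z Sz] := S0; apply: le_trans (rho_le S0 x Sz) _; apply: ltW; exact: bounded.
Qed.

Let vol_cmp n x y r s : (0 < s)%R -> (mdist y x + r <= 2 ^+ n * s)%R ->
  (vol nu x r <= D ^+ n * vol nu y s)%R.
Proof. by move=> s0 rs; exact: (vol_compare fnu D1 dnu Logic.I s0 rs). Qed.

Let pdist (c : R) (a : W) : \bar R := (`|f a - c| `^ p)%:E.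
Let pdist0 c a : 0 <= pdist c a. Proof. by rewrite lee_fin powR_ge0. Qed.
Let mpdist c : measurable_fun setT (pdist c : borel W -> \bar R).
Proof. exact: measurable_powR_dist. Qed.

(** For [x] at distance about [s] from the boundary this is comparable to the mean
    of [g] over the boundary points near [x]: by codimension regularity,
    [s `^ theta] times the [pi]-measure of [ball x (4 * s)] is comparable to its
    [nu]-measure.  The [nu]-volume in the denominator is never zero, and it is
    measurable in [x]. *)
Definition boundary_avg (s : R) (g : W -> \bar R) (x : W) : \bar R :=
  (s `^ theta)%:E * wavg nu pi (4 * s) g x.

Lemma boundary_avg_ge0 s g x : (forall y, 0 <= g y) -> 0 <= boundary_avg s g x.
Proof. by move=> g0; rewrite mule_ge0 ?wavg_ge0// lee_fin powR_ge0. Qed.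

Lemma measurable_boundary_avg s (g : borel W -> \bar R) : measurable_fun setT g ->
  (forall y, 0 <= g y) -> measurable_fun setT (boundary_avg s g : borel W -> \bar R).
Proof.
move=> mg g0; apply: emeasurable_funM; first exact: measurable_cst.
exact: measurable_wavg.
Qed.

Lemma integral_boundary_avg_le s (g : borel W -> \bar R) : (0 < s)%R ->
  measurable_fun setT g -> (forall y, 0 <= g y) ->
  \int[nu]_x boundary_avg s g x <= (D * s `^ theta)%:E * \int[pi]_y g y.
Proof.
move=> s0 mg g0; rewrite integralZl_nonneg ?powR_ge0//; last by move=> x _; exact: wavg_ge0.
rewrite (mulrC D) (EFinM (s `^ theta)) -muleA; apply: lee_wpmul2l.
  by rewrite lee_fin powR_ge0.
apply: (@integral_wavg_le _ _ sep nu nu pi setT setT) => //; try by rewrite setCT measure0.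
move=> y z _ _; rewrite in_ball => yz; have s40 : (0 < 4 * s)%R by posr.
split; first exact: vol0.
rewrite -[leRHS]/(D ^+ 1 * vol nu z (4 * s))%R; apply: vol_cmp => //.
by rewrite metric_sym expr1; move: yz; lra.
Qed.

Lemma boundary_avgZ s c g x : (0 <= c)%R -> (forall y, 0 <= g y) ->
  boundary_avg s (fun y => c%:E * g y) x = c%:E * boundary_avg s g x.
Proof.
move=> c0 g0; rewrite /boundary_avg /wavg integralZl_nonneg//.
by rewrite (muleCA _ c%:E) (muleCA _ c%:E).
Qed.

Let C1 : R := D ^+ 7 * A.
Let C10 : (0 < C1)%R. Proof. by rewrite /C1; posr. Qed.

(** A Whitney ball that meets the neighbourhood of [x] has radius comparable to
    the distance [s] of [x] to the boundary, and its boundary patch lies in the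
    ball of radius [4 * s] around [x] with comparable measure. *)
Lemma coef_dist_le x y s c k : ~ S x -> (s / 2 < rho x)%R -> (rho x <= s)%R ->
  (mdist x y <= rho x / 4)%R -> I k -> (mdist (pc k) y < 2 * rk k)%R ->
  (s / 32 <= rk k)%R /\
  (`|coef k - c| `^ p)%:E <= C1%:E * boundary_avg s (pdist c) x.
Proof.
move=> nSx sx xs xy Ik ky.
have r0 := rk0 Ik; have Sq := qS Ik.
have s0 : (0 < s)%R by exact: lt_le_trans (rho0 nSx) xs.
(* [pc k] is at distance [8 * rk k] from the boundary and within [2 * rk k] of [y] *)
have ry1 : (6 * rk k <= rho y)%R.
  apply: rho_ge => // z Sz; have := pS Ik Sz; have := metric_triangle (pc k) y z.
  by move: ky; lra.
have dq := pq Ik.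
have yq : (mdist y (q k) <= 10 * rk k)%R.
  by have := metric_triangle y (pc k) (q k); rewrite (metric_sym y (pc k)); move: ky; lra.
have ry2 : (rho y <= 10 * rk k)%R by exact: le_trans (rho_le S0 y Sq) yq.
have l1 := rho_lip S0 x y; have l2 := rho_lip S0 y x; rewrite (metric_sym y x) in l2.
have rs : (s / 32 <= rk k)%R by move: l1; lra.
split => //.
have rks : (rk k <= s)%R by move: l2; lra.
have mU : measurable (ball (q k) (rk k) `&` S : set (borel W)).
  by apply: measurableI => //; exact: measurable_ball_metric.
have rkR : (rk k <= 128 * R0)%R by have := rhoR0 x; move: l2 R00; lra.
have xq : (mdist x (q k) <= s / 4 + 10 * rk k)%R.
  by have := metric_triangle x y (q k); move: xs xy yq; lra.
have PU : pi (ball (q k) (rk k) `&` S) = (vol pi (q k) (rk k))%:E.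
  by rewrite measure_setI_null ?volE//; exact: measurable_ball_metric.
have vnu : (vol nu x (4 * s) <= D ^+ 7 * vol nu (q k) (rk k))%R.
  by apply: vol_cmp => //; rewrite metric_sym; move: xq sx l1; lra.
have low := lower Sq r0 rkR.
have vpi0 : (0 < vol pi (q k) (rk k))%R.
  rewrite lt_neqAle vol_ge0 andbT eq_sym; apply/eqP => v0; move: low.
  by rewrite v0 mul0r mulr0 leNgt vol0.
have iU : pi.-integrable (ball (q k) (rk k) `&` S) (EFin \o f).
  exact: (integrable_powR_finite fpi p1 mU mf fp).
apply: le_trans (ravg_powR_le c p1 mU _ _ iU) _.
- by rewrite PU lte_fin.
- by rewrite PU ltry.
rewrite PU /= /boundary_avg /wavg !muleA -!EFinM.
apply: lee_pmul.
- by rewrite lee_fin invr_ge0 ltW.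
- by apply: integral_ge0 => a _; exact: pdist0.
- have v4 : (0 < vol nu x (4 * s))%R by apply: vol0; posr.
  rewrite lee_fin ler_pdivlMr// ler_pdivrMl//.
  apply: (le_trans vnu).
  rewrite (_ : _ * (C1 * _) = D ^+ 7 * (A * (vol pi (q k) (rk k) * s `^ theta)))%R;
    last by rewrite /C1; ring.
  rewrite ler_wpM2l ?exprn_ge0 ?(ltW D0)//; apply: (le_trans low).
  rewrite ler_wpM2l ?(ltW A0)// ler_wpM2l ?vol_ge0//.
  by apply: le_powR; [exact: ltW|exact: ltW|].
- apply: le_integral_set => // a [qa _]; move: qa; rewrite !in_ball => qa.
  by have := metric_triangle x (q k) a; move: xq qa l2; lra.
Qed.

Let powR_inv_le (a M : R) : (0 <= a)%R -> (a `^ p <= M)%R -> (a <= M `^ p^-1)%R.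
Proof.
move=> a0 aM; rewrite -[leLHS](powRr1 a0) -(@mulfV _ p) ?gt_eqF// powRrM.
by apply: le_powR; [rewrite invr_ge0 ltW|exact: powR_ge0|].
Qed.

(** The pointwise convexity of [F] turns the bound for the coefficients into one
    for its values. *)
Lemma F_dist_const_le x s c : ~ S x -> (s / 2 < rho x)%R -> (rho x <= s)%R ->
  (`|F x - c| `^ p)%:E <= C1%:E * boundary_avg s (pdist c) x.
Proof.
move=> nSx sx xs.
have b0 : 0 <= C1%:E * boundary_avg s (pdist c) x.
  by rewrite mule_ge0 ?boundary_avg_ge0// lee_fin ltW.
have [->|bf] := eqVneq (C1%:E * boundary_avg s (pdist c) x) +oo; first exact: leey.
have bfin : C1%:E * boundary_avg s (pdist c) x \is a fin_num by rewrite ge0_fin_numE// ltey.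
pose M := fine (C1%:E * boundary_avg s (pdist c) x).
have ME : C1%:E * boundary_avg s (pdist c) x = M%:E by rewrite fineK.
have M0 : (0 <= M)%R by rewrite -lee_fin -ME.
have FM : (`|F x - c| <= M `^ p^-1)%R.
  apply: F_convex => // k Ik kx; apply: powR_inv_le => //.
  rewrite -lee_fin -ME; apply: (coef_dist_le _ nSx sx xs _ Ik kx).2.
  by rewrite mdistxx divr_ge0// ltW// rho0.
rewrite ME lee_fin; apply: le_trans (le_powR (ltW p0) (normr_ge0 _) FM) _.
by rewrite -powRrM mulVf ?gt_eqF// powRr1.
Qed.

Let C2 : R := (32 * N) `^ p * C1.
Let C20 : (0 < C2)%R. Proof. by rewrite /C2; posr. Qed.

Lemma F_dist_le x y s t c : ~ S x -> ~ S y -> (s / 2 < rho x)%R -> (rho x <= s)%R ->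
  (mdist x y <= t)%R -> (0 < t)%R -> (t <= rho x / 4)%R ->
  (`|F x - F y| `^ p)%:E <=
    (C2 * (t / s) `^ p)%:E * boundary_avg s (pdist c) x.
Proof.
move=> nSx nSy sx xs xyt t0 tx.
have s0 : (0 < s)%R by exact: lt_le_trans (rho0 nSx) xs.
have b0 : 0 <= boundary_avg s (pdist c) x by exact: boundary_avg_ge0.
have c0 : (0 < C2 * (t / s) `^ p)%R by posr.
have [->|bf] := eqVneq (boundary_avg s (pdist c) x) +oo.
  by rewrite gt0_muley ?leey.
have bfin : boundary_avg s (pdist c) x \is a fin_num by rewrite ge0_fin_numE// ltey.
pose b := fine (boundary_avg s (pdist c) x).
have bE : boundary_avg s (pdist c) x = b%:E by rewrite fineK.
have b00 : (0 <= b)%R by rewrite -lee_fin -bE.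
have M0 : (0 <= C1 * b)%R by rewrite mulr_ge0// ltW.
have FM : (`|F x - F y| <= N / (s / 32) * mdist x y * (C1 * b) `^ p^-1)%R.
  apply: (F_lip (c := c)) => //; first by posr.
  move=> k Ik kxy.
  have [z xz kz] : exists2 z, (mdist x z <= rho x / 4)%R & (mdist (pc k) z < 2 * rk k)%R.
    case: kxy => kx; [exists x|exists y] => //; last exact: le_trans xyt tx.
    by rewrite mdistxx divr_ge0// ltW// rho0.
  have [r1 r2] := coef_dist_le c nSx sx xs xz Ik kz; split => //.
  by apply: powR_inv_le => //; rewrite -lee_fin EFinM -bE.
rewrite bE -EFinM lee_fin; apply: le_trans (le_powR (ltW p0) (normr_ge0 _) FM) _.
have e32 : (N / (s / 32) * mdist x y <= (32 * N) * (t / s))%R.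
  rewrite (_ : (N / (s / 32) = 32 * N / s)%R); last by field; rewrite gt_eqF.
  by rewrite mulrAC [leRHS]mulrA ler_wpM2r ?invr_ge0 ?(ltW s0)// ler_wpM2l// mulr_ge0// ltW.
have l0 : (0 <= N / (s / 32) * mdist x y)%R.
  by rewrite mulr_ge0 ?mdist_ge0// divr_ge0// ltW// divr_gt0.
rewrite powRM ?powR_ge0// -powRrM mulVf ?gt_eqF// powRr1//.
rewrite (_ : (C2 * (t / s) `^ p * b = ((32 * N) * (t / s)) `^ p * (C1 * b))%R); last first.
  rewrite powRM; [rewrite /C2; ring| |]; first by rewrite mulr_ge0// ltW.
  by rewrite divr_ge0// ltW.
by apply: ler_wpM2r => //; apply: le_powR => //; exact: ltW.
Qed.

Let C4 : R := D ^+ 2 * A * 2 `^ theta.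
Let C40 : (0 < C4)%R. Proof. by rewrite /C4; posr. Qed.

(** A bound that holds for every boundary point near [x] may be averaged, since
    the boundary has enough mass near [x]. *)
Lemma le_boundary_avg x s (L : \bar R) (g : borel W -> \bar R) :
  (0 < s)%R -> (s <= 64 * R0)%R -> (rho x <= s)%R -> 0 <= L -> (forall b, 0 <= g b) ->
  (forall b, S b -> (mdist x b < 4 * s)%R -> L <= g b) ->
  L <= C4%:E * boundary_avg s g x.
Proof.
move=> s0 sR xs L0 g0 Lg.
have [z Sz xz] : exists2 z, S z & (mdist x z < 2 * s)%R.
  by apply: rho_approx => //; apply: le_lt_trans xs _; move: s0; lra.
have s20 : (0 < 2 * s)%R by posr.
have s40 : (0 < 4 * s)%R by posr.
have mB := measurable_ball_metric x (4 * s).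
have vE : (vol nu x (4 * s) <= C4 * s `^ theta * vol pi x (4 * s))%R.
  apply: (@le_trans _ _ (D ^+ 2 * vol nu z (2 * s))%R).
    by apply: vol_cmp => //; rewrite metric_sym; move: xz; lra.
  have := lower Sz s20; rewrite powRM ?(ltW s0)// => low.
  have zR : (2 * s <= 128 * R0)%R by move: sR; lra.
  rewrite (_ : C4 * _ * _ = D ^+ 2 * (A * (vol pi x (4 * s) * (2 `^ theta * s `^ theta))))%R;
    last by rewrite /C4; ring.
  rewrite ler_wpM2l ?exprn_ge0 ?(ltW D0)//; apply: le_trans (low zR) _.
  rewrite ler_wpM2l ?(ltW A0)// ler_wpM2r ?mulr_ge0 ?powR_ge0//.
  by apply: le_vol => //; move: xz; lra.
have Lint : L * (vol pi x (4 * s))%:E <= \int[pi]_(b in ball x (4 * s)) g b.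
  rewrite -volE// -(measure_setI_null mS piS mB) -integral_cst; last exact: measurableI.
  apply: le_integral_set => // b [xb Sb].
  by apply: Lg => //; rewrite in_ball in xb.
have -> : C4%:E * boundary_avg s g x = ((vol nu x (4 * s))^-1)%:E *
    ((C4 * s `^ theta)%:E * \int[pi]_(y in ball x (4 * s)) g y).
  by rewrite /boundary_avg /wavg !muleA -!EFinM; congr (_%:E * _); ring.
rewrite lee_pdivlMl; last exact: vol0.
apply: (@le_trans _ _ ((C4 * s `^ theta * vol pi x (4 * s))%:E * L)).
  by rewrite lee_wpmul2r// lee_fin.
rewrite (EFinM (C4 * _)) -muleA lee_wpmul2l//; last by rewrite muleC.
by rewrite lee_fin mulr_ge0 ?powR_ge0// ltW.
Qed.

Let C3 : R := A * D ^+ 3.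
Let C30 : (0 < C3)%R. Proof. by rewrite /C3; posr. Qed.

(** The boundary value at [b] may be used as the constant: the average around [x]
    is then an oscillation around [b]. *)
Lemma wavg_pdist_le_osc x b l : (0 < l)%R -> (4 * l <= 128 * R0)%R -> S b ->
  (mdist x b <= 2 * l)%R ->
  (l `^ theta)%:E * wavg nu pi l (pdist (f b)) x <= C3%:E * osc_at pi p f (4 * l) b.
Proof.
move=> l0 lR Sb xb.
have l40 : (0 < 4 * l)%R by posr.
have up := upper Sb l40 lR.
have lo := lower Sb l40 lR.
have vp : (0 < vol pi b (4 * l))%R.
  rewrite lt_neqAle vol_ge0 andbT eq_sym; apply/eqP => v0; move: lo.
  by rewrite v0 mul0r mulr0 leNgt vol0.
rewrite /osc_at /wavg !muleA -!EFinM; apply: lee_pmul.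
- by rewrite lee_fin mulr_ge0 ?powR_ge0// invr_ge0 vol_ge0.
- by apply: integral_ge0 => a _; exact: pdist0.
- rewrite lee_fin ler_pdivlMr// mulrAC ler_pdivrMr; last exact: vol0.
  have lp : (l `^ theta <= (4 * l) `^ theta)%R.
    by apply: le_powR; [exact: ltW|exact: ltW|move: l0; lra].
  apply: (@le_trans _ _ (vol pi b (4 * l) * (4 * l) `^ theta)%R).
    by rewrite mulrC ler_wpM2l// vol_ge0.
  apply: (le_trans up); rewrite /C3 -mulrA ler_wpM2l ?(ltW A0)//.
  by apply: vol_cmp => //; move: xb; lra.
- apply: le_integral_set => // a; rewrite !in_ball => xa.
  have := metric_triangle b x a; rewrite (metric_sym b x).
  by move: xb xa; lra.
Qed.

Let Cf : R := C4 * (C2 * C3).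
Let Cf0 : (0 < Cf)%R. Proof. by rewrite /Cf; posr. Qed.

Lemma boundary_avg_le_osc x b s : (0 < s)%R -> (s <= 8 * R0)%R -> S b ->
  (mdist x b < 4 * s)%R ->
  boundary_avg s (pdist (f b)) x <= C3%:E * osc_at pi p f (16 * s) b.
Proof.
move=> s0 sR Sb xb.
have s40 : (0 < 4 * s)%R by posr.
rewrite (_ : 16 * s = 4 * (4 * s))%R; last by ring.
apply: le_trans (wavg_pdist_le_osc s40 _ Sb _); [|by move: sR; lra|by move: xb s0; lra].
rewrite /boundary_avg lee_wpmul2r ?wavg_ge0// lee_fin.
by apply: le_powR; [exact: ltW|exact: ltW|move: s0; lra].
Qed.

(** Far from the boundary the extension is Lipschitz at the scale of the
    distance to the boundary. *)
Lemma F_dist_far x y s t : ~ S x -> ~ S y -> (s / 2 < rho x)%R -> (rho x <= s)%R ->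
  (s <= 8 * R0)%R -> (mdist x y <= t)%R -> (0 < t)%R -> (t <= rho x / 4)%R ->
  (`|F x - F y| `^ p)%:E <=
    (Cf * (t / s) `^ p)%:E * boundary_avg s (osc_at pi p f (16 * s)) x.
Proof.
move=> nSx nSy sx xs sR xyt t0 tx.
have s0 : (0 < s)%R by exact: lt_le_trans (rho0 nSx) xs.
have c0 : (0 <= C2 * (t / s) `^ p)%R by posr.
have c3 : (0 <= C2 * (t / s) `^ p * C3)%R by posr.
rewrite (_ : Cf * _ = C4 * (C2 * (t / s) `^ p * C3))%R; last by rewrite /Cf; ring.
rewrite EFinM -muleA -boundary_avgZ//; last by move=> b; exact: osc_at_ge0.
apply: le_boundary_avg => //; first by move: sR R00; lra.
- by move=> b; rewrite mule_ge0 ?osc_at_ge0.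
move=> b Sb xb; apply: le_trans (F_dist_le (f b) nSx nSy sx xs xyt t0 tx) _.
rewrite (EFinM (C2 * (t / s) `^ p)) -muleA lee_wpmul2l//.
exact: boundary_avg_le_osc.
Qed.

Let Fdist (x b : W) : \bar R := (`|F x - f b| `^ p)%:E.
Let Fdist0 x b : 0 <= Fdist x b. Proof. by rewrite lee_fin powR_ge0. Qed.
Let mFdist x : measurable_fun setT (Fdist x : borel W -> \bar R).
Proof.
apply/measurable_EFinP; apply: (measurableT_comp (f := @powR R ^~ p)).
  exact: measurable_powR.
by apply: measurableT_comp => //; apply: measurable_funB.
Qed.

(** The mean distance of [F x] to the boundary values near [x], which measures
    the oscillation of [F] close to the boundary. *)
Let Phi (t : R) (x : W) : \bar R := boundary_avg (8 * t) (Fdist x) x.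
Let Phi0 t x : 0 <= Phi t x. Proof. exact: boundary_avg_ge0. Qed.

Let CN : R := C4 * (2 `^ p * D ^+ 2).
Let CN0 : (0 < CN)%R. Proof. by rewrite /CN; posr. Qed.

Lemma boundary_avg_move x y t (g : borel W -> \bar R) : (0 < t)%R ->
  (mdist x y <= t)%R -> (forall b, 0 <= g b) ->
  boundary_avg (4 * t) g x <= (D ^+ 2)%:E * boundary_avg (8 * t) g y.
Proof.
move=> t0 xy g0; rewrite /boundary_avg.
rewrite (_ : 4 * (4 * t) = 16 * t)%R; last by ring.
rewrite (_ : 4 * (8 * t) = 32 * t)%R; last by ring.
have t16 : (0 < 16 * t)%R by posr.
have t32 : (0 < 32 * t)%R by posr.
rewrite [leRHS]muleCA; apply: lee_pmul.
- by rewrite lee_fin powR_ge0.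
- exact: wavg_ge0.
- rewrite lee_fin; apply: le_powR; [exact: ltW|posr|move: t0; lra].
rewrite /wavg muleA -EFinM; apply: lee_pmul.
- by rewrite lee_fin invr_ge0 vol_ge0.
- exact: integral_ge0.
- rewrite lee_fin ler_pdivlMr; last exact: vol0.
  rewrite ler_pdivrMl; last exact: vol0.
  by rewrite [leRHS]mulrC; apply: vol_cmp => //; rewrite expr2; move: xy; lra.
- apply: le_integral_set => // b; rewrite !in_ball => xb.
  have := metric_triangle y x b; rewrite (metric_sym y x).
  by move: xy xb t0; lra.
Qed.

(** Close to the boundary the two values of [F] are compared through the values of
    [f] at common nearby boundary points. *)
Lemma F_dist_near x y t : (0 < t)%R -> (t <= R0)%R -> (mdist x y <= t)%R ->
  (rho x <= 4 * t)%R ->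
  (`|F x - F y| `^ p)%:E <= CN%:E * (Phi t x + Phi t y).
Proof.
move=> t0 tR xy xt; have t40 : (0 < 4 * t)%R by posr.
pose g b := (2 `^ p)%:E * (Fdist x b + Fdist y b).
have g0 b : 0 <= g b by rewrite mule_ge0 ?adde_ge0// lee_fin powR_ge0.
apply: (@le_trans _ _ (C4%:E * boundary_avg (4 * t) g x)).
  apply: le_boundary_avg => //; first by move: tR R00; lra.
  move=> b Sb _; rewrite /g /Fdist -EFinD -EFinM lee_fin (distrC (F y)).
  exact: dist_powR_le (ltW p0).
rewrite /CN (EFinM C4) -muleA lee_wpmul2l ?lee_fin ?(ltW C40)//.
rewrite boundary_avgZ ?powR_ge0//; last by move=> b; exact: adde_ge0.
rewrite (EFinM (2 `^ p)) -muleA lee_wpmul2l ?lee_fin ?powR_ge0//.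
have -> : boundary_avg (4 * t) (fun b => Fdist x b + Fdist y b) x =
    boundary_avg (4 * t) (Fdist x) x + boundary_avg (4 * t) (Fdist y) x.
  rewrite /boundary_avg /wavg ge0_integralD//; last 3 first.
  - exact: measurable_ball_metric.
  - exact: measurable_funTS.
  - exact: measurable_funTS.
  have v0 : 0 <= ((vol nu x (4 * (4 * t)))^-1)%:E by rewrite lee_fin invr_ge0 vol_ge0.
  have i0 z : 0 <= \int[pi]_(b in ball x (4 * (4 * t))) Fdist z b by exact: integral_ge0.
  by rewrite (ge0_muleDr _ (i0 x) (i0 y)) ge0_muleDr// mule_ge0.
rewrite ge0_muleDr//; apply: leeD; apply: boundary_avg_move => //.
by rewrite mdistxx ltW.
Qed.

Let C5 : R := C1 * C3.
Let C50 : (0 < C5)%R. Proof. by rewrite /C5; posr. Qed.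

(** The distance of [x] to the boundary selects one term of this series, the
    other terms only enlarge it and make it measurable. *)
Definition near_bound (t : R) (x : W) : \bar R :=
  \sum_(0 <= m <oo) C5%:E *
    boundary_avg (dyad (16 * t) m) (osc_at pi p f (128 * t)) x.

Let nb_term0 t m x : 0 <= C5%:E *
  boundary_avg (dyad (16 * t) m) (osc_at pi p f (128 * t)) x.
Proof.
rewrite mule_ge0 ?lee_fin ?(ltW C50)// boundary_avg_ge0// => y; exact: osc_at_ge0.
Qed.

Lemma near_bound_ge0 t x : 0 <= near_bound t x.
Proof. exact: nneseries_ge0. Qed.

Let mnb_term t m : measurable_fun setT (fun x : borel W => C5%:E *
  boundary_avg (dyad (16 * t) m) (osc_at pi p f (128 * t)) x).
Proof.
apply: emeasurable_funM; first exact: measurable_cst.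
apply: measurable_boundary_avg; last by move=> y; exact: osc_at_ge0.
exact: measurable_osc_at.
Qed.

Lemma measurable_near_bound t : measurable_fun setT (near_bound t : borel W -> \bar R).
Proof.
by apply: ge0_emeasurable_sum => [m x _ _|m _]; [exact: nb_term0|exact: mnb_term].
Qed.

(** [F x] is an average of [f] at the scale [s] of the distance of [x] to the
    boundary, whereas [Phi] compares it with [f] at the larger scale [t].  The
    double integral over the two boundary balls is estimated with the
    interchanged order: for fixed [a] in the small ball, the integral over the
    large ball is an oscillation of [f] around [a]. *)
Lemma Phi_le_near_bound t x : (0 < t)%R -> (t <= R0)%R -> ~ S x -> (rho x <= 5 * t)%R ->
  Phi t x <= near_bound t x.
Proof.
move=> t0 tR nSx xt.
have x16 : (rho x <= 16 * t)%R by move: xt t0; lra.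
have [m /andP[m1 m2]] := dyad_cover (rho0 nSx) x16.
set s := dyad (16 * t) m in m2.
have sx : (s / 2 < rho x)%R by rewrite /s dyadS mulrAC mulfV ?mul1r.
have s10 : (s < 10 * t)%R by move: sx xt; lra.
have s0 : (0 < s)%R by exact: lt_le_trans (rho0 nSx) m2.
apply: le_trans (nneseries_ge_term m (fun m => nb_term0 t m x)).
have mB4 := measurable_ball_metric x (4 * s).
have mB32 := measurable_ball_metric x (32 * t).
have mBS : measurable (ball x (4 * s) `&` S : set (borel W)) by exact: measurableI.
have v4 : (0 < vol nu x (4 * s))%R by apply: vol0; posr.
have v32 : (0 < vol nu x (32 * t))%R by apply: vol0; posr.
pose h (ba : borel W * borel W) : \bar R := (`|f ba.2 - f ba.1| `^ p)%:E.
have mh : measurable_fun setT h by exact: measurable_pow_dist.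
have h0 ba : 0 <= h ba by rewrite lee_fin powR_ge0.
rewrite -/s /Phi /boundary_avg /wavg (_ : 4 * (8 * t) = 32 * t)%R; last by ring.
apply: (@le_trans _ _ (((8 * t) `^ theta)%:E * (((vol nu x (32 * t))^-1)%:E *
    ((C1 * s `^ theta / vol nu x (4 * s))%:E *
     \int[pi]_(b in ball x (32 * t)) \int[pi]_(a in ball x (4 * s) `&` S) h (b, a))))).
  rewrite lee_wpmul2l ?lee_fin ?powR_ge0// lee_wpmul2l ?lee_fin ?invr_ge0 ?vol_ge0//.
  rewrite -integralZl_nonneg//; last 2 first.
  - by rewrite divr_ge0 ?vol_ge0// mulr_ge0 ?powR_ge0// ltW.
  - by move=> b _; exact: integral_ge0.
  apply: le_integral_in => // b _.
  apply: le_trans (F_dist_const_le (f b) nSx sx m2) _.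
  rewrite /boundary_avg /wavg !muleA -!EFinM lee_wpmul2l//.
    by rewrite lee_fin divr_ge0 ?vol_ge0// mulr_ge0 ?powR_ge0// ltW.
  have := @integral_null_compl _ _ _ pi S (ball x (4 * s)) (pdist (f b)).
  by rewrite /h/= => -> //; exact: measurable_funTS.
rewrite swap_set_integral//.
rewrite !muleA -!EFinM.
rewrite (_ : (8 * t) `^ theta / _ * _ = C1 * s `^ theta / vol nu x (4 * s) *
   ((8 * t) `^ theta / vol nu x (32 * t)))%R; last by ring.
rewrite (_ : C5 * _ / _ = C1 * s `^ theta / vol nu x (4 * s) * C3)%R; last by rewrite /C5; ring.
rewrite !(EFinM (_ / vol nu x (4 * s))) -!muleA lee_wpmul2l//.
  by rewrite lee_fin divr_ge0 ?vol_ge0// mulr_ge0 ?powR_ge0// ltW.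
rewrite -!integralZl_nonneg//; last 4 first.
- exact: ltW.
- by move=> a _; exact: osc_at_ge0.
- by rewrite divr_ge0 ?vol_ge0// powR_ge0.
- by move=> a _; exact: integral_ge0.
apply: le_integral_set => //.
- by move=> a _; rewrite mule_ge0 ?osc_at_ge0// lee_fin ltW.
- by move=> a _; rewrite mule_ge0 ?integral_ge0// lee_fin divr_ge0 ?vol_ge0// powR_ge0.
move=> a [xa Sa]; rewrite in_ball in xa.
have t32 : (0 < 32 * t)%R by posr.
have t4 : (4 * (32 * t) <= 128 * R0)%R by move: tR; lra.
have xa2 : (mdist x a <= 2 * (32 * t))%R by move: xa s10 t0; lra.
rewrite (_ : 128 * t = 4 * (32 * t))%R; last by ring.
apply: le_trans (wavg_pdist_le_osc t32 t4 Sa xa2).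
rewrite /wavg muleA -EFinM; apply: lee_pmul.
- by rewrite lee_fin divr_ge0 ?vol_ge0// powR_ge0.
- exact: integral_ge0.
- rewrite lee_fin ler_wpM2r ?invr_ge0 ?vol_ge0//.
  by apply: le_powR; [exact: ltW|posr|move: t0; lra].
by apply: le_integral_in => // b _; rewrite /h/= distrC.
Qed.

Let gth : R := 2 `^ (- theta).
Let gth01 : (0 < gth < 1)%R.
Proof.
rewrite powR_gt0//= /gth powRN invf_lt1 ?powR_gt0//.
rewrite -[ltLHS](congr1 (fun f => f theta) (@powR1 R)).
by apply: gt0_ltr_powR; rewrite ?nnegrE ?ltr1n.
Qed.

Lemma dyad_powR (r : R) m : (0 < r)%R -> (dyad r m `^ theta = r `^ theta * gth ^+ m)%R.
Proof.
move=> r0; rewrite /dyad powRM ?invr_ge0 ?exprn_ge0 ?(ltW r0)//; congr (_ * _)%R.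
rewrite -[X in (X `^ theta)%R]powR_inv1 ?exprn_ge0// -(@powR_mulrn _ 2%:R)//.
by rewrite /gth -(powR_mulrn m (powR_ge0 2 (- theta))) -!powRrM; congr (_ `^ _)%R; ring.
Qed.

(** The factor [s `^ theta] in [boundary_avg] makes the series over the scales
    converge geometrically: points close to the boundary have little mass. *)
Lemma dyad_boundary_series_le (r c : R) (g : borel W -> \bar R) : (0 < r)%R -> (0 <= c)%R ->
  measurable_fun setT g -> (forall y, 0 <= g y) ->
  \int[nu]_x \sum_(0 <= m <oo) c%:E * boundary_avg (dyad r m) g x <=
  (c * D * r `^ theta / (1 - gth))%:E * \int[pi]_y g y.
Proof.
move=> r0 c0 mg g0.
have t0 m x : 0 <= c%:E * boundary_avg (dyad r m) g x by rewrite mule_ge0 ?boundary_avg_ge0.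
have ig : 0 <= \int[pi]_y g y by exact: integral_ge0.
rewrite integral_nneseries; [|exact: measurableT| |by []]; last first.
  move=> m; apply: emeasurable_funM; first exact: measurable_cst.
  exact: measurable_boundary_avg.
have cDr : (0 <= c * D * r `^ theta)%R by rewrite !mulr_ge0 ?powR_ge0// ltW.
apply: (@le_trans _ _ (\sum_(0 <= m <oo)
   ((c * D * r `^ theta)%:E * \int[pi]_y g y) * (gth ^+ m)%:E)).
  apply: lee_nneseries => [m _ _|m _]; first exact: integral_ge0.
  rewrite integralZl_nonneg//; last by move=> x _; exact: boundary_avg_ge0.
  have := integral_boundary_avg_le (dyad_gt0 m r0) mg g0; rewrite dyad_powR// => le.
  apply: le_trans (lee_wpmul2l _ le) _; first by rewrite lee_fin.
  rewrite muleA [leRHS]muleAC -!EFinM; apply: lee_wpmul2r => //.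
  by rewrite lee_fin le_eqVlt; apply/orP; left; apply/eqP; ring.
apply: le_trans (nneseriesZl_e _ _) _ => [m||].
- by rewrite lee_fin exprn_ge0// ltW//; case/andP: gth01.
- by rewrite mule_ge0.
rewrite [leRHS](_ : _ = ((c * D * r `^ theta)%:E * \int[pi]_y g y) * ((1 - gth)^-1)%:E).
  by rewrite lee_wpmul2l ?mule_ge0// geometric_series_le.
by rewrite muleAC -EFinM.
Qed.

Let C6 : R := C5 * D * 16 `^ theta / (1 - gth).
Let C60 : (0 < C6)%R.
Proof. by apply: divr_gt0; [posr|rewrite subr_gt0; case/andP: gth01]. Qed.

Lemma integral_near_bound_le t : (0 < t)%R ->
  \int[nu]_x near_bound t x <= (C6 * t `^ theta)%:E * osc pi p f (128 * t).
Proof.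
move=> t0; have t16 : (0 < 16 * t)%R by posr.
apply: le_trans (dyad_boundary_series_le t16 (ltW C50) _ _) _.
- exact: measurable_osc_at.
- by move=> y; exact: osc_at_ge0.
apply: lee_wpmul2r; first exact: osc_ge0.
rewrite lee_fin le_eqVlt; apply/orP; left; apply/eqP.
by rewrite powRM ?(ltW t0)// /C6; ring.
Qed.

Local Notation s_ := (dyad R0).

(** The terms [j < i] belong to the points at distance about [s_ j] from the
    boundary, where the Lipschitz bound at the scale [s_ i] applies. *)
Let far_sum (i : nat) (x : W) : \bar R := \sum_(0 <= j < i)
  (Cf * (s_ i / s_ j) `^ p)%:E * boundary_avg (s_ j) (osc_at pi p f (16 * s_ j)) x.

Let far_term0 i j x : 0 <= (Cf * (s_ i / s_ j) `^ p)%:E *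
  boundary_avg (s_ j) (osc_at pi p f (16 * s_ j)) x.
Proof.
apply: mule_ge0; first by rewrite lee_fin mulr_ge0 ?powR_ge0// ltW.
by apply: boundary_avg_ge0 => y; exact: osc_at_ge0.
Qed.

Let far_sum0 i x : 0 <= far_sum i x.
Proof. by apply: sume_ge0 => j _; exact: far_term0. Qed.

Let s0_ i : (0 < s_ i)%R. Proof. exact: dyad_gt0. Qed.
Let sR_ i : (s_ i <= R0)%R. Proof. exact: dyad_le. Qed.

(** The threshold [4 * s_ i] separates the two regimes: closer to the boundary
    the comparison goes through boundary values, farther away through the
    Lipschitz bound.  The terms at [x] and [y] are kept apart, since one is
    averaged over the ball and the other is constant on it. *)
Lemma F_dist_pointwise i x y : ~ S x -> ~ S y -> (mdist x y < s_ i)%R ->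
  (`|F y - F x| `^ p)%:E <=
  CN%:E * near_bound (s_ i) y + (CN%:E * near_bound (s_ i) x + far_sum i x).
Proof.
move=> nSx nSy xy.
have nb0 z : 0 <= CN%:E * near_bound (s_ i) z.
  by rewrite mule_ge0 ?near_bound_ge0// lee_fin ltW.
rewrite distrC; have [xs|xs] := leP (rho x) (4 * s_ i)%R.
  apply: le_trans (F_dist_near (s0_ i) (sR_ i) (ltW xy) xs) _.
  have ys : (rho y <= 5 * s_ i)%R.
    have := rho_lip S0 y x; rewrite (metric_sym y x); move: xy xs; lra.
  have xs5 : (rho x <= 5 * s_ i)%R by have := s0_ i; move: xs; lra.
  have px := Phi_le_near_bound (s0_ i) (sR_ i) nSx xs5.
  have py := Phi_le_near_bound (s0_ i) (sR_ i) nSy ys.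
  rewrite ge0_muleDr//; rewrite addeC; apply: leeD.
    by rewrite lee_wpmul2l// lee_fin ltW.
  apply: (@le_trans _ _ (CN%:E * near_bound (s_ i) x)); last by rewrite leeDl.
  by rewrite lee_wpmul2l// lee_fin ltW.
have [j /andP[j1 j2]] := dyad_cover (rho0 nSx) (rhoR0 x).
have ji : (j < i)%N.
  rewrite ltnNge; apply/negP => ij.
  have := dyad_mono R00 ij; have := s0_ i; move: j2 xs; lra.
apply: (@le_trans _ _ (far_sum i x)); last first.
  by rewrite -[leLHS]add0e leeD// -[leLHS]add0e leeD.
have sx : (s_ j / 2 < rho x)%R by rewrite dyadS mulrAC mulfV ?mul1r.
apply: (le_trans (F_dist_far nSx nSy sx j2 _ (ltW xy) (s0_ i) _)).
- by have := sR_ j; move: R00; lra.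
- by move: xs; lra.
rewrite /far_sum (bigD1_seq j) ?mem_index_iota ?iota_uniq//= leeDl//.
by apply: sume_ge0 => m _; exact: far_term0.
Qed.

Let mfar_sum i : measurable_fun setT (far_sum i : borel W -> \bar R).
Proof.
apply: emeasurable_sum => j; apply: emeasurable_funM; first exact: measurable_cst.
apply: measurable_boundary_avg; last by move=> y; exact: osc_at_ge0.
exact: measurable_osc_at.
Qed.

Let CNnb0 i x : 0 <= CN%:E * near_bound (s_ i) x.
Proof. by rewrite mule_ge0 ?near_bound_ge0// lee_fin ltW. Qed.

Let mCNnb i : measurable_fun setT (fun x : borel W => CN%:E * near_bound (s_ i) x).
Proof. by apply: emeasurable_funM; [exact: measurable_cst|exact: measurable_near_bound]. Qed.

Lemma osc_at_ext_le i x : ~ S x -> osc_at nu p F (s_ i) x <=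
  wavg nu nu (s_ i) (fun y => CN%:E * near_bound (s_ i) y) x +
  (CN%:E * near_bound (s_ i) x + far_sum i x).
Proof.
move=> nSx; set c := (X in _ + X).
have c0 : 0 <= c by exact: adde_ge0.
apply: le_trans (wavg_add_cst (s_ i) x fnu (mCNnb i) (CNnb0 i) c0).
rewrite /osc_at /wavg lee_wpmul2l ?lee_fin ?invr_ge0 ?vol_ge0//.
have mB := measurable_ball_metric x (s_ i).
have nuCS : nu (~` ~` S) = 0 by rewrite setCK.
have d0 y : 0 <= (`|F y - F x| `^ p)%:E by rewrite lee_fin powR_ge0.
have md := measurable_powR_dist (F x) p mF.
have := @integral_null_compl _ _ _ nu (~` S) (ball x (s_ i)) _ (measurableC mS) nuCS mB
   (measurable_funTS md) (fun y _ => d0 y).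
move=> <-; apply: le_integral_set => //.
- by move=> y _; rewrite adde_ge0.
move=> y [xy nSy]; apply: F_dist_pointwise => //.
by rewrite in_ball in xy.
Qed.

Variable Dp : R.
Hypotheses (Dp1 : (1 <= Dp)%R) (dpi : doubling_on pi S Dp).

Definition ext_osc_const : R := CN * (1 + D) * C6 + Cf * D * Dp ^+ 3.

Lemma ext_osc_const_gt0 : (0 < ext_osc_const)%R.
Proof.
have Dp0 : (0 < Dp)%R by exact: lt_le_trans Dp1.
by rewrite /ext_osc_const; apply: addr_gt0; posr.
Qed.

Lemma integral_wavg_self_le t (g : borel W -> \bar R) : (0 < t)%R ->
  measurable_fun setT g -> (forall x, 0 <= g x) ->
  \int[nu]_x wavg nu nu t g x <= D%:E * \int[nu]_x g x.
Proof.
move=> t0 mg g0.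
apply: (@integral_wavg_le _ _ sep nu nu nu setT setT) => //; try by rewrite setCT measure0.
move=> y z _ _; rewrite in_ball => yz; split; first exact: vol0.
rewrite -[leRHS]/(D ^+ 1 * vol nu z t)%R; apply: vol_cmp => //.
by rewrite metric_sym expr1; move: yz; lra.
Qed.

(** At the scale [s_ i] the extension oscillates at most as much as the boundary
    function does at the scales [s_ j] with [j <= i], damped by the factor that
    comes from the Lipschitz bound. *)
Lemma osc_ext_le i : osc nu p F (s_ i) <=
  \sum_(0 <= j < i.+1) (ext_osc_const * ((s_ i / s_ j) `^ p * s_ j `^ theta))%:E *
    osc pi p f (128 * s_ j).
Proof.
have nuCS : nu (~` ~` S) = 0 by rewrite setCK.
have Dp0 : (0 < Dp)%R by exact: lt_le_trans Dp1.
have e1 : (0 < CN * (1 + D) * C6)%R by posr.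
have e2 : (0 < Cf * D * Dp ^+ 3)%R by posr.
have mo : measurable_fun setT (osc_at nu p F (s_ i) : borel W -> \bar R).
  exact: measurable_osc_at.
have w0 x : 0 <= wavg nu nu (s_ i) (fun y => CN%:E * near_bound (s_ i) y) x.
  exact: wavg_ge0.
have mw : measurable_fun setT
    (fun x : borel W => wavg nu nu (s_ i) (fun y => CN%:E * near_bound (s_ i) y) x).
  exact: measurable_wavg.
have inb : \int[nu]_x (CN%:E * near_bound (s_ i) x) <=
    (CN * C6 * s_ i `^ theta)%:E * osc pi p f (128 * s_ i).
  rewrite integralZl_nonneg; [|exact: ltW|by move=> x _; exact: near_bound_ge0].
  rewrite -mulrA (EFinM CN) -muleA lee_wpmul2l ?lee_fin ?(ltW CN0)//.
  exact: integral_near_bound_le.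
apply: (@le_trans _ _ (\int[nu]_x (wavg nu nu (s_ i) (fun y => CN%:E * near_bound (s_ i) y) x +
    (CN%:E * near_bound (s_ i) x + far_sum i x)))).
  apply: (le_integral_ae (measurableC mS) nuCS mo) => [x|x|x nSx].
  - exact: osc_at_ge0.
  - by rewrite !adde_ge0.
  - exact: osc_at_ext_le.
rewrite ge0_integralD//; last 2 first.
- by move=> x _; rewrite adde_ge0.
- by apply: emeasurable_funD; [exact: mCNnb|exact: mfar_sum].
rewrite [X in _ + X]ge0_integralD//.
rewrite big_nat_recr//= addeA addeC; apply: leeD.
  rewrite ge0_integral_sum//; last first.
    move=> j; apply: emeasurable_funM; first exact: measurable_cst.
    apply: measurable_boundary_avg; last by move=> y; exact: osc_at_ge0.
    exact: measurable_osc_at.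
  apply: lee_sum => j _.
  have c0 : (0 <= Cf * (s_ i / s_ j) `^ p)%R by rewrite mulr_ge0 ?powR_ge0// ltW.
  rewrite integralZl_nonneg//; last first.
    by move=> x _; apply: boundary_avg_ge0 => y; exact: osc_at_ge0.
  have mj : measurable_fun setT (osc_at pi p f (16 * s_ j) : borel W -> \bar R).
    exact: measurable_osc_at.
  apply: le_trans (lee_wpmul2l _ (integral_boundary_avg_le (s0_ j) mj _)) _.
  - by rewrite lee_fin.
  - by move=> y; exact: osc_at_ge0.
  have s16 : (0 < 16 * s_ j)%R by posr.
  have := osc_radius_le sep 3 p fpi mS piS Dp1 dpi mf s16.
  rewrite (_ : 2 ^+ 3 * _ = 128 * s_ j)%R; last by ring.
  move=> le; apply: le_trans (lee_wpmul2l _ (lee_wpmul2l _ le)) _ => //.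
    by rewrite lee_fin mulr_ge0 ?powR_ge0// ltW.
  rewrite !muleA -!EFinM lee_wpmul2r ?osc_ge0// lee_fin.
  rewrite (_ : _ * Dp ^+ 3 = Cf * D * Dp ^+ 3 * ((s_ i / s_ j) `^ p * s_ j `^ theta))%R;
    last by ring.
  by rewrite ler_wpM2r ?mulr_ge0 ?powR_ge0// /ext_osc_const lerDr ltW.
rewrite mulfV ?gt_eqF// powR1 mul1r.
apply: (@le_trans _ _ ((CN * (1 + D) * C6 * s_ i `^ theta)%:E * osc pi p f (128 * s_ i))).
  rewrite (_ : _ * _ = CN * C6 * s_ i `^ theta * D + CN * C6 * s_ i `^ theta)%R; last by ring.
  have c0 : (0 <= CN * C6 * s_ i `^ theta)%R.
    by rewrite mulr_ge0 ?powR_ge0// ltW// mulr_gt0.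
  have cD := mulr_ge0 c0 (ltW D0).
  rewrite (EFinD (CN * C6 * s_ i `^ theta * D)) ge0_muleDl//.
  apply: leeD => //.
  apply: le_trans (integral_wavg_self_le (s0_ i) (mCNnb i) (CNnb0 i)) _.
  by rewrite (mulrC _ D) (EFinM D) -muleA lee_wpmul2l ?lee_fin ?(ltW D0).
rewrite lee_wpmul2r ?osc_ge0// lee_fin ler_wpM2r ?powR_ge0//.
by rewrite /ext_osc_const lerDl ltW.
Qed.

Definition ext_Lp_const : R := C1 * D * R0 `^ theta / (1 - gth).

(** The bound of [F] by the constant [0], summed over all distances to the
    boundary. *)
Lemma integral_ext_le : \int[nu]_x (`|F x| `^ p)%:E <=
  ext_Lp_const%:E * \int[pi]_x (`|f x| `^ p)%:E.
Proof.
have nuCS : nu (~` ~` S) = 0 by rewrite setCK.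
have b0 m x : 0 <= C1%:E * boundary_avg (dyad R0 m) (pdist 0) x.
  by rewrite mule_ge0 ?boundary_avg_ge0// lee_fin ltW.
have mF' := measurable_powR_norm p mF.
have pd0 : pdist 0 = (fun x : W => (`|f x| `^ p)%:E).
  by apply/funext => x; rewrite /pdist subr0.
rewrite -pd0; apply: le_trans (dyad_boundary_series_le R00 (ltW C10) (mpdist 0) (pdist0 0)).
apply: (le_integral_ae (measurableC mS) nuCS mF') => [x|x|x nSx].
- by rewrite lee_fin powR_ge0.
- exact: nneseries_ge0.
have [m /andP[m1 m2]] := dyad_cover (rho0 nSx) (rhoR0 x).
have sx : (s_ m / 2 < rho x)%R by rewrite dyadS mulrAC mulfV ?mul1r.
apply: le_trans (nneseries_ge_term m (fun m => b0 m x)).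
by have := F_dist_const_le 0 nSx sx m2; rewrite subr0.
Qed.

Let ext_dist i (z : W) : \bar R :=
  wavg nu nu (s_ i) (fun x => (`|F x - f z| `^ p)%:E) z.

Let mext_dist i : measurable_fun setT (ext_dist i : borel W -> \bar R).
Proof.
apply: (@measurable_wavg2 _ _ sep nu nu (s_ i) (fun zx => (`|F zx.2 - f zx.1| `^ p)%:E)) => //.
exact: measurable_pow_dist.
Qed.

Let ext_dist_ge0 i z : 0 <= ext_dist i z.
Proof. by apply: wavg_ge0 => y; rewrite lee_fin powR_ge0. Qed.

(** The mean distance of the extension to the boundary value: interchanging the
    two integrals turns it into an average of [Phi]. *)
Lemma integral_ext_dist_le i : \int[pi]_z ext_dist i z <=
  (D ^+ 6 * C6)%:E * osc pi p f (128 * s_ i).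
Proof.
set t := s_ i; have t0 : (0 < t)%R by exact: s0_.
have t32 : (0 < 32 * t)%R by posr.
have t8 : (0 < 8 * t)%R by posr.
have D60 : (0 <= D ^+ 6)%R by rewrite exprn_ge0// ltW.
have nuCS : nu (~` ~` S) = 0 by rewrite setCK.
pose h (zx : borel W * borel W) : \bar R :=
  ((vol nu zx.2 (32 * t))^-1)%:E * (`|F zx.2 - f zx.1| `^ p)%:E.
have h0 zx : 0 <= h zx.
  by rewrite mule_ge0// lee_fin ?powR_ge0// invr_ge0 vol_ge0.
have mh : measurable_fun setT h.
  apply: emeasurable_funM; last exact: measurable_pow_dist.
  apply/measurable_EFinP; apply: (measurableT_comp (measurable_volV sep (32 * t) fnu)).
  exact: measurable_snd.
apply: (@le_trans _ _ (\int[pi]_z ((D ^+ 6)%:E * \int[nu]_(x in ball z t) h (z, x)))).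
  apply: (le_integral_ae mS piS (mext_dist i)) => [z|z|z Sz] //.
    by rewrite mule_ge0 ?integral_ge0.
  rewrite /ext_dist /wavg -!integralZl_nonneg//; last by rewrite invr_ge0 vol_ge0.
  apply: le_integral_in => x; rewrite in_ball => zx.
    by rewrite mule_ge0 ?lee_fin ?powR_ge0// invr_ge0 vol_ge0.
  rewrite /h/= muleA lee_wpmul2r ?lee_fin ?powR_ge0//.
  rewrite ler_pdivlMr; last exact: vol0.
  rewrite ler_pdivrMl; last exact: vol0.
  rewrite [leRHS]mulrC; apply: vol_cmp; first exact: s0_.
  by rewrite -/t in zx *; move: zx t0; lra.
rewrite integralZl_nonneg//; last by move=> z _; exact: integral_ge0.
rewrite swap_ball_integral//.
have mG : measurable_fun setT (fun x : borel W => \int[pi]_(z in ball x t) h (z, x)).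
  apply: (@measurable_ball_integral _ _ sep pi (fun xz => h (xz.2, xz.1))) => //.
  by apply: measurableT_comp => //; exact: measurable_swap.
rewrite (EFinM (D ^+ 6)) -muleA lee_wpmul2l//.
apply: (@le_trans _ _ (\int[nu]_x (((8 * t) `^ (- theta))%:E * near_bound t x))).
  apply: (le_integral_ae (measurableC mS) nuCS mG) => [x|x|x nSx].
  - exact: integral_ge0.
  - by rewrite mule_ge0 ?near_bound_ge0// lee_fin powR_ge0.
  have mB := measurable_ball_metric x t.
  have mhx : measurable_fun setT (fun z : borel W => h (z, x)).
    by apply: measurableT_comp mh _; exact: measurable_pair2.
  have := @integral_null_compl _ _ _ pi S (ball x t) _ mS piS mB (measurable_funTS mhx).
  move=> <- //; have [[z [xz Sz]]|ne] := pselect (exists z, (ball x t `&` S) z); last first.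
    rewrite (_ : ball x t `&` S = set0) ?integral_set0.
      by rewrite mule_ge0 ?near_bound_ge0// lee_fin powR_ge0.
    by rewrite -subset0 => z zB; apply: ne; exists z.
  rewrite in_ball in xz.
  have xt : (rho x <= 5 * t)%R.
    by apply: le_trans (rho_le S0 x Sz) _; move: xz t0; lra.
  rewrite powRN lee_pdivlMl ?powR_gt0//.
  apply: le_trans (Phi_le_near_bound t0 (sR_ i) nSx xt).
  rewrite /Phi /boundary_avg lee_wpmul2l ?lee_fin ?powR_ge0//.
  rewrite /wavg (_ : 4 * (8 * t) = 32 * t)%R; last by ring.
  rewrite -integralZl_nonneg ?invr_ge0 ?vol_ge0//.
  apply: le_integral_set => //.
  - by move=> b [xb _]; rewrite !in_ball in xb *; move: xb t0; lra.
  - by move=> b _; rewrite mule_ge0 ?lee_fin ?powR_ge0 ?invr_ge0 ?vol_ge0.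
rewrite integralZl_nonneg ?powR_ge0//; last by move=> x _; exact: near_bound_ge0.
apply: le_trans (lee_wpmul2l _ (integral_near_bound_le t0)) _.
  by rewrite lee_fin powR_ge0.
rewrite muleA -EFinM lee_wpmul2r ?osc_ge0// lee_fin mulrCA ler_piMr ?(ltW C60)//.
rewrite powRN ler_pdivrMl ?powR_gt0// mulr1.
by apply: le_powR; [exact: ltW|exact: ltW|move: t0; lra].
Qed.

(** The sum over the scales of the mean distances is integrable on the boundary,
    so that its terms tend to zero almost everywhere. *)
Lemma ext_dist_small_ae : \sum_(0 <= i <oo) osc pi p f (128 * s_ i) < +oo ->
  {ae pi, forall z, forall e, (0 < e)%R ->
    exists N, forall i, (N <= i)%N ->
      wavg nu nu (s_ i) (fun x => (`|F x - f z| `^ p)%:E) z <= e%:E}.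
Proof.
move=> sf.
have it : pi.-integrable setT (fun z : borel W => \sum_(0 <= i <oo) ext_dist i z).
  apply/integrableP; split.
    by apply: ge0_emeasurable_sum => // i _; exact: mext_dist.
  under eq_integral do rewrite gee0_abs ?nneseries_ge0//.
  rewrite integral_nneseries; [|exact: measurableT|exact: mext_dist|by []].
  have cc : (0 <= D ^+ 6 * C6)%R by rewrite mulr_ge0 ?exprn_ge0// ltW.
  apply: (@le_lt_trans _ _ (\sum_(0 <= i <oo) (D ^+ 6 * C6)%:E * osc pi p f (128 * s_ i))).
    by apply: lee_nneseries => [i _ _|i _]; [exact: integral_ge0|exact: integral_ext_dist_le].
  rewrite nneseriesZl => [|i _]; last exact: osc_ge0.
  by rewrite lte_mul_pinfty ?lee_fin.
apply: filterS (integrable_ae measurableT it) => z /(_ Logic.I) fz e e0.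
apply: nneseries_small => //; first by move=> i; exact: ext_dist_ge0.
by rewrite -ge0_fin_numE//; apply: nneseries_ge0 => i _ _; exact: ext_dist_ge0.
Qed.

End Extension.

(** * Comparison of Besov seminorms across the scales *)

Lemma gap_addr k i : gap k (k + i) = i.
Proof. by rewrite /gap; lia. Qed.

Lemma gap_ge i j : (j <= i)%N -> gap i j = (i - j)%N.
Proof. by rewrite /gap; lia. Qed.

Section SeminormComparison.
Context {R : realType}.
Variables (alpha theta p : R) (q : \bar R).
Hypotheses (p1 : 1 <= p) (q1 : (1 <= q)%E) (theta0 : 0 < theta).
Hypotheses (alpha_gt : theta / p < alpha) (alpha_lt1 : alpha < 1).
Local Notation beta := (alpha - theta / p).
Implicit Types (E : R -> \bar R).

Let p0 : 0 < p. Proof. exact: lt_le_trans p1. Qed.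
Let beta0 : 0 < beta. Proof. by rewrite subr_gt0. Qed.
Let alpha0 : 0 < alpha. Proof. by apply: lt_trans alpha_gt; rewrite divr_gt0. Qed.
Let ln20 : 0 < ln (2 : R). Proof. by rewrite ln_gt0// ltr1n. Qed.

(** Identities between products of powers of dyadic radii are checked on the
    exponents: with all powers written as exponentials they are linear in the
    logarithms. *)
Lemma powR_expR (x y : R) : 0 < x -> x `^ y = expR (y * ln x).
Proof. by move=> x0; rewrite /powR gt_eqF. Qed.

Lemma ln_dyad (r : R) j : 0 < r -> ln (dyad r j) = ln r - j%:R * ln 2.
Proof.
move=> r0; rewrite /dyad lnM ?posrE ?invr_gt0 ?exprn_gt0// lnV ?posrE ?exprn_gt0//.
by rewrite lnXn// mulr_natl.
Qed.

(** The ratio of the geometric sums: half of the decay [2 `^ (- beta * p)] of the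
    boundary oscillation is spent on the Cauchy estimate for the means. *)
Definition trace_ratio : R := 2 `^ (- (beta / 2)).

Lemma trace_ratio01 : 0 < trace_ratio < 1.
Proof.
by rewrite /trace_ratio powR_expR// expR_gt0 expR_lt1 mulNr oppr_lt0 mulr_gt0// divr_gt0.
Qed.

Let g : R := trace_ratio `^ p.
Let g01 : 0 < g < 1.
Proof.
have /andP[h0 h1] := trace_ratio01.
by rewrite /g powR_expR// expR_gt0 expR_lt1 pmulr_rlt0// ln_lt0// h0.
Qed.

(** The bound for the trace, for an abstract oscillation function [E]; the powers of
    [g^-1] grow more slowly than the terms decay when the seminorm of order [alpha]
    is finite. *)
Definition weighted_tail E (delta : R) (k : nat) : \bar R :=
  (\sum_(0 <= i <oo) ((g^-1) ^+ i)%:E *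
    ((dyad (2 * delta) (k + i)%N `^ (- theta))%:E * E (4 * dyad (2 * delta) (k + i)%N)%R))%E.

Let dyad4 (delta : R) j : 4 * dyad (2 * delta) j = dyad (8 * delta) j.
Proof. by rewrite /dyad; ring. Qed.

Let dyadic_value E gam (r : R) j : 0 < r -> (E (dyad r j) =
  (dyad r j `^ (gam * p))%:E * dyadic_terms gam p r E j)%E.
Proof.
move=> r0; rewrite /dyadic_terms muleA -EFinM -powRD.
  by rewrite subrr powRr0 mul1e.
by apply/implyP => _; rewrite gt_eqF// dyad_gt0.
Qed.

Let weighted_term E (delta : R) k i : 0 < delta ->
  (((g^-1) ^+ i)%:E *
    ((dyad (2 * delta) (k + i)%N `^ (- theta))%:E * E (4 * dyad (2 * delta) (k + i)%N)%R) =
  (4 `^ (alpha * p) * dyad (2 * delta) k `^ (beta * p) * g ^+ i)%:E *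
    dyadic_terms alpha p (8 * delta) E (k + i)%N)%E.
Proof.
move=> d0; have d8 : 0 < 8 * delta by posr.
have d2 : 0 < 2 * delta by posr.
rewrite dyad4 (dyadic_value E alpha (k + i) d8) !muleA -!EFinM; congr (_%:E * _)%E.
congr (_ * _).
have gE : g = expR (- (beta / 2) * ln 2 * p).
  by rewrite /g /trace_ratio (powR_expR _ (_ : 0 < 2))// powR_expR ?expR_gt0// expRK mulrC.
have n4 : 0 < 4 :> R by [].
have l4 : ln (4 : R) = 2 * ln 2.
  have -> : (4 : R) = 2 * 2 by rewrite -natrM.
  by rewrite lnM ?posrE// [RHS]mulr_natl mulr2n.
rewrite gE -expRN -!expRM_natl (powR_expR _ n4) -dyad4 (powR_expR (- theta)) ?dyad_gt0//.
rewrite (powR_expR _ (mulr_gt0 n4 (dyad_gt0 _ d2))) (powR_expR (beta * p)) ?dyad_gt0//.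
have l4d : ln (4 * dyad (2 * delta) (k + i)) = 2 * ln 2 + ln (dyad (2 * delta) (k + i)).
  by rewrite -l4 -[RHS](@lnM _ 4) ?posrE ?dyad_gt0.
rewrite l4d l4 !ln_dyad// -!expRD natrD; congr expR.
by field; rewrite gt_eqF.
Qed.

(** In the normalisation of [dyadic_terms] the growing weights and the decay
    [2 `^ (- beta * p)] of the radii combine to the kernel [g ^+ gap k j]. *)
Lemma weighted_tail_le E delta k : 0 < delta -> (forall t, 0 <= E t)%E ->
  ((dyad (2 * delta) k `^ (- (beta * p)))%:E * weighted_tail E delta k <=
  (4 `^ (alpha * p))%:E * \sum_(0 <= j <oo) (g ^+ gap k j)%:E *
    dyadic_terms alpha p (8 * delta) E j)%E.
Proof.
move=> d0 E0; have d2 : 0 < 2 * delta by posr.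
have /andP[g0 _] := g01.
have b0 j : (0 <= dyadic_terms alpha p (8 * delta) E j)%E by exact: dyadic_terms_ge0.
have t0 j : (0 <= (g ^+ gap k j)%:E * dyadic_terms alpha p (8 * delta) E j)%E.
  by rewrite mule_ge0// lee_fin exprn_ge0// ltW.
rewrite /weighted_tail -nneseriesZl; last first.
  by move=> i _; rewrite !mule_ge0// lee_fin ?powR_ge0// exprn_ge0// invr_ge0 ltW.
apply: nneseries_le => [i|n].
  by rewrite !mule_ge0// lee_fin ?powR_ge0// exprn_ge0// invr_ge0 ltW.
apply: (@le_trans _ _ ((4 `^ (alpha * p))%:E * \sum_(0 <= i < n) (g ^+ gap k (k + i)%N)%:E *
    dyadic_terms alpha p (8 * delta) E (k + i)%N))%E.
  rewrite ge0_sume_distrr; last by move=> i _; exact: t0.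
  apply: lee_sum => i _; rewrite weighted_term// !muleA -!EFinM.
  rewrite lee_wpmul2r// lee_fin le_eqVlt; apply/orP; left; apply/eqP.
  rewrite gap_addr (powRN (dyad (2 * delta) k)).
  have a0 : dyad (2 * delta) k `^ (beta * p) != 0 by rewrite gt_eqF// powR_gt0// dyad_gt0.
  rewrite mulrA mulrCA; congr (_ * _).
  by rewrite mulVf// mulr1.
rewrite lee_wpmul2l ?lee_fin ?powR_ge0//.
apply: le_trans (nneseries_ge_partial (k + n) t0).
rewrite [leRHS](@big_cat_nat _ _ _ k _ (k + n))//= ?leq_addr//.
rewrite -[leLHS]add0e; apply: leeD; first by apply: sume_ge0 => i _.
by rewrite [leRHS](big_addn 0 (k + n) k) addKn; apply: lee_sum => i _; rewrite addnC.
Qed.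

(** The seminorm of the trace: at the scale [k] the oscillation of the trace is a
    geometrically weighted sum of oscillations at the finer scales. *)
Lemma trace_seminorm_le (D Dp K : R) : 0 < D -> 0 < Dp -> 0 < K ->
  exists2 C, 0 < C & forall (delta : R) E Eb, 0 < delta ->
    (forall t, 0 <= E t)%E -> (forall t, 0 <= Eb t)%E ->
    almost_increasing D E -> almost_increasing Dp Eb ->
    (forall t, 2 * delta <= t -> (Eb t <= Eb (2 * delta)%R)%E) ->
    (forall k, Eb (dyad (2 * delta) k) <= K%:E * weighted_tail E delta k)%E ->
    (seminorm_of beta p q Eb <= C%:E * seminorm_of alpha p q E)%E.
Proof.
move=> D0 Dp0 K0.
have [C1 C10 h1] := lqnorm_le_seminorm alpha0 p1 q1 D0.
have [C2 C20 h2] := seminorm_le_lqnorm beta0 p1 q1 Dp0.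
have A0 : 0 < K * 4 `^ (alpha * p) by posr.
have [C3 C30 h3] := lqnorm_convolution p1 q1 g01 A0.
exists (C2 * (C3 * C1)); first by posr.
move=> delta E Eb d0 E0 Eb0 Ei Ebi Ebl Ek.
have d2 : 0 < 2 * delta by posr.
have d8 : 0 < 8 * delta by posr.
apply: le_trans (h2 Eb _ d2 Eb0 Ebi Ebl) _.
rewrite !EFinM -!muleA lee_wpmul2l ?lee_fin ?(ltW C20)//.
apply: le_trans (h3 (dyadic_terms alpha p (8 * delta) E) _ _ _ _) _.
- by move=> k; exact: dyadic_terms_ge0.
- by move=> k; exact: dyadic_terms_ge0.
- move=> k; rewrite {1}/dyadic_terms.
  apply: le_trans (lee_wpmul2l _ (Ek k)) _; first by rewrite lee_fin powR_ge0.
  rewrite muleCA (EFinM K) -muleA lee_wpmul2l ?lee_fin ?(ltW K0)//.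
  exact: weighted_tail_le.
rewrite lee_wpmul2l ?lee_fin ?(ltW C30)//; exact: h1.
Qed.

(** Each dyadic term is at most the [p]-th power of the seminorm, and the kernel
    is summable. *)
Lemma weighted_tail0_le (D : R) : 0 < D ->
  exists2 C, 0 < C & forall (delta : R) E, 0 < delta -> (forall t, 0 <= E t)%E ->
    almost_increasing D E ->
    (weighted_tail E delta 0 <=
     (C * (2 * delta) `^ (beta * p))%:E * seminorm_of alpha p q E `^ p)%E.
Proof.
move=> D0; have [C1 C10 h1] := lqnorm_le_seminorm alpha0 p1 q1 D0.
have /andP[g0 gl1] := g01.
have G0 : 0 < (1 - g)^-1 by rewrite invr_gt0 subr_gt0.
exists (4 `^ (alpha * p) * C1 `^ p * (1 - g)^-1); first by posr.
move=> delta E d0 E0 Ei; have d8 : 0 < 8 * delta by posr.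
set L := (seminorm_of _ _ _ _ `^ p)%E.
have L0 : (0 <= L)%E by exact: poweR_ge0.
have b0 j : (0 <= dyadic_terms alpha p (8 * delta) E j)%E by exact: dyadic_terms_ge0.
have lq0 := lqnorm_ge0 p1 q1 b0.
have sn0 : (0 <= seminorm_of alpha p q E)%E.
  rewrite -(@lee_pmul2l _ C1%:E) ?lte_fin// mule0.
  exact: le_trans lq0 (h1 E _ d8 E0 Ei).
have bL j : (dyadic_terms alpha p (8 * delta) E j <= (C1 `^ p)%:E * L)%E.
  have := lqnorm_ge_term j p1 q1 b0.
  move=> /le_trans /(_ (h1 E _ d8 E0 Ei)) le.
  rewrite -[leLHS](@poweRVK _ p) ?gt_eqF// -poweR_EFin /L -poweRM ?lee_fin ?(ltW C10)//.
  by apply: le_poweR; [exact: ltW|exact: poweR_ge0|].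
pose c := 4 `^ (alpha * p) * (2 * delta) `^ (beta * p) * C1 `^ p.
have c0 : 0 <= c by rewrite !mulr_ge0 ?powR_ge0.
apply: (@le_trans _ _ (\sum_(0 <= i <oo) (c%:E * L) * (g ^+ i)%:E))%E.
  rewrite /weighted_tail; apply: lee_nneseries => [i _ _|i _].
    by rewrite !mule_ge0// lee_fin ?powR_ge0// exprn_ge0// invr_ge0 ltW.
  rewrite weighted_term// add0n dyad0 /c !EFinM.
  rewrite -!muleA lee_wpmul2l ?lee_fin ?powR_ge0// lee_wpmul2l ?lee_fin ?powR_ge0//.
  by rewrite muleC (muleA _ L) lee_wpmul2r// lee_fin exprn_ge0// ltW.
apply: le_trans (nneseriesZl_e _ _) _ => [j||].
- by rewrite lee_fin exprn_ge0// ltW.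
- by rewrite mule_ge0.
apply: (@le_trans _ _ (c%:E * L * ((1 - g)^-1)%:E))%E.
  by rewrite lee_wpmul2l ?mule_ge0// geometric_series_le.
rewrite muleAC -EFinM lee_wpmul2r// lee_fin le_eqVlt; apply/orP; left; apply/eqP.
by rewrite /c; ring.
Qed.

Section ExtensionSeminorm.
Variables (R0 : R).
Hypothesis R00 : 0 < R0.
Let R128 : 0 < 128 * R0. Proof. by posr. Qed.
Let dyad128 j : 128 * dyad R0 j = dyad (128 * R0) j.
Proof. by rewrite /dyad mulrA. Qed.

Let g1 : R := 2 `^ (- ((1 - alpha) * p)).
Let g101 : 0 < g1 < 1.
Proof.
rewrite /g1 powR_expR// expR_gt0 expR_lt1 mulNr oppr_lt0 !mulr_gt0//.
by rewrite subr_gt0.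
Qed.

Let ext_term E i j : (j <= i)%N ->
  ((dyad R0 i `^ (- (alpha * p)))%:E *
    (((dyad R0 i / dyad R0 j) `^ p * dyad R0 j `^ theta)%:E * E (128 * dyad R0 j)%R) =
  (128 `^ (beta * p))%:E * ((g1 ^+ gap i j)%:E * dyadic_terms beta p (128 * R0) E j))%E.
Proof.
move=> ji; rewrite dyad128 (dyadic_value E beta j R128) !muleA -!EFinM.
congr (_%:E * _)%E; rewrite -dyad128; congr (_ * _).
have n128 : 0 < 128 :> R by [].
have s0 k : 0 < dyad R0 k by exact: dyad_gt0.
have n2 : 0 < 2 :> R by [].
rewrite (powRM (beta * p) (ltW n128) (ltW (s0 j))) mulrCA; congr (_ * _).
rewrite (powR_expR _ (s0 i)) (powR_expR _ (divr_gt0 (s0 i) (s0 j))).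
rewrite (powR_expR theta (s0 j)) (powR_expR (beta * p) (s0 j)).
have ld : ln (dyad R0 i / dyad R0 j) = ln (dyad R0 i) - ln (dyad R0 j).
  by apply: ln_div; rewrite posrE.
rewrite ld !ln_dyad// gap_ge//.
rewrite /g1 (powR_expR _ n2) -expRM_natl natrB// -!expRD; congr expR.
by field; rewrite gt_eqF.
Qed.

(** The Lipschitz factor [(s_ i / s_ j) `^ p] beats the weight
    [(s_ i / s_ j) `^ (alpha * p)] exactly because [alpha < 1]; this leaves the
    kernel [g1 ^+ gap i j]. *)
Lemma extension_seminorm_le (D Dp M : R) : 0 < D -> 0 < Dp -> 0 < M ->
  exists2 C, 0 < C & forall EF Ef,
    (forall t, 0 <= EF t)%E -> (forall t, 0 <= Ef t)%E ->
    almost_increasing D EF -> almost_increasing Dp Ef ->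
    (forall t, R0 <= t -> (EF t <= EF R0)%E) ->
    (forall i, EF (dyad R0 i) <= \sum_(0 <= j < i.+1)
      (M * ((dyad R0 i / dyad R0 j) `^ p * dyad R0 j `^ theta))%:E *
      Ef (128 * dyad R0 j)%R)%E ->
    (seminorm_of alpha p q EF <= C%:E * seminorm_of beta p q Ef)%E.
Proof.
move=> D0 Dp0 M0.
have [C1 C10 h1] := lqnorm_le_seminorm beta0 p1 q1 Dp0.
have [C2 C20 h2] := seminorm_le_lqnorm alpha0 p1 q1 D0.
have A0 : 0 < M * 128 `^ (beta * p) by posr.
have [C3 C30 h3] := lqnorm_convolution p1 q1 g101 A0.
exists (C2 * (C3 * C1)); first by posr.
move=> EF Ef EF0 Ef0 EFi Efi EFl Ei.
apply: le_trans (h2 EF _ R00 EF0 EFi EFl) _.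
rewrite !EFinM -!muleA lee_wpmul2l ?lee_fin ?(ltW C20)//.
have b0 j : (0 <= dyadic_terms beta p (128 * R0) Ef j)%E by exact: dyadic_terms_ge0.
apply: le_trans (h3 (dyadic_terms beta p (128 * R0) Ef) _ _ _ _) _ => //.
- by move=> k; exact: dyadic_terms_ge0.
- move=> i; rewrite {1}/dyadic_terms.
  apply: le_trans (lee_wpmul2l _ (Ei i)) _; first by rewrite lee_fin powR_ge0.
  have /andP[gg _] := g101.
  have t0 j : (0 <= (g1 ^+ gap i j)%:E * dyadic_terms beta p (128 * R0) Ef j)%E.
    by rewrite mule_ge0// lee_fin exprn_ge0// ltW.
  apply: (@le_trans _ _ ((M * 128 `^ (beta * p))%:E * \sum_(0 <= j < i.+1)
      (g1 ^+ gap i j)%:E * dyadic_terms beta p (128 * R0) Ef j))%E; last first.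
    by rewrite lee_wpmul2l ?lee_fin ?(ltW A0)// nneseries_ge_partial.
  rewrite ge0_sume_distrr => [|j _]; last first.
    by rewrite mule_ge0// lee_fin mulr_ge0 ?mulr_ge0 ?powR_ge0// ltW.
  rewrite ge0_sume_distrr => [|j _]; last exact: t0.
  rewrite big_nat_cond [leRHS]big_nat_cond.
  apply: lee_sum => j /andP[/andP[_ ji] _].
  by rewrite (EFinM M) -muleA muleCA ext_term// (EFinM M) -muleA.
rewrite lee_wpmul2l ?lee_fin ?(ltW C30)//; exact: h1.
Qed.

(** A finite seminorm of positive order [beta] makes the oscillations decay
    geometrically. *)
Lemma osc_summable (Dp : R) E : 0 < Dp -> (forall t, 0 <= E t)%E ->
  almost_increasing Dp E -> (seminorm_of beta p q E < +oo)%E ->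
  (\sum_(0 <= i <oo) E (128 * dyad R0 i)%R < +oo)%E.
Proof.
move=> Dp0 E0 Ei sf.
have [C1 C10 h1] := lqnorm_le_seminorm beta0 p1 q1 Dp0.
have b0 j : (0 <= dyadic_terms beta p (128 * R0) E j)%E by exact: dyadic_terms_ge0.
set L := lqnorm p q (dyadic_terms beta p (128 * R0) E).
have L0 : (0 <= L)%E by exact: lqnorm_ge0.
have Lf : (L < +oo)%E.
  apply: le_lt_trans (h1 E _ R128 E0 Ei) _.
  by rewrite lte_mul_pinfty ?lee_fin ?(ltW C10).
have bL j : (dyadic_terms beta p (128 * R0) E j <= L `^ p)%E.
  rewrite -[leLHS](@poweRVK _ p) ?gt_eqF//.
  apply: le_poweR; [exact: ltW|exact: poweR_ge0|exact: lqnorm_ge_term].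
pose gb : R := 2 `^ (- (beta * p)).
have gb01 : 0 < gb < 1.
  by rewrite /gb powR_expR// expR_gt0 expR_lt1 mulNr oppr_lt0 !mulr_gt0.
have /andP[gb0 gb1] := gb01.
pose c := ((128 * R0) `^ (beta * p))%:E.
have c0 : (0 <= c)%E by rewrite lee_fin powR_ge0.
apply: (@le_lt_trans _ _ (\sum_(0 <= i <oo) (c * L `^ p) * (gb ^+ i)%:E))%E.
  apply: lee_nneseries => [i _ _|i _]; first exact: E0.
  rewrite dyad128 (dyadic_value E beta i R128) muleAC; apply: lee_pmul => //.
  - by rewrite lee_fin powR_ge0.
  rewrite /c -EFinM lee_fin le_eqVlt; apply/orP; left; apply/eqP.
  rewrite /gb !powR_expR ?dyad_gt0// ln_dyad// -expRM_natl -expRD; congr expR.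
  by ring.
apply: le_lt_trans (nneseriesZl_e _ _) _ => [j||].
- by rewrite lee_fin exprn_ge0// ltW.
- by rewrite mule_ge0// poweR_ge0.
apply: (@le_lt_trans _ _ (c * L `^ p * ((1 - gb)^-1)%:E))%E.
  by rewrite lee_wpmul2l ?mule_ge0 ?poweR_ge0// geometric_series_le.
have Lpf : (L `^ p < +oo)%E by rewrite poweR_lty.
have Lpn : (L `^ p)%E \is a fin_num by rewrite ge0_fin_numE ?poweR_ge0.
by rewrite -(fineK Lpn) /c -!EFinM ltry.
Qed.

End ExtensionSeminorm.
End SeminormComparison.

(** * Geometry of a bounded domain with a regular boundary *)

(** Infinitely many separated balls of comparable measure do not fit into a space
    of finite measure, so that at every scale there is a finite net. *)
Lemma separable_of_doubling (R : realType) (W : completeMetricType R)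
    (nu : {measure set (borel W) -> \bar R}) (D R0 : R) :
  finite_total nu -> 1 <= D -> doubling_on nu setT D -> 0 < R0 ->
  (forall x y : W, mdist x y < R0) -> separable_metric W.
Proof.
move=> fnu D1 dnu R00 bnd.
have net (e : R) : 0 < e -> exists s : seq W, forall x, exists2 y, y \in s & mdist y x < e.
  move=> e0; apply: contrapT => /forallNP no.
  have /choice[next nextP] : forall s : seq W, exists x, forall y, y \in s -> e <= mdist y x.
    move=> s; have /existsNP[x nx] := no s; exists x => y ys.
    by rewrite leNgt; apply/negP => yx; apply: nx; exists y.
  pose L := fix L n := if n is n'.+1 then next (L n') :: L n' else [::].
  pose x n := next (L n).
  have xL i j : (i < j)%N -> x i \in L j.
    elim: j => // j IH; rewrite ltnS leq_eqVlt => /predU1P[->|/IH ij].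
      by rewrite /= mem_head.
    by rewrite /= in_cons ij orbT.
  have sepx i j : (i < j)%N -> e <= mdist (x i) (x j) by move=> /xL; exact: nextP.
  pose F n : set (borel W) := ball (x n) (e / 2).
  have e20 : 0 < e / 2 by posr.
  have disj i j : (i < j)%N -> F i `&` F j !=set0 -> False.
    move=> ij [y []]; rewrite /F/= !in_ball => iy jy; have := sepx i j ij.
    by have := metric_triangle (x i) y (x j); rewrite (metric_sym y); move: iy jy; lra.
  have tF : trivIset setT F.
    move=> i j _ _ Fij; have [ij|ij|//] := ltngtP i j; first by case: (disj _ _ ij Fij).
    by case: (disj _ _ ij); rewrite setIC.
  have [m Dm] := exp2_unbounded (R0 / (e / 2)).
  have mF n : measurable (F n) by exact: measurable_ball_metric.
  pose c := vol nu (x 0%N) R0 / D ^+ m.+1.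
  have D0 : 0 < D by exact: lt_le_trans D1.
  have v0 : 0 < vol nu (x 0%N) R0 by have [] := dnu (x 0%N) R0 I R00.
  have c0 : 0 < c by rewrite divr_gt0// exprn_gt0.
  have cF n : c <= vol nu (x n) (e / 2).
    rewrite ler_pdivrMr ?exprn_gt0// mulrC.
    apply: (vol_compare fnu D1 dnu I e20).
    have := bnd (x n) (x 0%N); rewrite exprS; move: Dm; rewrite ltr_pdivrMr//; lra.
  have UF : (nu (\bigcup_n F n) <= nu setT)%E.
    by apply: le_measure; rewrite ?inE//; exact: bigcup_measurable.
  rewrite measure_bigcup// in UF.
  have part n : (n%:R * c <= vol nu (x 0%N) R0).
    rewrite -lee_fin -volE//; have -> : ball (x 0%N) R0 = setT.
      by rewrite -subTset => y _; rewrite in_ball.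
    apply: le_trans UF; rewrite (eq_eseriesl (Q := xpredT)); last by move=> k; rewrite in_setT.
    apply: le_trans (nneseries_ge_partial n (fun i => measure_ge0 nu (F i))).
    apply: (@le_trans _ _ (\sum_(0 <= i < n) c%:E)%E).
      by rewrite sumEFin big_const_nat subn0 iter_addr addr0 mulr_natl.
    by apply: lee_sum => i _; rewrite [leRHS](volE _ _ fnu) lee_fin.
  have [n nv] : exists n : nat, vol nu (x 0%N) R0 / c < n%:R.
    by have [k] := exp2_unbounded (vol nu (x 0%N) R0 / c); exists (2 ^ k)%N; rewrite natrX.
  by have := part n; rewrite leNgt -ltr_pdivrMr// nv.
have /choice[s sP] : forall n, exists s : seq W, forall x, exists2 y, y \in s & mdist y x < 2 ^- n.
  by move=> n; apply: net; rewrite invr_gt0 exprn_gt0.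
exists (fun k => if unpickle k is Some (n, i) then nth point (s n) i else point).
move=> x r r0; have [n nr] := exp2_unbounded r^-1.
have nr' : 2 ^- n < r by rewrite -[ltRHS]invrK ltf_pV2 ?posrE ?invr_gt0 ?exprn_gt0.
have [y ys yx] := sP n x.
exists (pickle (n, index y (s n))); rewrite pickleK in_ball nth_index//.
exact: lt_trans nr'.
Qed.

(** The hypotheses on a bounded domain that the trace and the extension share,
    independent of the exponents. *)
Record regular_domain (R : realType) (W : completeMetricType R) (Z : set W)
  (nu pi : {measure set (borel W) -> \bar R}) (theta Cnu Ctheta : R) : Prop :=
RegularDomain {
  domain_theta : 0 < theta;
  domain_Cnu : 1 <= Cnu;
  domain_Ctheta : 1 <= Ctheta;
  domain_dense : closure Z = setT;
  domain_locally_compact : locally_compact_in Z;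
  domain_bounded : metric_bounded Z;
  domain_nu0 : nu (boundary Z) = 0%E;
  domain_doubling : doubling nu Z Cnu;
  domain_pi0 : pi Z = 0%E;
  domain_codim : codim_regular nu pi Z theta Ctheta;
  domain_diam : 0 < diam (boundary Z)
}.

Section Setting.
Context {R : realType} {W : completeMetricType R}.
Variables (Z : set W) (nu pi : {measure set (borel W) -> \bar R}).
Variables (theta Cnu Ctheta : R).
Hypothesis dom : regular_domain Z nu pi theta Cnu Ctheta.
Let theta0 := domain_theta dom.
Let Cnu1 := domain_Cnu dom.
Let Ct1 := domain_Ctheta dom.
Let dense := domain_dense dom.
Let lc := domain_locally_compact dom.
Let bd := domain_bounded dom.
Let nuS := domain_nu0 dom.
Let dbl := domain_doubling dom.
Let piZ := domain_pi0 dom.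
Let cod := domain_codim dom.
Let diam0 := domain_diam dom.
Local Notation S := (boundary Z).
Local Notation delta := (diam (boundary Z)).

Let Cnu0 : 0 < Cnu. Proof. exact: lt_le_trans Cnu1. Qed.
Let Ct0 : 0 < Ctheta. Proof. exact: lt_le_trans Ct1. Qed.

(** A compact neighbourhood of [x] in [Z] is closed in the completion, and near
    [x] it contains every point of [Z]; since [Z] is dense, it contains a ball of
    the completion. *)
Lemma domain_open : open Z.
Proof.
rewrite openE => x Zx; have [K [KZ cK] xK] := lc Zx.
have /nbhs_ballP[e /= e0 xe] : nbhs x [set y | Z y -> K y] := xK.
apply/nbhs_ballP; exists e => // y xy; apply: KZ.
have clK : closed K by apply: compact_closed => //; exact: metric_hausdorff.
apply: clK => B nB; have : closure Z y by rewrite dense.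
have nbe : nbhs y (ball x e) by apply: open_nbhs_nbhs; split => //; exact: ball_open_metric.
move=> /(_ _ (filterI nB nbe))[w [Zw [Bw xw]]]; exists w; split => //.
exact: xe.
Qed.

Lemma boundary_closed : closed S.
Proof. exact: open_closedC domain_open. Qed.

Lemma boundary_nonempty : S !=set0.
Proof.
apply/set0P/eqP => S0; move: diam0; rewrite /diam S0.
rewrite (_ : [set mdist x y | x in set0 & y in set0] = set0) ?sup0 ?ltxx//.
by rewrite -subset0 => _ [x []].
Qed.

Lemma domain_measurable : measurable (Z : set (borel W)).
Proof. by apply: open_borel; exact: domain_open. Qed.

Lemma boundary_measurable : measurable (S : set (borel W)).
Proof. exact: measurableC domain_measurable. Qed.

Lemma domain_approx x (e : R) : 0 < e -> exists2 z, Z z & mdist x z < e.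
Proof.
move=> e0; have : closure Z x by rewrite dense.
move=> /(_ (ball x e))[|z [Zz xz]]; first exact: nbhsx_ballx.
by exists z => //; rewrite in_ball in xz.
Qed.

Lemma mdist_bounded : exists2 R0 : R, 0 < R0 & forall x y : W, mdist x y < R0.
Proof.
have [M MZ] := bd; exists (`|M| + 3) => [|x y]; first by rewrite ltr_wpDl.
have [x' Zx xx] := domain_approx x ltr01; have [y' Zy yy] := domain_approx y ltr01.
have := metric_triangle x x' y; have := metric_triangle x' y' y.
rewrite (metric_sym y' y); have := MZ _ _ Zx Zy; have := ler_norm M.
by move: xx yy; lra.
Qed.

Lemma mdist_le_diam x y : S x -> S y -> mdist x y <= delta.
Proof.
move=> Sx Sy; apply: ub_le_sup; last by exists x => //; exists y.
have [R0 _ h] := mdist_bounded; exists R0 => _ [a _ [b _ <-]].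
by rewrite ltW.
Qed.

Lemma nu_ball_domain x r : nu (ball x r `&` Z) = nu (ball x r).
Proof.
apply: measure_setI_null; [exact: domain_measurable|exact: nuS|exact: measurable_ball_metric].
Qed.

Lemma pi_boundary0 : pi (~` S) = 0%E.
Proof. by rewrite /boundary setCK. Qed.

Lemma pi_ball_boundary x r : pi (ball x r `&` S) = pi (ball x r).
Proof.
apply: measure_setI_null; [exact: boundary_measurable|exact: pi_boundary0|].
exact: measurable_ball_metric.
Qed.

Lemma finite_nu : finite_total nu.
Proof.
have [R0 R00 bnd] := mdist_bounded.
have [z Sz] := boundary_nonempty; have [x Zx _] := domain_approx z ltr01.
have bT : ball x R0 = setT by rewrite -subTset => y _; rewrite in_ball.
have [_ _] := dbl Zx R00; rewrite nu_ball_domain bT; apply: le_lt_trans.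
by rewrite -[leLHS]mul1e lee_wpmul2r// lee_fin.
Qed.

Lemma codim_real z r : S z -> 0 < r -> r <= 2 * delta ->
  pi (ball z r) = (vol pi z r)%:E /\
  (vol nu z r <= Ctheta * (vol pi z r * r `^ theta) /\
   vol pi z r * r `^ theta <= Ctheta * vol nu z r).
Proof.
move=> Sz r0 rd; have [] := cod Sz r0 rd.
have rt0 : 0 < r `^ theta by exact: powR_gt0.
rewrite nu_ball_domain pi_ball_boundary (volE _ _ finite_nu) dive_pos// -!EFinM => lo up.
have pf : pi (ball z r) \is a fin_num.
  by rewrite ge0_fin_numE//; apply: le_lt_trans up _; rewrite ltry.
have pE : pi (ball z r) = (vol pi z r)%:E by rewrite fineK.
split => //; move: lo up; rewrite pE !lee_fin => lo up; split.
  by move: lo; rewrite ler_pdivrMl// ler_pdivrMl// => /le_trans; apply;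
    rewrite mulrC -mulrA.
by move: up; rewrite mulrCA ler_pdivlMl// mulrC.
Qed.

Let delta20 : 0 < 2 * delta. Proof. by posr. Qed.

Lemma boundary_sub_ball z r : S z -> delta < r -> S `<=` ball z r.
Proof.
by move=> Sz rd y Sy; rewrite in_ball; apply: le_lt_trans rd; exact: mdist_le_diam.
Qed.

Lemma pi_large_ball z r : S z -> delta < r -> pi (ball z r) = pi S.
Proof.
by move=> Sz rd; rewrite -pi_ball_boundary setIidr//; exact: boundary_sub_ball.
Qed.

Lemma finite_pi : finite_total pi.
Proof.
have [z Sz] := boundary_nonempty; have d2 : delta < 2 * delta by move: diam0; lra.
have [pE _] := codim_real Sz delta20 (lexx _).
have -> : finite_total pi = (pi (ball z (2 * delta)) < +oo)%E.
  rewrite pi_large_ball// /finite_total -(measure_setI_null _ pi_boundary0)//; last first.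
    exact: boundary_measurable.
  by rewrite setTI.
by rewrite pE ltry.
Qed.

Lemma vol_large_ball z r s : S z -> delta < r -> delta < s -> vol pi z r = vol pi z s.
Proof. by move=> Sz rd sd; rewrite /vol !pi_large_ball. Qed.

Definition nu_doubling_const : R := Cnu ^+ 3.
Local Notation D := nu_doubling_const.

Lemma nu_doubling_const_ge1 : 1 <= D.
Proof. exact: exprn_ege1. Qed.

(** The doubling property extends from the domain to its completion, since every
    point is a limit of points of the domain. *)
Lemma nu_doubling : doubling_on nu setT D.
Proof.
move=> x r _ r0; have r40 : 0 < r / 4 by posr.
have [z Zz xz] := domain_approx x r40.
have pos s : 0 < s -> 0 < vol nu z s /\ vol nu z (2 * s) <= Cnu * vol nu z s.
  move=> s0; have s20 : 0 < s / 2 by posr.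
  have [h1 _ _] := dbl Zz s20; have [_ h2 _] := dbl Zz s0.
  move: h1 h2; rewrite !nu_ball_domain !(volE _ _ finite_nu) -EFinM !lte_fin lee_fin.
  by rewrite mulrCA mulfV// mulr1.
have r20 : 0 < r / 2 by posr.
have sub : vol nu z (r / 2) <= vol nu x r.
  by apply: le_vol; [exact: finite_nu|move: xz; lra].
split; first exact: lt_le_trans (pos _ r20).1 sub.
have d1 := (pos _ r20).2; have d2 := (pos _ r0).2; have r2 : 0 < 2 * r by posr.
have d3 := (pos _ r2).2.
have e1 : 2 * (r / 2) = r by field.
rewrite e1 in d1.
have up : vol nu x (2 * r) <= vol nu z (2 * (2 * r)).
  by apply: le_vol; [exact: finite_nu|rewrite metric_sym; move: xz; lra].
apply: (le_trans up); apply: (le_trans d3).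
rewrite /D exprS -mulrA ler_wpM2l ?(ltW Cnu0)//; apply: (le_trans d2).
rewrite exprS -mulrA ler_wpM2l ?(ltW Cnu0)//; apply: (le_trans d1).
by rewrite expr1 ler_wpM2l ?(ltW Cnu0).
Qed.

Let D0 : 0 < D. Proof. by apply: lt_le_trans nu_doubling_const_ge1. Qed.

Lemma domain_separable : separable_metric W.
Proof.
have [R0 R00 bnd] := mdist_bounded.
exact: (separable_of_doubling finite_nu nu_doubling_const_ge1 nu_doubling R00 bnd).
Qed.

Definition codim_const : R := Ctheta * 2 `^ theta.

Lemma codim_const_gt0 : 0 < codim_const.
Proof. by rewrite /codim_const; posr. Qed.

Let vol_pi_le z r : S z -> 0 < r -> vol pi z r * (Num.min r (2 * delta)) `^ theta <=
  Ctheta * vol nu z (Num.min r (2 * delta)).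
Proof.
move=> Sz r0; rewrite minEle; case: ifPn => [rd|/negP rd].
  by have [_ []] := codim_real Sz r0 rd.
have d2 : delta < 2 * delta by move: diam0; lra.
have dr : delta < r by apply: lt_trans d2 _; rewrite ltNge; exact/negP.
rewrite (vol_large_ball Sz dr d2).
by have [_ []] := codim_real Sz delta20 (lexx _).
Qed.

(** Beyond the diameter the ball does not grow any more, at the price of a factor
    that depends on the ratio of the radius and the diameter. *)
Lemma codim_upper z r b : 1 <= b -> S z -> 0 < r -> r <= b * (2 * delta) ->
  vol pi z r * r `^ theta <= Ctheta * b `^ theta * vol nu z r.
Proof.
move=> b1 Sz r0 rb; have b0 : 0 < b by exact: lt_le_trans b1.
have := vol_pi_le Sz r0; set m := Num.min _ _ => le.
have m0 : 0 < m by rewrite /m lt_min r0.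
have mr : m <= r by rewrite /m ge_min lexx.
have rm : r <= b * m.
  by rewrite /m minEle; case: ifPn => // _; rewrite ler_peMl// ltW.
apply: (@le_trans _ _ (vol pi z r * (b * m) `^ theta)).
  rewrite ler_wpM2l ?vol_ge0//; apply: le_powR => //; exact: ltW.
rewrite powRM ?(ltW b0) ?(ltW m0)// mulrCA mulrAC [leRHS]mulrC ler_wpM2l ?powR_ge0//.
apply: (le_trans le); rewrite ler_wpM2l ?(ltW Ct0)//; apply: le_vol; first exact: finite_nu.
by rewrite mdistxx add0r.
Qed.

(** Iterated doubling of [nu] replaces the large ball by one of radius twice the
    diameter of the boundary. *)
Lemma codim_lower z r n : S z -> 0 < r -> r <= 2 ^+ n * (2 * delta) ->
  vol nu z r <= Ctheta * D ^+ n * (vol pi z r * r `^ theta).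
Proof.
move=> Sz r0 rb; have [rd|rd] := leP r (2 * delta).
  have [_ [lo _]] := codim_real Sz r0 rd; apply: (le_trans lo).
  rewrite -[leRHS]mulrA ler_wpM2l ?(ltW Ct0)//.
  by rewrite ler_peMl ?mulr_ge0 ?vol_ge0 ?powR_ge0// exprn_ege1// nu_doubling_const_ge1.
have d2 : delta < 2 * delta by move: diam0; lra.
have [_ [lo _]] := codim_real Sz delta20 (lexx _).
apply: (@le_trans _ _ (D ^+ n * vol nu z (2 * delta))).
  apply: (vol_compare finite_nu nu_doubling_const_ge1 nu_doubling I delta20).
  by rewrite mdistxx add0r.
rewrite (mulrC Ctheta) -mulrA (ler_wpM2l (exprn_ge0 n (ltW D0)))//.
apply: (le_trans lo); rewrite ler_wpM2l ?(ltW Ct0)//.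
rewrite (vol_large_ball Sz (lt_trans d2 rd) d2) ler_wpM2l ?vol_ge0//.
by apply: le_powR; exact: ltW.
Qed.

Definition pi_doubling_const : R := Ctheta ^+ 2 * D.
Local Notation Dp := pi_doubling_const.

Lemma pi_doubling_const_ge1 : 1 <= Dp.
Proof. by rewrite /Dp mulr_ege1 ?exprn_ege1 ?nu_doubling_const_ge1. Qed.

(** Up to the diameter of the boundary, the regularity of [pi] reduces this to the
    doubling of [nu]; beyond it, every ball contains the whole boundary. *)
Lemma pi_doubling : doubling_on pi S Dp.
Proof.
move=> z t Sz t0; have d2 : delta < 2 * delta by move: diam0; lra.
have pos r : 0 < r -> r <= 2 * delta -> 0 < vol pi z r.
  move=> r0 rd; rewrite lt_neqAle vol_ge0 andbT eq_sym; apply/eqP => v0.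
  have [_ [lo _]] := codim_real Sz r0 rd; move: lo; rewrite v0 mul0r mulr0 leNgt.
  by rewrite (nu_doubling (x := z) I r0).1.
have Dp1 := pi_doubling_const_ge1.
have [td|td] := leP t delta; last first.
  have t2 : delta < 2 * t by move: td t0; lra.
  rewrite (vol_large_ball Sz td d2) (vol_large_ball Sz t2 d2).
  have p0 := pos _ delta20 (lexx _); split => //.
  by rewrite ler_peMl// ltW.
have t20 : 0 < 2 * t by posr.
have t2d : 2 * t <= 2 * delta by move: td; lra.
have td2 : t <= 2 * delta by move: td t0; lra.
split; first exact: pos.
have [_ [_ up]] := codim_real Sz t20 t2d; have [_ [lo _]] := codim_real Sz t0 td2.
have tt0 : 0 < t `^ theta by exact: powR_gt0.
rewrite -(ler_pM2r tt0).
apply: (@le_trans _ _ (vol pi z (2 * t) * (2 * t) `^ theta)).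
  by rewrite ler_wpM2l ?vol_ge0//; apply: le_powR; [exact: ltW|exact: ltW|move: t0; lra].
apply: (le_trans up); rewrite (_ : Dp * _ * _ = Ctheta * (D * (Ctheta * (vol pi z t * t `^ theta)))); last by rewrite /Dp; ring.
rewrite ler_wpM2l ?(ltW Ct0)//.
have [_ d] := nu_doubling (x := z) I t0; apply: (le_trans d).
by rewrite ler_wpM2l ?(ltW D0).
Qed.

End Setting.

(** * Besov spaces on subsets of full measure *)

Lemma seminorm_of_ge0 (R : realType) (alpha p : R) (q : \bar R) (E : R -> \bar R) :
  (1 <= q)%E -> (forall t, 0 <= E t)%E -> (0 <= seminorm_of alpha p q E)%E.
Proof.
case: q => [r||//] q1 E0; first exact: poweR_ge0.
rewrite /seminorm_of.
apply: (@le_trans _ _ (((1 `^ alpha)^-1)%:E * E 1%R `^ p^-1)%E).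
  by rewrite mule_ge0 ?poweR_ge0// lee_fin invr_ge0 powR_ge0.
by apply: ereal_sup_ubound; exists 1 => //; rewrite /= in_itv/= ltr01.
Qed.

Lemma poweR_lty_inv (R : realType) (x : \bar R) (r : R) : 0 < r -> (0 <= x)%E ->
  (x `^ r < +oo)%E -> (x < +oo)%E.
Proof.
move=> r0 x0 xr; rewrite ltey; apply/eqP => xE; move: xr.
by rewrite xE poweRyr ?gt_eqF.
Qed.

Section Relative.
Context {R : realType} {W : completeMetricType R}.
Variables (mu : {measure set (borel W) -> \bar R}) (X : set W) (p : R).
Hypothesis sep : separable_metric W.
Hypotheses (fmu : finite_total mu) (mX : measurable (X : set (borel W))).
Hypotheses (muX : mu (~` X) = 0%E) (p1 : 1 <= p).
Hypothesis vol0 : forall x t, X x -> 0 < t -> 0 < vol mu x t.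
Local Open Scope ereal_scope.

Let p0 : (0 < p)%R. Proof. exact: lt_le_trans p1. Qed.

(** Extension by zero makes a function that is measurable on [X] measurable on the
    whole space; no integral changes, since the measure vanishes off [X]. *)
Definition extend (f : W -> R) : borel W -> R := (f : borel W -> R) \_ X.

Lemma extend_in f x : X x -> extend f x = f x.
Proof. by move=> Xx; rewrite /extend patchE mem_set. Qed.

Lemma measurable_extend f : measurable_fun (X : set (borel W)) (f : borel W -> R) ->
  measurable_fun setT (extend f).
Proof. by move=> mf; apply/(measurable_restrictT _ _).1. Qed.

(** The positivity of the volumes matters for the division of extended reals,
    which is not the real division at zero; for nonpositive radii both sides
    are integrals over the empty set. *)
Lemma ball_avgE (g : W -> \bar R) (G : borel W -> \bar R) x t :
  (forall s, 0 < s -> 0 < vol mu x s)%R ->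
  measurable_fun setT G -> (forall y, 0 <= G y) -> (forall y, X y -> g y = G y) ->
  ball_avg mu X g x t = wavg mu mu t G x.
Proof.
move=> volx mG G0 gG; have mB := measurable_ball_metric x t.
rewrite /ball_avg /wavg; have -> : \int[mu]_(y in ball x t `&` X) g y = \int[mu]_(y in ball x t) G y.
  rewrite -(integral_null_compl mX muX mB (measurable_funTS mG))//.
  by apply: eq_integral => y /set_mem[_ Xy]; exact: gG.
rewrite measure_setI_null// (volE _ _ fmu); have [t0|t0] := ltP 0%R t.
  by rewrite inver gt_eqF// volx.
suff -> : ball x t = set0 :> set W by rewrite integral_set0 !mule0.
rewrite -subset0 => y; rewrite in_ball => xy.
by have := lt_le_trans xy t0; rewrite ltNge mdist_ge0.
Qed.

Lemma besov_oscE f t : measurable_fun (X : set (borel W)) (f : borel W -> R) ->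
  besov_osc mu X p f t = osc mu p (extend f) t.
Proof.
move=> mf; have mF := measurable_extend mf.
rewrite /osc -(integral_null_compl mX muX measurableT (measurable_osc_at sep p t fmu mF)); last first.
  by move=> x _; exact: osc_at_ge0.
rewrite setTI; apply: eq_integral => x /set_mem Xx.
apply: ball_avgE => //.
- by move=> s; exact: vol0.
- exact: measurable_powR_dist.
- by move=> y Xy; rewrite !extend_in.
Qed.

Lemma besov_seminormE alpha q f : measurable_fun (X : set (borel W)) (f : borel W -> R) ->
  besov_seminorm mu X alpha p q f = seminorm_of alpha p q (osc mu p (extend f)).
Proof.
move=> mf; have <- : besov_osc mu X p f = osc mu p (extend f).
  by apply/funext => t; exact: besov_oscE.
by [].
Qed.

Lemma Lp_normE f : Lp_norm mu X p f = (\int[mu]_x (`|extend f x| `^ p)%:E) `^ p^-1.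
Proof. by rewrite /Lp_norm unlock. Qed.

Lemma int_powR_ge0 f : 0 <= \int[mu]_x (`|extend f x| `^ p)%:E.
Proof. by apply: integral_ge0 => x _; rewrite lee_fin powR_ge0. Qed.

Lemma Lp_norm_powR f : \int[mu]_x (`|extend f x| `^ p)%:E = Lp_norm mu X p f `^ p.
Proof. by rewrite Lp_normE poweRVK ?gt_eqF// int_powR_ge0. Qed.

Lemma Lp_norm_ge0 f : 0 <= Lp_norm mu X p f.
Proof. by rewrite Lp_normE poweR_ge0. Qed.

(** In a space of finite measure the [L^p] norm already gives local
    integrability. *)
Lemma besov_spaceP alpha q f :
  besov_space mu X alpha p q f <->
  [/\ measurable_fun setT (extend f),
      seminorm_of alpha p q (osc mu p (extend f)) < +oo &
      \int[mu]_x (`|extend f x| `^ p)%:E < +oo].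
Proof.
split=> [[[mf _] sf lf]|[mF sf lf]].
  split; [exact: measurable_extend|by rewrite -besov_seminormE|].
  rewrite Lp_normE in lf; apply: poweR_lty_inv lf; last exact: int_powR_ge0.
  by rewrite invr_gt0.
have mf : measurable_fun (X : set (borel W)) (f : borel W -> R).
  by apply/(measurable_restrictT _ _).2.
split; [split=> // x Xx|by rewrite besov_seminormE|by rewrite Lp_normE poweR_lty].
exists 1%R => //.
have mB : measurable (ball x 1 `&` X : set (borel W)).
  by apply: measurableI => //; exact: measurable_ball_metric.
have := integrable_powR_finite fmu p1 mB mF lf.
by apply: eq_integrable => // y /set_mem[_ Xy]; rewrite /= extend_in.
Qed.

End Relative.

(** * The trace operator on a domain *)

Section TraceOperator.
Context {R : realType} {W : completeMetricType R}.
Variables (Z : set W) (nu pi : {measure set (borel W) -> \bar R}).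
Variables (theta Cnu Ctheta alpha p : R) (q : \bar R).
Hypothesis dom : regular_domain Z nu pi theta Cnu Ctheta.
Hypotheses (p1 : 1 <= p) (q1 : (1 <= q)%E).
Hypothesis alpha_gt : theta / p < alpha.
Local Notation S := (boundary Z).
Local Notation delta := (diam (boundary Z)).
Local Notation beta := (alpha - theta / p).
Local Notation h := (trace_ratio alpha theta p).
Local Notation D := (nu_doubling_const Cnu).
Local Notation Dp := (pi_doubling_const Cnu Ctheta).
Local Notation A := (codim_const theta Ctheta).
Local Notation extZ := (extend Z).
Local Open Scope ereal_scope.

Let p0 : (0 < p)%R. Proof. exact: lt_le_trans p1. Qed.
Let theta0 := domain_theta dom.
Let delta0 := domain_diam dom.
Let sep := domain_separable dom.
Let fnu := finite_nu dom.
Let fpi := finite_pi dom.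
Let mZ := domain_measurable dom.
Let mS := boundary_measurable dom.
Let nuS : nu (~` Z) = 0 := domain_nu0 dom.
Let piS := pi_boundary0 dom.
Let D1 := nu_doubling_const_ge1 dom.
Let dnu := nu_doubling dom.
Let Dp1 := pi_doubling_const_ge1 dom.
Let dpi := pi_doubling dom.
Let A0 := codim_const_gt0 dom.
Let h01 := trace_ratio01 alpha_gt.

Let upper z r : S z -> (0 < r)%R -> (r <= 4 * delta)%R ->
  (vol pi z r * r `^ theta <= A * vol nu z r)%R.
Proof.
move=> Sz r0 rd; apply: (codim_upper dom) => //; first by rewrite ler1n.
by rewrite mulrA -natrM.
Qed.

Let volZ x t : Z x -> (0 < t)%R -> (0 < vol nu x t)%R.
Proof. by move=> _ t0; have [] := dnu (x := x) I t0. Qed.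

Let volS x t : S x -> (0 < t)%R -> (0 < vol pi x t)%R.
Proof. by move=> Sx t0; have [] := dpi Sx t0. Qed.

Let spaceZ := besov_spaceP sep fnu mZ nuS p1 volZ alpha q.
Let spaceS := besov_spaceP sep fpi mS piS p1 volS beta q.

Definition trace_of (u : W -> R) : W -> R := trace nu delta (extZ u).

Lemma measurable_trace_of u : measurable_fun setT (extZ u) ->
  measurable_fun setT (trace_of u : borel W -> R).
Proof. by move=> mu_u; exact: measurable_trace. Qed.

(** The trace has values on the whole completion; integrals against [pi] only see
    those on the boundary. *)
Lemma osc_extend_boundary (f : borel W -> R) t : measurable_fun setT f ->
  osc pi p (extend S f) t = osc pi p f t.
Proof.
move=> mf; have mf' : measurable_fun (S : set (borel W)) f by exact: measurable_funTS.
rewrite -(besov_oscE p sep fpi mS piS volS)//.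
rewrite /osc -(integral_null_compl mS piS measurableT (measurable_osc_at sep p t fpi mf)); last first.
  by move=> x _; exact: osc_at_ge0.
rewrite setTI; apply: eq_integral => x /set_mem Sx.
apply: (ball_avgE fpi mS piS) => //; first by move=> s; exact: volS.
  exact: measurable_powR_dist.
Qed.

Lemma int_extend_boundary (f : borel W -> R) : measurable_fun setT f ->
  \int[pi]_x (`|extend S f x| `^ p)%:E = \int[pi]_x (`|f x| `^ p)%:E.
Proof.
move=> mf.
have g0 (g : borel W -> R) x : 0 <= (`|g x| `^ p)%:E by rewrite lee_fin powR_ge0.
have me := measurable_extend mS (measurable_funTS mf).
rewrite -(integral_null_compl mS piS measurableT (measurable_powR_norm p mf)) => [|x _]; last exact: g0.
rewrite -(integral_null_compl mS piS measurableT (measurable_powR_norm p me)) => [|x _]; last exact: g0.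
by apply: eq_integral => x /set_mem[_ Sx]; rewrite extend_in.
Qed.

Lemma osc_boundary_large (f : borel W -> R) t : measurable_fun setT f ->
  (2 * delta <= t)%R -> osc pi p f t <= osc pi p f (2 * delta).
Proof.
move=> mf t2; rewrite (osc_large sep p fpi mS piS mf _ t2)// => x Sx.
by apply: (boundary_sub_ball dom Sx); move: delta0; lra.
Qed.

Definition trace_osc_const : R :=
  (4 `^ p * (Dp * (D ^+ 4 * (1 - h)^-1 `^ p) + D ^+ 4 + D ^+ 4 * (1 - h)^-1 `^ p) * (A * D))%R.

Section OneFunction.
Variable u : W -> R.
Hypothesis Bu : besov_space nu Z alpha p q u.

Let mU : measurable_fun setT (extZ u). Proof. by have [] := (spaceZ u).1 Bu. Qed.

Let sU : seminorm_of alpha p q (osc nu p (extZ u)) < +oo. Proof. by have [] := (spaceZ u).1 Bu. Qed.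
Let lU : \int[nu]_x (`|extZ u x| `^ p)%:E < +oo. Proof. by have [] := (spaceZ u).1 Bu. Qed.
Let mT := measurable_trace_of mU.

Lemma seminorm_osc : besov_seminorm nu Z alpha p q u =
  seminorm_of alpha p q (osc nu p (extZ u)).
Proof. by apply: besov_seminormE => //; have [[]] := Bu. Qed.

Lemma seminorm_trace : besov_seminorm pi S beta p q (trace_of u) =
  seminorm_of beta p q (osc pi p (trace_of u)).
Proof.
rewrite (besov_seminormE p sep fpi mS piS volS); last exact: (measurable_funTS mT).
have -> // : osc pi p (extend S (trace_of u)) = osc pi p (trace_of u).
by apply/funext => t; exact: (osc_extend_boundary t mT).
Qed.

Lemma osc_trace_of_le k : osc pi p (trace_of u) (dyad (2 * delta) k) <=
  trace_osc_const%:E * weighted_tail alpha theta p (osc nu p (extZ u)) delta k.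
Proof.
exact: (osc_trace_le sep fnu fpi mS piS D1 dnu Dp1 dpi A0 delta0 theta0 p1 upper h01 mU lU).
Qed.

Let D0 : (0 < D)%R. Proof. exact: lt_le_trans D1. Qed.

Lemma osc_nu_almost_increasing : almost_increasing D (osc nu p (extZ u)).
Proof. by apply: (almost_increasing_osc sep p fnu measurableT _ D1 dnu mU); rewrite setCT measure0. Qed.

Lemma osc_pi_almost_increasing (f : borel W -> R) : measurable_fun setT f ->
  almost_increasing Dp (osc pi p f).
Proof. by move=> mf; exact: (almost_increasing_osc sep p fpi mS piS Dp1 dpi mf). Qed.

Lemma weighted_tail_finite : weighted_tail alpha theta p (osc nu p (extZ u)) delta 0 < +oo.
Proof.
have [C C0 hC] := weighted_tail0_le p1 q1 theta0 alpha_gt D0.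
apply: le_lt_trans (hC delta (osc nu p (extZ u)) delta0 _ osc_nu_almost_increasing) _.
  by move=> t; exact: osc_ge0.
rewrite lte_mul_pinfty ?lee_fin ?mulr_ge0 ?powR_ge0 ?(ltW C0)//.
exact: poweR_lty.
Qed.

Lemma osc_tail_finite_ae : {ae pi, forall z, osc_tail nu delta p h (extZ u) 0 z < +oo}.
Proof.
exact: (trace_avg_limit_ae sep fnu fpi mS piS D1 dnu A0 delta0 theta0 upper h01 mU
  weighted_tail_finite).
Qed.

Lemma trace_of_limit_ae : {ae pi, forall z, S z ->
  ball_avg nu Z (fun x => (`|u x - trace_of u z| `^ p)%:E) z r @[r --> (0 : R)^'+] --> 0}.
Proof.
apply: (@filterS _ (almost_everywhere pi) _ _ _ _ osc_tail_finite_ae) => z tz Sz.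
have := trace_limit fnu D1 dnu delta0 p1 h01 mU lU tz.
set w := (X in X @ _ --> _); set b := (X in _ -> X @ _ --> _).
have -> // : b = w.
apply/funext => r; apply: (ball_avgE fnu mZ nuS) => //.
- by move=> s s0; have [] := dnu (x := z) I s0.
- exact: measurable_powR_dist.
- by move=> y Zy; rewrite extend_in.
Qed.

Lemma integral_trace_of_le : \int[pi]_z (`|trace_of u z| `^ p)%:E <=
  (2 `^ p * (D ^+ 4 * (1 - h)^-1 `^ p * (A * D)))%:E *
    weighted_tail alpha theta p (osc nu p (extZ u)) delta 0 +
  (2 `^ p * (A * D) * (2 * delta) `^ (- theta))%:E * \int[nu]_x (`|extZ u x| `^ p)%:E.
Proof.
exact: (integral_trace_le sep fnu fpi mS piS D1 dnu A0 delta0 theta0 p1 upper h01 mU lU).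
Qed.

Lemma trace_avg_cvg_ae : {ae pi, forall z,
  trace_avg nu delta (extZ u) j z @[j --> \oo] --> trace_of u z}.
Proof.
apply: (@filterS _ (almost_everywhere pi) _ _ _ _ osc_tail_finite_ae) => z tz.
exact: (trace_avg_cvg fnu D1 dnu delta0 p1 h01 mU lU tz).1.
Qed.

Lemma trace_of_space : seminorm_of beta p q (osc pi p (trace_of u)) < +oo ->
  besov_space pi S beta p q (trace_of u).
Proof.
move=> st; apply/(spaceS (trace_of u)).2; split.
- by apply: measurable_extend => //; exact: (measurable_funTS mT).
- have -> // : osc pi p (extend S (trace_of u)) = osc pi p (trace_of u).
  by apply/funext => t; exact: (osc_extend_boundary t mT).
rewrite (int_extend_boundary mT); apply: le_lt_trans integral_trace_of_le _.
have /andP[_ h1] := h01; have h10 : (0 < (1 - h)^-1)%R by rewrite invr_gt0 subr_gt0.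
have c1 : (0 <= 2 `^ p * (D ^+ 4 * (1 - h)^-1 `^ p * (A * D)))%R by apply: ltW; posr.
have c2 : (0 <= 2 `^ p * (A * D) * (2 * delta) `^ (- theta))%R by apply: ltW; posr.
apply: lte_add_pinfty; apply: lte_mul_pinfty; rewrite ?lee_fin//.
exact: weighted_tail_finite.
Qed.

Let int_ball (x : W) r : nu.-integrable (ball x r) (EFin \o extZ u).
Proof. by apply: integrable_powR_finite lU => //; exact: measurable_ball_metric. Qed.

Lemma integrable_extend x r : nu.-integrable (ball x r) (EFin \o extZ u).
Proof. exact: int_ball. Qed.

End OneFunction.

Lemma extend_linear (a : R) (u v : W -> R) x :
  extZ (fun x => a * u x + v x)%R x = (a * extZ u x + extZ v x)%R.
Proof. by rewrite /extend !patchE; case: ifP => _ //; rewrite mulr0 addr0. Qed.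

(** Means over balls are linear, and so are their limits wherever both exist. *)
Lemma trace_of_linear (a : R) u v : besov_space nu Z alpha p q u ->
  besov_space nu Z alpha p q v ->
  {ae pi, forall z, S z ->
    trace_of (fun x => a * u x + v x)%R z = (a * trace_of u z + trace_of v z)%R}.
Proof.
move=> Bu Bv; have cu := trace_avg_cvg_ae Bu; have cv := trace_avg_cvg_ae Bv.
apply: (@filterS2 _ (almost_everywhere pi) _ _ _ _ _ cu cv) => z uz vz _.
apply: trace_of_cvg.
have -> : (fun j => trace_avg nu delta (extZ (fun x => a * u x + v x)%R) j z) =
    (fun j => a * trace_avg nu delta (extZ u) j z + trace_avg nu delta (extZ v) j z)%R.
  apply/funext => j; rewrite /trace_avg /ravg.
  have mB := measurable_ball_metric z (trace_radius delta j).
  have iu := integrable_extend Bu z (trace_radius delta j).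
  have iv := integrable_extend Bv z (trace_radius delta j).
  under eq_Rintegral do rewrite extend_linear.
  rewrite RintegralD//; last by apply: eq_integrable (integrableZl mB a iu).
  by rewrite RintegralZl// mulrDr mulrCA.
exact: (cvgD (cvgM (cvg_cst a) uz) vz).
Qed.

(** The means over balls of functions that agree almost everywhere are equal, so
    that the traces agree even pointwise. *)
Lemma trace_of_ae_eq u v : besov_space nu Z alpha p q u ->
  besov_space nu Z alpha p q v -> {ae nu, forall x, Z x -> u x = v x} ->
  trace_of u = trace_of v.
Proof.
move=> Bu Bv uv; apply/funext => z; rewrite /trace_of /trace; congr (fine (limn_esup _)).
apply/funext => j; congr (_%:E); rewrite /trace_avg /ravg; congr (_ * _)%R.
rewrite /Rintegral; congr (fine _).
have [mu_u _ _] := (spaceZ u).1 Bu; have [mu_v _ _] := (spaceZ v).1 Bv.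
apply: ae_eq_integral.
- exact: measurable_ball_metric.
- by apply/measurable_EFinP; exact: measurable_funTS.
- by apply/measurable_EFinP; exact: measurable_funTS.
apply: (@filterS _ (almost_everywhere nu) _ _ _ _ uv) => x uvx _ /=; congr (_%:E).
by rewrite /extend !patchE; case: ifPn => // /set_mem /uvx.
Qed.

End TraceOperator.

(** * Bounds for the trace that are uniform in the domain *)

Section TraceBounds.
Context {R : realType}.
Variables (theta Cnu Ctheta alpha p : R) (q : \bar R).
Hypotheses (p1 : 1 <= p) (q1 : (1 <= q)%E) (alpha_gt : theta / p < alpha).
Local Notation beta := (alpha - theta / p).
Local Open Scope ereal_scope.

Let p0 : (0 < p)%R. Proof. exact: lt_le_trans p1. Qed.

Hypotheses (theta0 : (0 < theta)%R) (Cnu1 : (1 <= Cnu)%R) (Ct1 : (1 <= Ctheta)%R).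

Let D0 : (0 < nu_doubling_const Cnu)%R.
Proof. by rewrite /nu_doubling_const exprn_gt0// (lt_le_trans _ Cnu1). Qed.
Let Ct0 : (0 < Ctheta)%R. Proof. exact: lt_le_trans Ct1. Qed.
Let A0 : (0 < codim_const theta Ctheta)%R.
Proof. by rewrite /codim_const; posr. Qed.
Let Dp0 : (0 < pi_doubling_const Cnu Ctheta)%R.
Proof. by rewrite /pi_doubling_const; posr. Qed.

Let K := trace_osc_const theta Cnu Ctheta alpha p.
Let K0 : (0 < K)%R.
Proof.
have /andP[h0 h1] := trace_ratio01 alpha_gt.
have h10 : (0 < (1 - trace_ratio alpha theta p)^-1)%R by rewrite invr_gt0 subr_gt0.
by rewrite /K /trace_osc_const; posr.
Qed.

(** The constant is chosen before the domain: every ingredient depends only on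
    the exponents and on the doubling and regularity constants. *)
Theorem trace_seminorm_bound : exists2 C : R, (0 < C)%R &
  forall (W : completeMetricType R) (Z : set W) (nu pi : {measure set (borel W) -> \bar R}),
  regular_domain Z nu pi theta Cnu Ctheta ->
  forall u, besov_space nu Z alpha p q u ->
  besov_seminorm pi (boundary Z) beta p q (trace_of Z nu u) <=
    C%:E * besov_seminorm nu Z alpha p q u.
Proof.
have [C C0 hC] := trace_seminorm_le p1 q1 theta0 alpha_gt D0 Dp0 K0.
exists C => // W Z nu pi dom u Bu.
rewrite (seminorm_trace dom p1 Bu) (seminorm_osc dom Bu).
have [[mf _] _ _] := Bu.
have mU := measurable_extend (domain_measurable dom) mf.
have mT := measurable_trace_of dom mU.
apply: (hC (diam (boundary Z))).
- exact: domain_diam dom.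
- by move=> t; exact: osc_ge0.
- by move=> t; exact: osc_ge0.
- exact: (osc_nu_almost_increasing dom p1 Bu).
- exact: (osc_pi_almost_increasing p dom mT).
- by move=> t; exact: (osc_boundary_large p dom mT).
- by move=> k; exact: (osc_trace_of_le dom p1 alpha_gt Bu k).
Qed.

(** The largest radius [2 * delta] enters with the power [- theta] from the
    average over the largest balls and with the power [beta * p] from the
    seminorm, so that this constant depends on the diameter of the boundary. *)
Theorem trace_Lp_bound (delta : R) : exists2 C : R, (1 <= C)%R &
  forall (W : completeMetricType R) (Z : set W) (nu pi : {measure set (borel W) -> \bar R}),
  regular_domain Z nu pi theta Cnu Ctheta -> diam (boundary Z) = delta ->
  forall u, besov_space nu Z alpha p q u ->
  Lp_norm pi (boundary Z) p (trace_of Z nu u) <=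
    C%:E * (Lp_norm nu Z p u + besov_seminorm nu Z alpha p q u).
Proof.
have [C1 C10 hC] := weighted_tail0_le p1 q1 theta0 alpha_gt D0.
set D := nu_doubling_const Cnu in hC *; set A := codim_const theta Ctheta.
have /andP[h0 h1] := trace_ratio01 alpha_gt.
have h10 : (0 < (1 - trace_ratio alpha theta p)^-1)%R by rewrite invr_gt0 subr_gt0.
pose a := (2 `^ p * (D ^+ 4 * (1 - trace_ratio alpha theta p)^-1 `^ p * (A * D)))%R.
pose b := (2 `^ p * (A * D) * (2 * delta) `^ (- theta))%R.
pose c := (C1 * (2 * delta) `^ (beta * p))%R.
have AD0 : (0 <= A * D)%R by rewrite mulr_ge0// ltW.
have a0 : (0 <= a)%R by apply: ltW; rewrite /a; posr.
have b0 : (0 <= b)%R by rewrite /b (mulr_ge0 (mulr_ge0 (powR_ge0 _ _) AD0))// powR_ge0.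
have c0 : (0 <= c)%R by rewrite mulr_ge0 ?powR_ge0// ltW.
pose M := (a * c + b)%R.
have M0 : (0 <= M)%R by rewrite addr_ge0// mulr_ge0.
exists (1 + M `^ p^-1)%R; first by rewrite lerDl powR_ge0.
move=> W Z nu pi dom dE u Bu.
have [[mf _] _ _] := Bu.
have mU := measurable_extend (domain_measurable dom) mf.
have mT := measurable_trace_of dom mU.
have sn := seminorm_osc dom Bu.
set L := Lp_norm nu Z p u; set N := besov_seminorm nu Z alpha p q u.
have L0 : 0 <= L by exact: Lp_norm_ge0.
have N0 : 0 <= N by rewrite /N sn seminorm_of_ge0// => t; exact: osc_ge0.
have pLN x : 0 <= x -> x <= L + N -> x `^ p <= (L + N) `^ p.
  by move=> x0 xLN; apply: le_poweR => //; exact: ltW.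
have w0 : weighted_tail alpha theta p (osc nu p (extend Z u)) delta 0 <= c%:E * (L + N) `^ p.
  apply: le_trans (hC delta (osc nu p (extend Z u)) _ _ _) _.
  - by rewrite -dE; exact: domain_diam dom.
  - by move=> t; exact: osc_ge0.
  - exact: (osc_nu_almost_increasing dom p1 Bu).
  by rewrite lee_wpmul2l ?lee_fin// -sn pLN// leeDr.
have iT := integral_trace_of_le dom p1 alpha_gt Bu; rewrite dE in iT.
apply: (@le_trans _ _ ((M `^ p^-1)%:E * (L + N))); last first.
  by rewrite lee_wpmul2r ?adde_ge0// lee_fin lerDr.
rewrite Lp_normE (int_extend_boundary p dom mT).
have -> : (M `^ p^-1)%:E * (L + N) = (M%:E * (L + N) `^ p) `^ p^-1.
  rewrite poweRM ?poweR_ge0 ?lee_fin// poweR_EFin poweRK ?gt_eqF// adde_ge0//.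
apply: le_poweR; [by rewrite invr_ge0 ltW|by apply: integral_ge0 => x _; rewrite lee_fin powR_ge0|].
apply: (le_trans iT); have ac0 : (0 <= a * c)%R by exact: mulr_ge0.
rewrite /M (EFinD (a * c)) (ge0_muleDl _ (_ : 0 <= (a * c)%:E) (_ : 0 <= b%:E))//.
apply: leeD; first by rewrite (EFinM a) -muleA lee_wpmul2l.
by rewrite (Lp_norm_powR _ _ p1) lee_wpmul2l// pLN// leeDl.
Qed.

Theorem trace_bounded_linear (W : completeMetricType R) (Z : set W)
  (nu pi : {measure set (borel W) -> \bar R}) :
  regular_domain Z nu pi theta Cnu Ctheta ->
  bounded_linear_besov nu Z alpha pi (boundary Z) beta p q (trace_of Z nu).
Proof.
move=> dom; have [C1 C10 h1] := trace_seminorm_bound.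
have [C2 C21 h2] := trace_Lp_bound (diam (boundary Z)).
split=> [u Bu|u v Bu Bv uv|a u v Bu Bv|].
- apply: (trace_of_space dom p1 q1 alpha_gt Bu).
  rewrite -(seminorm_trace dom p1 Bu).
  apply: le_lt_trans (h1 _ _ _ _ dom u Bu) _.
  by rewrite lte_mul_pinfty ?lee_fin ?(ltW C10)//; case: Bu.
- by apply: aeW => z _; rewrite (trace_of_ae_eq dom p1 Bu Bv uv).
- exact: (trace_of_linear dom p1 q1 alpha_gt a Bu Bv).
exists (C1 + C2)%R => u Bu.
have [[mf _] _ _] := Bu; have L0 := Lp_norm_ge0 nu Z p u.
have N0 : 0 <= besov_seminorm nu Z alpha p q u.
  by rewrite (seminorm_osc dom Bu) seminorm_of_ge0// => t; exact: osc_ge0.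
have C20 : (0 <= C2)%R by exact: le_trans C21.
rewrite /besov_norm EFinD ge0_muleDl ?lee_fin ?(ltW C10)//; apply: leeD.
  apply: le_trans (h1 _ _ _ _ dom u Bu) _.
  by rewrite lee_wpmul2l ?lee_fin ?(ltW C10)// leeDl.
by apply: le_trans (h2 _ _ _ _ dom erefl u Bu) _; rewrite addeC.
Qed.

End TraceBounds.

(** * The Whitney partition of unity *)

Section Whitney.
Context {R : realType} {W : completeMetricType R}.
Variables (Z : set W) (nu pi : {measure set (borel W) -> \bar R}).
Variables (theta Cnu Ctheta : R).
Hypothesis dom : regular_domain Z nu pi theta Cnu Ctheta.
Variables (w : whitney_data W) (Cw : R).
Hypotheses (Cw0 : 0 < Cw) (hw : is_whitney Z Cnu Cw w).
Local Notation S := (boundary Z).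
Local Notation I := (wh_index w).
Local Notation pc := (wh_center w).
Local Notation rk := (wh_radius w).
Local Notation foot := (wh_foot w).
Local Notation phi := (wh_part w).
Implicit Types (k : int * nat) (x y z : W) (f : W -> R).

Lemma whitney_radius_gt0 k : I k -> 0 < rk k.
Proof. by move=> /(wh_scale hw)[h _]; apply: lt_trans h; rewrite exprz_gt0. Qed.

Lemma edistE x y : edist (x, y) = (mdist x y)%:E.
Proof.
apply/eqP; rewrite eq_le; apply/andP; split; last first.
  apply: le_ereal_inf_tmp => _ [r [_ xr] <-]; rewrite /= in_ball in xr.
  by rewrite lee_fin ltW.
apply/lee_addgt0Pr => e e0; rewrite -EFinD; apply: edist_fin => /=.
  by rewrite ltr_wpDl// mdist_ge0.
by rewrite in_ball ltrDl.
Qed.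

Lemma whitney_foot_dist k : I k -> mdist (pc k) (foot k) = 8 * rk k.
Proof.
move=> Ik; have [Sq cl] := wh_closest hw Ik.
have E : edist_inf S (pc k) = (mdist (pc k) (foot k))%:E.
  apply/eqP; rewrite eq_le; apply/andP; split.
    by apply: ereal_inf_lbound; exists (foot k) => //; exact: edistE.
  by apply: le_ereal_inf_tmp => _ [z Sz <-]; rewrite edistE lee_fin cl.
have := wh_dist hw Ik; rewrite E -EFinM => -[->].
by rewrite mulrA mulfV ?mul1r.
Qed.

Lemma whitney_boundary_dist k z : I k -> S z -> 8 * rk k <= mdist (pc k) z.
Proof.
by move=> Ik Sz; rewrite -whitney_foot_dist//; have [_] := wh_closest hw Ik; apply.
Qed.

Definition whitney_near x : set (int * nat) :=
  I `&` [set k | ball (pc k) (2 * rk k) x].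

Lemma whitney_part_far k x : I k -> ~ ball (pc k) (2 * rk k) x -> phi k x = 0.
Proof.
move=> Ik nb; have [h0] := wh_support hw x Ik.
by rewrite indicE memNset// => h1; apply/eqP; rewrite eq_le h0 h1.
Qed.

(** The bounded overlap limits the number of balls near a point, so that all the
    sums at that point are finite. *)
Lemma whitney_near_count x (B : seq (int * nat)) : uniq B ->
  [set` B] `<=` whitney_near x -> (size B)%:R <= 2 * Cnu ^+ 5.
Proof.
move=> uB BA; rewrite -lee_fin; apply: le_trans (wh_overlap hw x).
apply: esum_ge; exists [set` B].
  by split; [exact: finite_seq|move=> k /BA[]].
rewrite (@fsbigE _ _ _ _ _ B)//; last by move=> i /= ->.
rewrite big_seq_cond.
rewrite (eq_bigr (fun=> 1%E)) => [|k /andP[kB _]]; last first.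
  by have [_ kx] := BA k kB; rewrite indicE mem_set.
rewrite (eq_bigl (fun k => k \in B)) => [|k]; last by rewrite mem_setE andbb.
by rewrite -big_seq sumEFin big_const_seq count_predT iter_addr addr0.
Qed.

Lemma whitney_near_finite x : finite_set (whitney_near x).
Proof.
apply: contrapT => inf; have [n Cn] := exp2_unbounded (2 * Cnu ^+ 5).
have [B BA sB] := infinite_set_fset (2 ^ n) inf.
have := whitney_near_count (finmap.fset_uniq B) BA; rewrite leNgt => /negP; apply.
by apply: (lt_le_trans Cn); rewrite -natrX ler_nat.
Qed.

Definition whitney_seq x : seq (int * nat) := finmap.enum_fset (fset_set (whitney_near x)).

Lemma whitney_seq_uniq x : uniq (whitney_seq x).
Proof. exact: finmap.fset_uniq. Qed.

Lemma mem_whitney_seq x k : (k \in whitney_seq x) = (k \in whitney_near x).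
Proof. by rewrite -(in_fset_set (whitney_near_finite x)). Qed.

Lemma whitney_seq_sub x : [set` whitney_seq x] `<=` whitney_near x.
Proof. by move=> k /=; rewrite mem_whitney_seq => /set_mem. Qed.

(** The sum may be taken over any finite family that contains the balls near [x];
    two points can thus be treated with one common family. *)
Lemma whitney_sumE x (a : int * nat -> R) (s : seq (int * nat)) : uniq s ->
  (forall k, k \in s -> I k) -> (forall k, whitney_near x k -> k \in s) ->
  \sum_(k \in I) (a k * phi k x) = \sum_(k <- s) a k * phi k x.
Proof.
move=> us sI As; rewrite (@fsbigE _ _ _ _ _ s) => //; last first.
  move=> k Ik ks; rewrite whitney_part_far ?mulr0// => kx.
  by move: ks; rewrite As.
rewrite big_seq_cond [RHS]big_seq_cond; apply: eq_bigl => k.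
by have [/sI Ik|//] := boolP (k \in s); rewrite mem_set.
Qed.

Lemma whitney_partition1 x : Z x -> \sum_(k <- whitney_seq x) phi k x = 1.
Proof.
move=> Zx; have := wh_partition hw x; rewrite indicE mem_set//.
have p0 k : k \in whitney_near x -> (0 <= (phi k x)%:E)%E.
  by move=> /set_mem[Ik _]; rewrite lee_fin; have [] := wh_support hw x Ik.
have -> : (\esum_(k in I) (phi k x)%:E = \esum_(k in whitney_near x) (phi k x)%:E)%E.
  rewrite /whitney_near esum_mkcondr; apply: eq_esum => k Ik.
  by case: ifPn => // /negP kx; rewrite whitney_part_far// => b; apply: kx; exact: mem_set.
rewrite (esum_fset (whitney_near_finite x) p0) fsbig_finite ?sumEFin; last first.
  exact: whitney_near_finite.
by case.
Qed.

Lemma whitney_partition x (s : seq (int * nat)) : Z x -> uniq s ->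
  (forall k, k \in s -> I k) -> (forall k, whitney_near x k -> k \in s) ->
  \sum_(k <- s) phi k x = 1.
Proof.
move=> Zx us sI As; rewrite -(whitney_partition1 Zx).
under eq_bigr do rewrite -[phi _ _]mul1r.
under [RHS]eq_bigr do rewrite -[phi _ _]mul1r.
rewrite -(whitney_sumE (fun=> 1) us sI As).
apply: whitney_sumE; first exact: whitney_seq_uniq.
- by move=> k; rewrite mem_whitney_seq => /set_mem[].
by move=> k kx; rewrite mem_whitney_seq mem_set.
Qed.

Definition whitney_coef f k : R :=
  let U := ball (foot k) (rk k) `&` S in (fine (pi U))^-1 * \int[pi]_(z in U) f z.

Lemma whitney_extensionE f x (s : seq (int * nat)) : uniq s ->
  (forall k, k \in s -> I k) -> (forall k, whitney_near x k -> k \in s) ->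
  whitney_extension Z pi w f x = \sum_(k <- s) whitney_coef f k * phi k x.
Proof. exact: whitney_sumE. Qed.

Let seq_near x k : k \in whitney_seq x -> I k.
Proof. by rewrite mem_whitney_seq => /set_mem[]. Qed.

Let near_seq x k : whitney_near x k -> k \in whitney_seq x.
Proof. by rewrite mem_whitney_seq => kx; exact: mem_set. Qed.

Lemma whitney_extension_seq f x : whitney_extension Z pi w f x =
  \sum_(k <- whitney_seq x) whitney_coef f k * phi k x.
Proof.
apply: whitney_extensionE; [exact: whitney_seq_uniq|exact: seq_near|exact: near_seq].
Qed.

Lemma whitney_extension_convex f x c M : Z x ->
  (forall k, I k -> mdist (pc k) x < 2 * rk k -> `|whitney_coef f k - c| <= M) ->
  `|whitney_extension Z pi w f x - c| <= M.
Proof.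
move=> Zx h; have p1 := whitney_partition1 Zx.
have -> : whitney_extension Z pi w f x - c =
    \sum_(k <- whitney_seq x) (whitney_coef f k - c) * phi k x.
  rewrite whitney_extension_seq -[in LHS](mulr1 c) -{1}p1 mulr_sumr -sumrB.
  by apply: eq_bigr => k _; rewrite mulrBl.
apply: le_trans (ler_norm_sum _ _ _) _.
rewrite -[leRHS]mulr1 -p1 mulr_sumr big_seq [leRHS]big_seq; apply: ler_sum => k kx.
have Ik := seq_near kx; have [h0 _] := wh_support hw x Ik.
rewrite normrM (ger0_norm h0) ler_wpM2r// h//.
by have [_] := whitney_seq_sub kx; rewrite /= in_ball.
Qed.

Definition whitney_lip_const : R := 2 * (2 * Cnu ^+ 5) * Cw.

Lemma whitney_lip_const_gt0 : 0 < whitney_lip_const.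
Proof.
have Cnu0 : 0 < Cnu by apply: lt_le_trans (domain_Cnu dom).
by rewrite /whitney_lip_const; posr.
Qed.

(** Subtracting the constant is possible because the partition sums to one at
    both points. *)
Lemma whitney_extension_lip f x y c M r : Z x -> Z y -> 0 < r ->
  (forall k, I k -> mdist (pc k) x < 2 * rk k \/ mdist (pc k) y < 2 * rk k ->
    `|whitney_coef f k - c| <= M /\ r <= rk k) ->
  `|whitney_extension Z pi w f x - whitney_extension Z pi w f y| <=
    whitney_lip_const / r * mdist x y * M.
Proof.
move=> Zx Zy r0 h; pose s := undup (whitney_seq x ++ whitney_seq y).
have us : uniq s by exact: undup_uniq.
have sI k : k \in s -> I k.
  by rewrite mem_undup mem_cat => /orP[]; exact: seq_near.
have sx k : whitney_near x k -> k \in s.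
  by move=> /near_seq kx; rewrite mem_undup mem_cat kx.
have sy k : whitney_near y k -> k \in s.
  by move=> /near_seq kx; rewrite mem_undup mem_cat kx orbT.
have sh k : k \in s -> `|whitney_coef f k - c| <= M /\ r <= rk k.
  move=> ks; apply: h; first exact: sI.
  move: ks; rewrite mem_undup mem_cat => /orP[] /whitney_seq_sub[_ /=]; rewrite in_ball.
    by left.
  by right.
have M0 : 0 <= M.
  have : whitney_seq x != [::].
    apply/eqP => s0; have := whitney_partition1 Zx.
    by rewrite s0 big_nil => /esym/eqP; rewrite oner_eq0.
  case E : (whitney_seq x) => [//|k t] _.
  have ks : k \in s by rewrite mem_undup mem_cat E mem_head.
  by apply: le_trans (sh k ks).1.
have -> : whitney_extension Z pi w f x - whitney_extension Z pi w f y =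
    \sum_(k <- s) (whitney_coef f k - c) * (phi k x - phi k y).
  rewrite (whitney_extensionE f us sI sx) (whitney_extensionE f us sI sy) -sumrB.
  transitivity (\sum_(k <- s) (whitney_coef f k * phi k x - whitney_coef f k * phi k y) -
      c * (\sum_(k <- s) phi k x - \sum_(k <- s) phi k y)).
    by rewrite (whitney_partition Zx us sI sx) (whitney_partition Zy us sI sy) subrr mulr0 subr0.
  rewrite -sumrB mulr_sumr -sumrB; apply: eq_bigr => k _; ring.
apply: le_trans (ler_norm_sum _ _ _) _.
pose b := M * (Cw / r * mdist x y).
have b0 : 0 <= b by rewrite !mulr_ge0 ?mdist_ge0 ?invr_ge0// ltW.
apply: (@le_trans _ _ (\sum_(k <- s) b)).
  rewrite big_seq [leRHS]big_seq; apply: ler_sum => k ks.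
  have [cM rr] := sh k ks; rewrite normrM; apply: ler_pM => //.
  have Ik := sI k ks; apply: le_trans (wh_lipschitz hw Ik Zx Zy) _.
  rewrite ler_wpM2r ?mdist_ge0// ler_wpM2l ?(ltW Cw0)//.
  by rewrite lef_pV2 ?posrE// whitney_radius_gt0.
rewrite big_const_seq count_predT iter_addr addr0 -mulr_natl.
rewrite (_ : whitney_lip_const / r * mdist x y * M = 2 * (2 * Cnu ^+ 5) * b); last first.
  by rewrite /whitney_lip_const /b; ring.
rewrite ler_wpM2r//; apply: (@le_trans _ _ ((size (whitney_seq x))%:R + (size (whitney_seq y))%:R)).
  by rewrite -natrD -size_cat ler_nat size_undup.
rewrite mulrDl mul1r; apply: lerD; apply: whitney_near_count.
- exact: whitney_seq_uniq.
- exact: whitney_seq_sub.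
- exact: whitney_seq_uniq.
- exact: whitney_seq_sub.
Qed.

(** The weights are Lipschitz on the open set [Z], so that their superlevel sets
    in [Z] are open in the completion. *)
Lemma measurable_whitney_part k : I k ->
  measurable_fun (Z : set (borel W)) (phi k : borel W -> R).
Proof.
move=> Ik; apply: (measurability _ (RGenOInfty.measurableE R)).
move=> _ [_ [a ->] <-]; apply: open_borel; rewrite openE => x [Zx /=].
rewrite in_itv/= andbT => ax.
have L0 : 0 < Cw / rk k by rewrite divr_gt0// whitney_radius_gt0.
have /nbhs_ballP[e /= e0 xe] : nbhs x Z.
  by apply: open_nbhs_nbhs; split => //; exact: domain_open dom.
pose d := (phi k x - a) / (Cw / rk k).
have d0 : 0 < d by rewrite divr_gt0// subr_gt0.
apply/nbhs_ballP; exists (Num.min e d); first by rewrite /= lt_min e0.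
move=> y; rewrite in_ball lt_min => /andP[ye yd].
have Zy : Z y by apply: xe; rewrite in_ball.
split => //=; rewrite in_itv/= andbT.
have := wh_lipschitz hw Ik Zx Zy; have := ler_norm (phi k x - phi k y).
have : Cw / rk k * mdist x y < phi k x - a by rewrite mulrC -ltr_pdivlMr.
by lra.
Qed.

(** The index set is countable; summing over longer and longer initial segments
    of it gives a sequence of measurable functions that is eventually constant at
    each point. *)
Lemma measurable_whitney_extension f :
  measurable_fun (Z : set (borel W)) (whitney_extension Z pi w f : borel W -> R).
Proof.
pose s n : seq (int * nat) := pmap pickle_inv (iota 0 n).
pose h n (x : borel W) : R :=
  \sum_(k <- s n) (if k \in I then whitney_coef f k * phi k x else 0).
apply: (@measurable_fun_cvg _ _ _ _ h) => [n|x Zx].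
  apply: measurable_sum => k; have [/set_mem Ik|_] := boolP (k \in I); last exact: measurable_cst.
  by apply: measurable_funM; [exact: measurable_cst|exact: measurable_whitney_part].
pose N := (\max_(k <- whitney_seq x) (pickle k).+1)%N.
apply: cvg_near_cst; exists N => // n /= Nn.
rewrite /h -big_mkcond -big_filter; apply/esym; apply: whitney_extensionE.
- by rewrite filter_uniq// (pmap_uniq (@pickle_invK _)) ?iota_uniq.
- by move=> k; rewrite mem_filter => /andP[/set_mem].
move=> k kx; rewrite mem_filter; have [Ik _] := kx; rewrite mem_set//= mem_pmap.
apply/mapP; exists (pickle k); last by rewrite pickleK_inv.
rewrite mem_iota add0n/=; apply: leq_trans Nn.
by rewrite /N; apply: (@leq_bigmax_seq _ _ xpredT (fun k => (pickle k).+1)) => //; exact: near_seq.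
Qed.

Lemma whitney_coef_ae_eq f g : {ae pi, forall z, S z -> f z = g z} ->
  measurable_fun (S : set (borel W)) (f : borel W -> R) ->
  measurable_fun (S : set (borel W)) (g : borel W -> R) ->
  forall k, whitney_coef f k = whitney_coef g k.
Proof.
move=> fg mf mg k; congr (_ * _)%R; rewrite /Rintegral; congr (fine _).
set U := _ `&` S; have mU : measurable (U : set (borel W)).
  by apply: measurableI; [exact: measurable_ball_metric|exact: boundary_measurable dom].
have US : U `<=` S by move=> z [].
apply: ae_eq_integral => //.
- by apply/measurable_EFinP; apply: measurable_funS mf => //; exact: boundary_measurable dom.
- by apply/measurable_EFinP; apply: measurable_funS mg => //; exact: boundary_measurable dom.
by apply: (@filterS _ (almost_everywhere pi) _ _ _ _ fg) => z fgz /US Sz /=; rewrite fgz.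
Qed.

Lemma whitney_coef_linear (a : R) f g k :
  pi.-integrable (ball (foot k) (rk k) `&` S : set (borel W)) (EFin \o (f : borel W -> R)) ->
  pi.-integrable (ball (foot k) (rk k) `&` S : set (borel W)) (EFin \o (g : borel W -> R)) ->
  whitney_coef (fun x => a * f x + g x) k = a * whitney_coef f k + whitney_coef g k.
Proof.
move=> jf jg; rewrite /whitney_coef.
have mU : measurable (ball (foot k) (rk k) `&` S : set (borel W)).
  by apply: measurableI; [exact: measurable_ball_metric|exact: boundary_measurable dom].
rewrite RintegralD//; last by apply: eq_integrable (integrableZl mU a jf).
by rewrite RintegralZl// mulrDr mulrCA.
Qed.

Lemma whitney_extension_coef_linear (a : R) f g h x :
  (forall k, I k -> whitney_coef h k = a * whitney_coef f k + whitney_coef g k) ->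
  whitney_extension Z pi w h x =
    a * whitney_extension Z pi w f x + whitney_extension Z pi w g x.
Proof.
move=> H; rewrite !whitney_extension_seq mulr_sumr -big_split/= big_seq [RHS]big_seq.
by apply: eq_bigr => k kx; rewrite H ?mulrDl ?mulrA//; exact: seq_near kx.
Qed.

End Whitney.

(** * The extension operator *)

Section ExtensionOperator.
Context {R : realType} {W : completeMetricType R}.
Variables (Z : set W) (nu pi : {measure set (borel W) -> \bar R}).
Variables (theta Cnu Ctheta alpha p : R) (q : \bar R).
Hypothesis dom : regular_domain Z nu pi theta Cnu Ctheta.
Hypotheses (p1 : 1 <= p) (q1 : (1 <= q)%E).
Hypotheses (alpha_gt : theta / p < alpha) (alpha_lt1 : alpha < 1).
Variables (w : whitney_data W) (Cw : R).
Hypotheses (Cw0 : 0 < Cw) (hw : is_whitney Z Cnu Cw w).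
Local Notation S := (boundary Z).
Local Notation delta := (diam (boundary Z)).
Local Notation beta := (alpha - theta / p).
Local Notation D := (nu_doubling_const Cnu).
Local Notation Dp := (pi_doubling_const Cnu Ctheta).
Local Notation ext := (whitney_extension Z pi w).
Local Open Scope ereal_scope.

Let p0 : (0 < p)%R. Proof. exact: lt_le_trans p1. Qed.
Let theta0 := domain_theta dom.
Let delta0 := domain_diam dom.
Let sep := domain_separable dom.
Let fnu := finite_nu dom.
Let fpi := finite_pi dom.
Let mZ := domain_measurable dom.
Let mS := boundary_measurable dom.
Let nuS : nu (~` Z) = 0 := domain_nu0 dom.
Let piS := pi_boundary0 dom.
Let D1 := nu_doubling_const_ge1 dom.
Let dnu := nu_doubling dom.
Let Dp1 := pi_doubling_const_ge1 dom.
Let dpi := pi_doubling dom.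
Let Ct0 : (0 < Ctheta)%R. Proof. exact: lt_le_trans (domain_Ctheta dom). Qed.
Let D0 : (0 < D)%R. Proof. exact: lt_le_trans D1. Qed.
Let Dp0 : (0 < Dp)%R. Proof. exact: lt_le_trans Dp1. Qed.

Let volZ x t : Z x -> (0 < t)%R -> (0 < vol nu x t)%R.
Proof. by move=> _ t0; have [] := dnu (x := x) Logic.I t0. Qed.

Let volS x t : S x -> (0 < t)%R -> (0 < vol pi x t)%R.
Proof. by move=> Sx t0; have [] := dpi Sx t0. Qed.

Let spaceZ := besov_spaceP sep fnu mZ nuS p1 volZ alpha q.
Let spaceS := besov_spaceP sep fpi mS piS p1 volS beta q.

(** The extension looks at balls much larger than the boundary, so that its
    constants also depend on the ratio of the two diameters. *)
Lemma codim_large (R0 : R) : (0 < R0)%R -> exists2 A, (0 < A)%R &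
  forall z r, S z -> (0 < r)%R -> (r <= 128 * R0)%R ->
    (vol pi z r * r `^ theta <= A * vol nu z r)%R /\
    (vol nu z r <= A * (vol pi z r * r `^ theta))%R.
Proof.
move=> R00; have d20 : (0 < 2 * delta)%R by posr.
have [n hn] := exp2_unbounded (128 * R0 / (2 * delta)).
rewrite ltr_pdivrMr// in hn.
have a1 : (0 < Ctheta * (2 ^+ n) `^ theta)%R by posr.
have a2 : (0 < Ctheta * D ^+ n)%R by posr.
exists (Ctheta * (2 ^+ n) `^ theta + Ctheta * D ^+ n)%R; first exact: addr_gt0.
move=> z r Sz r0 rR; have rn : (r <= 2 ^+ n * (2 * delta))%R.
  by apply: le_trans rR _; exact: ltW.
split.
  apply: le_trans (codim_upper dom _ Sz r0 rn) _; first by rewrite exprn_ege1// ler1n.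
  by rewrite ler_wpM2r ?vol_ge0// lerDl ltW.
apply: le_trans (codim_lower dom Sz r0 rn) _.
by rewrite ler_wpM2r ?mulr_ge0 ?vol_ge0 ?powR_ge0// lerDr ltW.
Qed.

Lemma whitney_coefE f k : coef pi S (extend S f) (wh_foot w) (wh_radius w) k =
  whitney_coef Z pi w f k.
Proof.
rewrite /coef /ravg /whitney_coef; congr (_ * _)%R.
by apply: eq_Rintegral => z /set_mem[_ Sz]; rewrite extend_in.
Qed.

(** The third clause says that the extension converges to [f] in the mean along
    some sequence of radii that tends to zero, which is enough to identify its
    trace. *)
Theorem extension_bounds : exists2 C : R, (0 < C)%R &
  forall f, besov_space pi S beta p q f ->
  [/\ seminorm_of alpha p q (osc nu p (extend Z (ext f))) <=
        C%:E * seminorm_of beta p q (osc pi p (extend S f)),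
      \int[nu]_x (`|extend Z (ext f) x| `^ p)%:E <=
        C%:E * \int[pi]_x (`|extend S f x| `^ p)%:E &
      exists2 s : nat -> R, (forall d, (0 < d)%R -> exists N, forall i, (N <= i)%N -> (0 < s i < d)%R) &
        {ae pi, forall z, forall e, (0 < e)%R -> exists N, forall i, (N <= i)%N ->
          wavg nu nu (s i) (fun x => (`|extend Z (ext f) x - extend S f z| `^ p)%:E) z <= e%:E}].
Proof.
have [R0 R00 bnd] := mdist_bounded dom.
have [A A0 hA] := codim_large R00.
have up z r : S z -> (0 < r)%R -> (r <= 128 * R0)%R ->
  (vol pi z r * r `^ theta <= A * vol nu z r)%R by move=> *; exact: (hA _ _ _ _ _).1.
have lo z r : S z -> (0 < r)%R -> (r <= 128 * R0)%R ->
  (vol nu z r <= A * (vol pi z r * r `^ theta))%R by move=> *; exact: (hA _ _ _ _ _).2.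
have N0 := whitney_lip_const_gt0 dom Cw0.
set N := whitney_lip_const Cnu Cw in N0.
have S0 := boundary_nonempty dom; have cS := boundary_closed dom.
have nuS' : nu S = 0 := nuS.
have rk0 := whitney_radius_gt0 hw.
have qS k : wh_index w k -> S (wh_foot w k) by move=> /(wh_closest hw)[].
have pq := whitney_foot_dist hw.
have pS := whitney_boundary_dist hw.
have M0 := ext_osc_const_gt0 p D1 A0 theta0 N0 Dp1.
set M := ext_osc_const D A theta p N Dp in M0.
have [C C0 hC] := extension_seminorm_le p1 q1 theta0 alpha_gt alpha_lt1 R00 D0 Dp0 M0.
set L := ext_Lp_const D A theta R0.
exists (C + `|L|)%R => [|f Bf]; first by rewrite ltr_pwDl.
have [mf sf lf] := (spaceS f).1 Bf.
have mF := measurable_extend mZ (measurable_whitney_extension dom Cw0 hw f).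
have nS x : ~ S x -> Z x by move=> /contrapT.
have conv x c B : ~ S x -> (forall k, wh_index w k -> (mdist (wh_center w k) x < 2 * wh_radius w k)%R ->
    (`|coef pi S (extend S f) (wh_foot w) (wh_radius w) k - c| <= B)%R) ->
    (`|extend Z (ext f) x - c| <= B)%R.
  move=> /nS Zx h; rewrite extend_in//; apply: (whitney_extension_convex hw Zx) => k Ik kx.
  by rewrite -whitney_coefE; exact: h.
have lip x y c B r : ~ S x -> ~ S y -> (0 < r)%R ->
    (forall k, wh_index w k -> (mdist (wh_center w k) x < 2 * wh_radius w k)%R \/
      (mdist (wh_center w k) y < 2 * wh_radius w k)%R ->
      (`|coef pi S (extend S f) (wh_foot w) (wh_radius w) k - c| <= B)%R /\ (r <= wh_radius w k)%R) ->
    (`|extend Z (ext f) x - extend Z (ext f) y| <= N / r * mdist x y * B)%R.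
  move=> /nS Zx /nS Zy r0 h; rewrite !extend_in//.
  apply: (whitney_extension_lip (c := c) Cw0 hw) => // k Ik kxy.
  by rewrite -whitney_coefE; exact: h.
have incE : almost_increasing D (osc nu p (extend Z (ext f))).
  by apply: (almost_increasing_osc sep p fnu measurableT _ D1 dnu mF); rewrite setCT measure0.
have incf := almost_increasing_osc sep p fpi mS piS Dp1 dpi mf.
have sge0 : 0 <= seminorm_of beta p q (osc pi p (extend S f)).
  by apply: seminorm_of_ge0 => // t; exact: osc_ge0.
have ige0 : 0 <= \int[pi]_x (`|extend S f x| `^ p)%:E.
  by apply: integral_ge0 => x _; rewrite lee_fin powR_ge0.
split.
- apply: (@le_trans _ _ (C%:E * seminorm_of beta p q (osc pi p (extend S f)))); last first.
    by rewrite lee_wpmul2r// lee_fin lerDl.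
  apply: hC => //.
  + by move=> t; exact: osc_ge0.
  + by move=> t; exact: osc_ge0.
  + move=> t Rt; rewrite (osc_large sep p fnu measurableT _ mF _ Rt)//; first by rewrite setCT measure0.
    by move=> x _ y _; rewrite in_ball.
  move=> i.
  exact: (osc_ext_le sep fnu fpi S0 cS nuS' piS D1 dnu A0 R00 theta0 p1 bnd up lo mf lf
    rk0 qS pq pS N0 mF conv lip Dp1 dpi i).
- apply: (@le_trans _ _ (L%:E * \int[pi]_x (`|extend S f x| `^ p)%:E)).
    exact: (integral_ext_le sep fnu fpi S0 cS nuS' piS D1 dnu A0 R00 theta0 p1 bnd lo mf lf
      rk0 qS pq pS mF conv).
  by rewrite lee_wpmul2r// lee_fin (le_trans (ler_norm _))// lerDr ltW.
exists (dyad R0) => [d d0|].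
  have [n hn] := exp2_unbounded (R0 / d); exists n => i ni.
  rewrite dyad_gt0//=; apply: le_lt_trans (dyad_mono R00 ni) _.
  by rewrite /dyad ltr_pdivrMr ?exprn_gt0// mulrC -ltr_pdivrMr.
have osum := osc_summable p1 q1 alpha_gt R00 Dp0 (fun t => osc_ge0 pi p (extend S f) t) incf sf.
exact: (ext_dist_small_ae sep fnu fpi S0 cS nuS' piS D1 dnu A0 R00 theta0 p1 bnd up lo mf lf
  rk0 qS pq pS mF conv osum).
Qed.

Lemma extension_space f : besov_space pi S beta p q f -> besov_space nu Z alpha p q (ext f).
Proof.
move=> Bf; have [C C0 hC] := extension_bounds; have [h1 h2 _] := hC f Bf.
have [_ sf lf] := (spaceS f).1 Bf.
apply/(spaceZ (ext f)).2; split.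
- exact: (measurable_extend mZ (measurable_whitney_extension dom Cw0 hw f)).
- by apply: le_lt_trans h1 _; rewrite lte_mul_pinfty ?lee_fin// ltW.
- by apply: le_lt_trans h2 _; rewrite lte_mul_pinfty ?lee_fin// ltW.
Qed.

Let integrable_patch f (x : W) r : besov_space pi S beta p q f ->
  pi.-integrable (ball x r `&` S : set (borel W)) (EFin \o (f : borel W -> R)).
Proof.
move=> Bf; have [mf _ lf] := (spaceS f).1 Bf.
have mB : measurable (ball x r `&` S : set (borel W)).
  by apply: measurableI => //; exact: measurable_ball_metric.
have := integrable_powR_finite fpi p1 mB mf lf.
by apply: eq_integrable => // y /set_mem[_ Sy]; rewrite /= extend_in.
Qed.

Theorem extension_bounded_linear : bounded_linear_besov pi S beta nu Z alpha p q ext.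
Proof.
have [C C0 hC] := extension_bounds.
split=> [|f g Bf Bg fg|a f g Bf Bg|].
- exact: extension_space.
- have [[mf _] _ _] := Bf; have [[mg _] _ _] := Bg.
  have e := whitney_coef_ae_eq dom w fg mf mg.
  apply: aeW => x _; rewrite !(whitney_extension_seq pi hw).
  by apply: eq_bigr => k _; rewrite e.
- apply: aeW => x _; apply: (whitney_extension_coef_linear hw) => k Ik.
  by apply: (whitney_coef_linear dom); exact: integrable_patch.
exists (C + C `^ p^-1)%R => f Bf; have [h1 h2 _] := hC f Bf.
have [[mf _] _ _] := Bf.
have sE : besov_seminorm nu Z alpha p q (ext f) = seminorm_of alpha p q (osc nu p (extend Z (ext f))).
  apply: (besov_seminormE p sep fnu mZ nuS volZ).
  exact: (measurable_whitney_extension dom Cw0 hw f).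
have sf : besov_seminorm pi S beta p q f = seminorm_of beta p q (osc pi p (extend S f)).
  exact: (besov_seminormE p sep fpi mS piS volS).
have s0 : 0 <= besov_seminorm pi S beta p q f.
  by rewrite sf seminorm_of_ge0// => t; exact: osc_ge0.
have L0 := Lp_norm_ge0 pi S p f.
rewrite /besov_norm EFinD ge0_muleDl ?lee_fin ?powR_ge0 ?(ltW C0)//; apply: leeD.
  by rewrite sE (le_trans h1)// -sf lee_wpmul2l ?lee_fin ?(ltW C0)// leeDl.
apply: (@le_trans _ _ ((C `^ p^-1)%:E * Lp_norm pi S p f)).
  rewrite !Lp_normE -poweR_EFin -poweRM ?lee_fin ?(ltW C0) ?int_powR_ge0//.
  apply: le_poweR => //; [by rewrite invr_ge0 ltW|exact: int_powR_ge0].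
by rewrite lee_wpmul2l ?lee_fin ?powR_ge0// leeDr.
Qed.

(** Both the trace of the extension and the boundary function are approximated by
    the extension in the mean over small balls. *)
Theorem trace_extension f : besov_space pi S beta p q f ->
  {ae pi, forall z, S z -> trace_of Z nu (ext f) z = f z}.
Proof.
move=> Bf; have [C C0 hC] := extension_bounds; have [_ _ [s s0 sae]] := hC f Bf.
have BF := extension_space Bf.
have tae := trace_of_limit_ae dom p1 q1 alpha_gt BF.
have mF := measurable_extend mZ (measurable_whitney_extension dom Cw0 hw f).
apply: (@filterS2 _ (almost_everywhere pi) _ _ _ _ _ sae tae) => z sz tz Sz.
have {tz}tz := tz Sz; set T := trace_of Z nu (ext f) z in tz *.
have Fz : extend S f z = f z by exact: extend_in.
have key e : (0 < e)%R -> (`|T - f z| `^ p <= e)%R.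
  move=> e0; have c2 : (0 < 2 `^ p :> R)%R by exact: powR_gt0.
  have e20 : (0 < e / (2 * 2 `^ p))%R by posr.
  have [N hN] := sz _ e20.
  have nb : \forall r \near (0 : R)^'+,
      ball_avg nu Z (fun x => (`|ext f x - T| `^ p)%:E) z r < (e / (2 * 2 `^ p))%:E.
    have n0 : nbhs (0 : \bar R) [set y | y < (e / (2 * 2 `^ p))%:E].
      by apply: open_nbhs_nbhs; split; [exact: open_ereal_lt_ereal|rewrite /= lte_fin].
    exact: tz n0.
  have [d /= d0 hd] := nb.
  have [N2 hN2] := s0 d d0.
  pose i := maxn N N2; have /andP[si0 sid] := hN2 i (leq_maxr _ _).
  have b1 := hN i (leq_maxl _ _).
  have b2 := hd (s i); rewrite /= sub0r normrN gtr0_norm// in b2.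
  have {b2}b2 := b2 sid si0.
  have E : ball_avg nu Z (fun x => (`|ext f x - T| `^ p)%:E) z (s i) =
      wavg nu nu (s i) (fun x => (`|extend Z (ext f) x - T| `^ p)%:E) z.
    apply: (ball_avgE fnu mZ nuS) => //.
    - by move=> t t0; have [] := dnu (x := z) Logic.I t0.
    - exact: measurable_powR_dist.
    - by move=> y Zy; rewrite extend_in.
  rewrite E in b2; rewrite Fz in b1.
  have mB := measurable_ball_metric z (s i).
  have v0 : (0 < vol nu z (s i))%R by have [] := dnu (x := z) Logic.I si0.
  have cst : (`|T - f z| `^ p)%:E = ((vol nu z (s i))^-1)%:E *
      \int[nu]_(x in ball z (s i)) (`|T - f z| `^ p)%:E.
    by rewrite integral_cst// (volE _ _ fnu) muleCA -!EFinM (mulVf (lt0r_neq0 v0)) mulr1.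
  rewrite -lee_fin cst.
  have g0 c x : 0 <= (`|extend Z (ext f) x - c| `^ p)%:E by rewrite lee_fin powR_ge0.
  apply: (@le_trans _ _ ((2 `^ p)%:E * (wavg nu nu (s i) (fun x => (`|extend Z (ext f) x - T| `^ p)%:E) z +
      wavg nu nu (s i) (fun x => (`|extend Z (ext f) x - f z| `^ p)%:E) z))).
    rewrite /wavg -ge0_muleDr ?integral_ge0// muleCA lee_wpmul2l ?lee_fin ?invr_ge0 ?vol_ge0//.
    rewrite -ge0_integralD//; last 2 first.
    - exact: (measurable_funTS (measurable_powR_dist _ _ mF)).
    - exact: (measurable_funTS (measurable_powR_dist _ _ mF)).
    rewrite -integralZl_nonneg ?powR_ge0//; last by move=> x _; rewrite adde_ge0.
    apply: le_integral_in => x _; first by rewrite lee_fin powR_ge0.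
    by rewrite -EFinD -EFinM lee_fin (distrC _ T); exact: dist_powR_le (ltW p0).
  apply: (@le_trans _ _ ((2 `^ p)%:E * ((e / (2 * 2 `^ p))%:E + (e / (2 * 2 `^ p))%:E))).
    apply: lee_wpmul2l; first by rewrite lee_fin powR_ge0.
    exact: leeD (ltW b2) b1.
  rewrite -EFinD -EFinM lee_fin le_eqVlt; apply/orP; left; apply/eqP.
  by field; rewrite gt_eqF.
have : (`|T - f z| `^ p <= 0)%R.
  by rewrite leNgt; apply/negP => h0; have := key _ (divr_gt0 h0 (ltr0Sn R 1)); lra.
move=> h; have : (`|T - f z| `^ p == 0)%R by rewrite eq_le h powR_ge0.
by rewrite powR_eq0 normr_eq0 subr_eq0 => /andP[/eqP].
Qed.

End ExtensionOperator.

Theorem theorem1p11 (R : realType) (alpha p theta : R) (q : \bar R)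
    (diamZ Cnu Ctheta : R)
    (p_ge1 : 1 <= p) (q_ge1 : (1%:E <= q)%E) (theta_gt0 : 0 < theta)
    (alpha_gt : theta / p < alpha) (alpha_lt1 : alpha < 1)
    (Cnu_ge1 : 1 <= Cnu) (Ctheta_ge1 : 1 <= Ctheta) :
  exists (C : R) (C' : R -> R),
    [/\ 1 <= C, forall delta, 1 <= C' delta &
  forall (W : completeMetricType R) (Z : set W)
    (nu pi : {measure set (borel W) -> \bar R}),
    closure Z = setT ->
    locally_compact_in Z -> ~ complete_in Z ->
    metric_bounded Z -> diam Z = diamZ ->
    nu (boundary Z) = 0%E -> doubling nu Z Cnu ->
    pi Z = 0%E -> codim_regular nu pi Z theta Ctheta ->
    0 < diam (boundary Z) ->
  exists T : (W -> R) -> (W -> R),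
    [/\ bounded_linear_besov nu Z alpha pi (boundary Z) (alpha - theta / p) p q T,
        forall u, besov_space nu Z alpha p q u ->
          {ae pi, forall z, boundary Z z ->
            ball_avg nu Z (fun x => (`|u x - T u z| `^ p)%:E) z r
              @[r --> (0 : R)^'+] --> 0%E},
        forall u, besov_space nu Z alpha p q u ->
          (besov_seminorm pi (boundary Z) (alpha - theta / p) p q (T u)
             <= C%:E * besov_seminorm nu Z alpha p q u)%E,
        forall u, besov_space nu Z alpha p q u ->
          (Lp_norm pi (boundary Z) p (T u)
             <= (C' (diam (boundary Z)))%:E *
                (Lp_norm nu Z p u + besov_seminorm nu Z alpha p q u))%E &
        forall (w : whitney_data W) (Cw : R), 0 < Cw -> is_whitney Z Cnu Cw w ->
          bounded_linear_besov pi (boundary Z) (alpha - theta / p) nu Z alpha p q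
            (whitney_extension Z pi w) /\
          forall f, besov_space pi (boundary Z) (alpha - theta / p) p q f ->
            {ae pi, forall z, boundary Z z -> T (whitney_extension Z pi w f) z = f z}]].
Proof.
have [C C0 hC] :=
  trace_seminorm_bound p_ge1 q_ge1 alpha_gt theta_gt0 Cnu_ge1 Ctheta_ge1.
have /choice[C' hC'] : forall delta : R, exists C1 : R, 1 <= C1 /\
    forall (W : completeMetricType R) (Z : set W) (nu pi : {measure set (borel W) -> \bar R}),
    regular_domain Z nu pi theta Cnu Ctheta -> diam (boundary Z) = delta ->
    forall u, besov_space nu Z alpha p q u ->
    (Lp_norm pi (boundary Z) p (trace_of Z nu u) <=
      C1%:E * (Lp_norm nu Z p u + besov_seminorm nu Z alpha p q u))%E.
  move=> delta.
  have [C1 C11 h1] :=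
    trace_Lp_bound p_ge1 q_ge1 alpha_gt theta_gt0 Cnu_ge1 Ctheta_ge1 delta.
  by exists C1.
exists (1 + C), C'; split; first by rewrite lerDl ltW.
  by move=> delta; have [] := hC' delta.
move=> W Z nu pi dense lc _ bd _ nu0 dbl pi0 cod diam0.
have dom : regular_domain Z nu pi theta Cnu Ctheta by split.
exists (trace_of Z nu); split.
- exact: (trace_bounded_linear p_ge1 q_ge1 alpha_gt theta_gt0 Cnu_ge1 Ctheta_ge1 dom).
- by move=> u Bu; exact: (trace_of_limit_ae dom p_ge1 q_ge1 alpha_gt Bu).
- move=> u Bu; apply: le_trans (hC _ _ _ _ dom u Bu) _.
  apply: lee_wpmul2r; last by rewrite lee_fin lerDr.
  by rewrite (seminorm_osc dom Bu) seminorm_of_ge0// => t; exact: osc_ge0.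
- by move=> u Bu; exact: (hC' _).2 _ _ _ _ dom erefl u Bu.
move=> w Cw Cw0 hw; split; first by
  exact: (extension_bounded_linear dom p_ge1 q_ge1 alpha_gt alpha_lt1 Cw0 hw).
by move=> f Bf; exact: (trace_extension dom p_ge1 q_ge1 alpha_gt alpha_lt1 Cw0 hw Bf).
Qed.
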